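(* Let $(\mathcal V,\langle\cdot,\cdot\rangle)$ be a nonzero metric generalized Jordan superpair (finite-dimensional, over $\mathbb F$) and let $n>1$ be an integer. Put $d_{\bar 0}=\dim\mathcal V^+_{\bar 0}$, $d_{\bar 1}=\dim\mathcal V^+_{\bar 1}$ and assume: $n\le d_{\bar 1}$ if $d_{\bar 0}=0$; and $\operatorname{char}\mathbb F=0$ or $\operatorname{char}\mathbb F>n$ if $d_{\bar 0}>0$. Let $\mathcal W=\bigvee^n\mathcal V$ be the $n$-th symmetric superpower of $\mathcal V$. Then: 1) The bilinear form of $\mathcal W$ is determined, for parity-ordered elements $\vee_i f_i\in\bigvee^{(p,n-p)}\mathcal V^-$ and $\vee_j v_j\in\bigvee^{(q,n-q)}\mathcal V^+$, by $$\langle \vee_i f_i,\vee_j v_j\rangle=\omega_{n-p}\,\mathrm{perdet}_{p,n-p}\big((\langle f_i,v_j\rangle)_{ij}\big),$$ which is zero if $p\ne q$. 2) Let $\sigma\in\{+,-\}$. For parity-ordered elements $\vee_i f_i\in\bigvee^{(p,n-p)}\mathcal V^{-\sigma}$ and $\vee_j v_j\in\bigvee^{(q,n-q)}\mathcal V^{\sigma}$, the spanning elements of $\mathfrak{instr}(\mathcal W)$ are of the form $$\nu(\vee_i f_i,\vee_j v_j)=\omega_{n-p}\sum_{i,j=1}^n\check\varsigma_{p,q}(i,j)\,\check{\mathcal M}_{ij}(B)\,\nu(f_i,v_j),$$ where $B=(\langle f_i,v_j\rangle)_{ij}$ is regarded as an even supermatrix in $\mathcal M_{(p|n-p)\times(q|n-q)}(\mathbb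 F)$, and the elements $\nu(f_i,v_j)\in\mathfrak{instr}(\mathcal V)$ on the right-hand side are understood through their action on $\bigvee^n\mathcal V^-$ and $\bigvee^n\mathcal V^+$. 3) For parity-ordered elements $\vee_i f_i\in\bigvee^{(p,n-p)}\mathcal V^{-\sigma}$, $\vee_j v_j\in\bigvee^{(q,n-q)}\mathcal V^{\sigma}$, $\vee_k g_k\in\bigvee^{(r,n-r)}\mathcal V^{-\sigma}$, with $\sigma\in\{+,-\}$ and $B$ as in 2), the triple products of $\mathcal W$ are given by $$\{\vee_i f_i,\vee_j v_j,\vee_k g_k\}=\omega_{n-p}\sum_{i,j,k=1}^n\check\varsigma_{p,q}(i,j)\check{\mathcal M}_{ij}(B)\Big(\prod_{t<k}\eta_{g_t,D_{f_i,v_j}}\Big)\,g_1\vee\dots\vee\{f_i,v_j,g_k\}\vee\dots\vee g_n .$$ 4) There is a morphism of affine group schemes $\check\Omega_n\colon\mathbf{Aut}(\mathcal V,\langle\cdot,\cdot\rangle)\to\mathbf{Aut}(\mathcal W,\langle\cdot,\cdot\rangle)$ given by $\varphi=(\varphi^-,\varphi^+)\mapsto\varphi^{\vee n}:=((\varphi^-)^{\vee n},(\varphi^+)^{\vee n})$, where $(\varphi^\sigma)^{\vee n}(\vee_i x_i)=\vee_i\varphi^\sigma(x_i)$. Furthermore: i) If $\mathcal V$ is odd (i.e. $\mathcal V^\pm_{\bar 0}=0$) and $\dim\mathcal V^{\pm}=n$, then $\ker\check\Omega_n=\mathbf{SL}_n\cap\mathbf{Aut}(\mathcal V,\langle\cdot,\cdot\rangle)$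 (viewing $\mathbf{Aut}(\mathcal V,\langle\cdot,\cdot\rangle)$ inside $\mathbf{GL}(\mathcal V^+)\simeq\mathbf{GL}_n$ via $\varphi\mapsto\varphi^+$), $\mathbf{Aut}(\mathcal W,\langle\cdot,\cdot\rangle)\simeq\mathbf G_m$, and $\mathbf{Aut}(\mathcal V,\langle\cdot,\cdot\rangle)/\ker\check\Omega_n$ is isomorphic to a subgroup scheme of $\mathbf{Aut}(\mathcal W,\langle\cdot,\cdot\rangle)$. ii) Otherwise, $\ker\check\Omega_n=\boldsymbol\mu_n$ (i.e. over each $R$ it is $\{c_\lambda : \lambda\in R,\ \lambda^n=1\}$), and $\mathbf{Aut}(\mathcal V,\langle\cdot,\cdot\rangle)/\boldsymbol\mu_n$ is isomorphic to a subgroup scheme of $\mathbf{Aut}(\mathcal W,\langle\cdot,\cdot\rangle)$.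
   Context: $\mathbb F$ is a field with $\operatorname{char}\mathbb F\neq2$; $R$ denotes an arbitrary associative commutative unital $\mathbb F$-algebra. A vector superspace is a $\mathbb Z_2$-graded space $V=V_{\bar0}\oplus V_{\bar1}$ with parity $\varepsilon$; for homogeneous elements (or homogeneous maps) $\eta_{x,y}=(-1)^{\varepsilon(x)\varepsilon(y)}$ and $\eta_{x,y,z}=(-1)^{\varepsilon(x)\varepsilon(y)+\varepsilon(y)\varepsilon(z)+\varepsilon(z)\varepsilon(x)}$. ''Lie superalgebra'' means a superalgebra with $[x,y]=-\eta_{x,y}[y,x]$ and $[x,[y,z]]=[[x,y],z]+\eta_{x,y}[y,[x,z]]$ for homogeneous elements. Supermodules satisfy $[x,y]\cdot v=x\cdot(y\cdot v)-\eta_{x,y}\,y\cdot(x\cdot v)$ and respect the grading. On $\mathrm{End}(V)$, $[x,y]=xy-\eta_{x,y}yx$. Metric generalized Jordan superpairs. A trilinear superpair is a pair $\mathcal V=(\mathcal V^-,\mathcal V^+)$ of vector superspaces with trilinear maps $\{\cdot,\cdot,\cdot\}^\sigma\colon\mathcal V^\sigma\times\mathcal V^{-\sigma}\times\mathcal V^\sigma\to\mathcal V^\sigma$ ($\sigma=\pm$) compatible with the $\mathbb Z_2$-gradings; $D^\sigma_{x,y}z:=\{x,y,z\}^\sigma$, and $D_{x,y}$ has parity $\varepsilon(x)+\varepsilon(y)$. It is a generalized Jordan superpair if $[D^\sigma_{x,y},D^\sigma_{z,w}]=D^\sigma_{D^\sigma_{x,y}z,w}-\eta_{x,y,z}D^\sigma_{z,D^{-\sigma}_{y,x}w}$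 for homogeneous elements. It is metric if it is finite-dimensional and endowed with a nondegenerate bilinear form $\langle\cdot,\cdot\rangle\colon\mathcal V^-\times\mathcal V^+\to\mathbb F$ which is even ($\langle x,y\rangle=0$ if $\varepsilon(x)\ne\varepsilon(y)$), superinvariant ($\langle D_{x,y}z,w\rangle=\eta_{x,y,z}\langle z,D_{y,x}w\rangle$) and supersymmetric ($\langle D_{x,y}z,w\rangle=\eta_{D_{x,y},D_{z,w}}\langle D_{z,w}x,y\rangle$ and $\langle x,D_{y,z}w\rangle=\eta_{D_{x,y},D_{z,w}}\langle z,D_{w,x}y\rangle$). Convention: $\langle v,f\rangle:=\eta_{f,v}\langle f,v\rangle$ for $f\in\mathcal V^-$, $v\in\mathcal V^+$. $\mathbf{Aut}(\mathcal V,\langle\cdot,\cdot\rangle)$ is the affine group scheme whose $R$-points are pairs $\varphi=(\varphi^-,\varphi^+)$ of even $R$-linear bijections of $\mathcal V^\pm\otimes R$ preserving the triple products and the form. For $\lambda\in R^\times$, $c_\lambda=(\lambda^{-1}\mathrm{id},\lambda\,\mathrm{id})$ is such an automorphism. $\mathbf G_m=\mathbf{GL}_1$; $\boldsymbol\mu_n$ is the group scheme of $n$-th roots of unity. Inner structure superalgebra. For homogeneous $f\in\mathcal V^-$, $v\in\mathcal V^+$ put $\nu(f,v)=(D_{f,v},-\eta_{f,v}D_{v,f})\in\mathrm{End}(\mathcal V^-)\times\mathrm{End}(\mathcal V^+)$ and $\nu(v,f)=-\eta_{f,v}\nu(f,v)$. $\mathfrak{instr}(\mathcal V)$ is the span of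 all $\nu(f,v)$, a Lie superalgebra acting on $\mathcal V^\pm$. It carries a unique nondegenerate even invariant ($b([x,y],z)=b(x,[y,z])$) supersymmetric ($b(x,y)=\eta_{x,y}b(y,x)$) form $b$ with $b(x,\nu(f,v))=\langle x\cdot f,v\rangle$. Symmetric superpower. For a finite-dimensional vector superspace $M$, the symmetric group $S_n$ acts on $M^{\otimes n}$ with $(i\ \,i{+}1)$ acting by $v_1\otimes\dots\otimes v_n\mapsto\eta_{v_i,v_{i+1}}v_1\otimes\dots\otimes v_{i+1}\otimes v_i\otimes\dots\otimes v_n$. $\bigvee^nM$ is the quotient of $M^{\otimes n}$ by the span of all $v-\sigma\cdot v$; the class of $v_1\otimes\dots\otimes v_n$ is $\vee_iv_i=v_1\vee\dots\vee v_n$, of parity $\sum\varepsilon(v_i)$. The subspace $\bigvee^{(k,n-k)}M$ is spanned by the parity-ordered elements $\vee_i v_i$ with $v_i$ even for $i\le k$ and odd for $i>k$; ''parity-ordered element of $\bigvee^{(k,n-k)}M$'' means such a $\vee_iv_i$. If $M$ is an $L$-supermodule, $L$ acts on $\bigvee^nM$ by $x\cdot(\vee_iv_i)=\sum_i(\prod_{k<i}\eta_{x,v_k})v_1\vee\dots\vee(x\cdot v_i)\vee\dots\vee v_n$. On $(\mathcal V^-)^{\otimes n}\times(\mathcal V^+)^{\otimes n}$ put $\langle\otimes_if_i,\otimes_jv_j\rangle=\big(\prod_{j<i}\eta_{f_i,v_j}\big)\prod_i\langle f_i,v_i\rangle$; then $F(f,v)=\sum_{\sigma\in S_n}\langle f,\sigma\cdot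 v\rangle$ induces a bilinear form on $\bigvee^n\mathcal V^-\times\bigvee^n\mathcal V^+$, called the $n$-th symmetric superpower of the form of $\mathcal V$; under the stated hypotheses it is a nondegenerate pairing of $\mathfrak{instr}(\mathcal V)$-supermodules. The metric generalized Jordan superpair $\mathcal W=\bigvee^n\mathcal V$ is obtained by the Faulkner construction with $L=\mathfrak{instr}(\mathcal V)$ and $b$: $\mathcal W^\pm=\bigvee^n\mathcal V^\pm$, the bilinear form is the one just described, $[f,v]\in L$ ($f\in\mathcal W^-,v\in\mathcal W^+$) is defined by $b(x,[f,v])=\langle x\cdot f,v\rangle$ for all $x\in L$, $[v,f]:=-\eta_{f,v}[f,v]$, and $\{f,v,g\}^-=[f,v]\cdot g$, $\{v,f,w\}^+=[v,f]\cdot w$. $\nu$ and $\mathfrak{instr}$ for $\mathcal W$ are defined as for $\mathcal V$. Further notation. $\omega_k=(-1)^{k(k-1)/2}$. For $A=(a_{ij})\in\mathcal M_n(\mathbb F)$ and $0\le k\le n$, $\mathrm{perdet}_{k,n-k}(A)=\mathrm{per}((a_{ij})_{1\le i,j\le k})\,\det((a_{ij})_{k<i,j\le n})$, where $\mathrm{per}$ is the permanent and empty determinants and permanents equal $1$. For $1\le i,j\le n$ and $0\le p,q\le n$: $\check\varsigma_{p,q}(i,j)=1$ if $i\le p,j\le q$; $(-1)^{j+n}$ if $i\le p,j>q$; $(-1)^{i+n}$ if $i>p,j\le q$; $(-1)^{i+j}$ if $i>p,j>q$. For an $n\times n$ matrix $B$ with rows $1,\dots,p$ and columns $1,\dots,q$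 called even and the other rows and columns odd (entries of mixed parity being zero), the symmetric $(i,j)$-superminor $\check{\mathcal M}_{ij}(B)$ is obtained by deleting row $i$ and column $j$: it is $0$ if the numbers of remaining even rows and remaining even columns differ; otherwise it is the permanent of the remaining even-even block times the determinant of the remaining odd-odd block. *)

(* Defs.v *)
From HB Require Import structures.
From mathcomp Require Import all_boot all_order all_algebra all_fingroup.
From mathcomp Require Import boolp classical_sets.

Set Implicit Arguments.
Unset Strict Implicit.
Unset Printing Implicit Defensive.

Import GRing.Theory.
Local Open Scope ring_scope.

(* Parities are booleans: [false] is even, [true] is odd. *)

Definition eta {F : fieldType} (a b : bool) : F := (-1) ^+ (a && b).

Definition eta3 {F : fieldType} (a b c : bool) : F :=
  eta a b * eta b c * eta c a.

Record superspace (F : fieldType) := Superspace {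
  ssort :> vectType F;
  gr : bool -> {vspace ssort};
  gr_full : (gr false + gr true = fullv)%VS;
  gr_direct : (gr false :&: gr true = 0)%VS }.

Section Superspace.
Variables (F : fieldType) (M : superspace F).

Definition hdim : nat := \dim (gr M false) + \dim (gr M true).

(* A homogeneous basis, even vectors first. *)
Definition hbasis : hdim.-tuple M :=
  [tuple of vbasis (gr M false) ++ vbasis (gr M true)].

Definition hb (k : 'I_hdim) : M := tnth hbasis k.

Definition hpar (k : 'I_hdim) : bool := (\dim (gr M false) <= k)%N.

Definition hcoord (k : 'I_hdim) (v : M) : F := coord hbasis k v.

Definition hcomp (a : bool) (v : M) : M := daddv_pi (gr M a) (gr M (~~ a)) v.

(* The parity of a homogeneous vector (the zero vector being counted as even). *)
Definition par (v : M) : bool := v \notin gr M false.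

End Superspace.

(* For homogeneous x and y, [twist B y x = eta_{x,y} B x y]. *)
Definition twist (F : fieldType) (M N : superspace F) (U : lmodType F)
    (B : M -> N -> U) (y : N) (x : M) : U :=
  \sum_(a : bool) \sum_(b : bool) eta a b *: B (hcomp a x) (hcomp b y).

Section SymmetricSuperpower.
Variables (F : fieldType) (n : nat) (M : superspace F).

Definition tidx := {ffun 'I_n -> 'I_(hdim M)}.

(* The n-th tensor power of M, in coordinates with respect to the basis of
   tensor products of vectors of [hbasis M]. *)
Definition tpow : vectType F := {ffun tidx -> F^o}.

Definition tens (v : 'I_n -> M) : tpow :=
  [ffun t : tidx => \prod_i hcoord (t i) (v i)].

(* Sign of the permutation s acting on homogeneous factors of parities a:
   one factor eta for each pair whose order is exchanged.  This is the action
   for which (i i+1) exchanges two neighbours with the sign eta; the i-th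
   factor is sent to the s(i)-th place. *)
Definition ksgn (s : 'S_n) (a : 'I_n -> bool) : F :=
  \prod_(i < n) \prod_(j < n | (i < j)%N && (s j < s i)%N) eta (a i) (a j).

Definition tact (s : 'S_n) (x : tpow) : tpow :=
  [ffun t : tidx => ksgn s (fun i => hpar (t (s i))) * x [ffun i => t (s i)]].

Fact tact_is_linear s : linear (tact s).
Proof.
move=> k x y; apply/ffunP => t; rewrite !ffunE mulrDr; congr (_ + _).
by rewrite /GRing.scale /= mulrCA.
Qed.
HB.instance Definition _ s :=
  GRing.isLinear.Build F tpow tpow *:%R (tact s) (tact_is_linear s).

Definition tpar (t : tidx) : bool := odd (\sum_i hpar (t i))%N.

Definition tproj (a : bool) (x : tpow) : tpow :=
  [ffun t : tidx => if tpar t == a then x t else 0].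

Fact tproj_is_linear a : linear (tproj a).
Proof.
move=> k x y; apply/ffunP => t; rewrite !ffunE; case: ifP => // _.
by rewrite scaler0 addr0.
Qed.
HB.instance Definition _ a :=
  GRing.isLinear.Build F tpow tpow *:%R (tproj a) (tproj_is_linear a).

Definition symker : {vspace tpow} :=
  (\sum_(s : 'S_n) limg (\1 - linfun (tact s))%VF)%VS.

(* The quotient of tpow by symker, realized on a complement of symker. *)
Definition sympow_sort : vectType F := subvs_of (symker^C)%VS.

Definition cls : 'Hom(tpow, sympow_sort) :=
  linfun (vsproj (symker^C)%VS \o daddv_pi (symker^C)%VS symker).

Lemma symker_compl : (symker^C :&: symker = 0)%VS.
Proof. by rewrite capvC capv_compl. Qed.

Lemma clsE x : vsval (cls x) = daddv_pi (symker^C)%VS symker x.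
Proof. by rewrite lfunE /= vsprojK // memv_pi. Qed.

Lemma cls_val w : cls (vsval w) = w.
Proof.
by apply/val_inj/(etrans (clsE _)); rewrite daddv_pi_id ?symker_compl ?subvsP.
Qed.

Lemma cls_eq0 x : (cls x == 0) = (x \in symker).
Proof.
have E : daddv_pi (symker^C)%VS symker x + daddv_pi symker (symker^C)%VS x = x.
  by rewrite daddv_pi_add ?symker_compl // addvC addv_complf memvf.
apply/eqP/idP => [/(congr1 vsval) H|H].
  by rewrite -E -clsE H add0r memv_pi.
apply/val_inj/(etrans (clsE _)); apply: (addIr x).
by rewrite -{2}(daddv_pi_id (capv_compl _) H) E /= add0r.
Qed.

Lemma tpar_perm (s : 'S_n) (t : tidx) : tpar [ffun i => t (s i)] = tpar t.
Proof.
rewrite /tpar [in RHS](reindex_inj (@perm_inj _ s)) /=.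
by congr (odd _); apply: eq_bigr => i _; rewrite ffunE.
Qed.

Lemma tproj_tact a s x : tproj a (tact s x) = tact s (tproj a x).
Proof.
apply/ffunP => t; rewrite !ffunE tpar_perm; case: ifP => // _.
by rewrite mulr0.
Qed.

Lemma tproj_symker a x : x \in symker -> tproj a x \in symker.
Proof.
case/memv_sumP => y yP ->; rewrite linear_sum; apply: memv_suml => s _.
have /memv_imgP[z _ ->] := yP s isT.
apply: (subvP (sumv_sup s isT (subvv _))).
apply/memv_imgP; exists (tproj a z); rewrite ?memvf //.
by rewrite !lfun_simp /= linearB /= tproj_tact.
Qed.

Definition sympow_gr (a : bool) : {vspace sympow_sort} :=
  (cls @: limg (linfun (tproj a)))%VS.

Lemma sympow_grP a w :
  reflect (exists x, w = cls (tproj a x)) (w \in sympow_gr a).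
Proof.
apply: (iffP memv_imgP) => [[_ /memv_imgP[x _ ->] ->]|[x ->]].
  by exists x; congr (cls _); rewrite lfunE.
exists (tproj a x) => //; apply/memv_imgP.
by exists x; rewrite ?memvf // lfunE.
Qed.

Lemma sympow_gr_full : (sympow_gr false + sympow_gr true = fullv)%VS.
Proof.
apply/vspaceP => w; rewrite memvf.
have -> : w = cls (tproj false (vsval w)) + cls (tproj true (vsval w)).
  rewrite -linearD -{1}(cls_val w); congr (cls _); apply/ffunP => t.
  by rewrite !ffunE; case: (tpar t); rewrite ?addr0 ?add0r.
by apply: memv_add; apply/sympow_grP; exists (vsval w).
Qed.

Lemma sympow_gr_direct : (sympow_gr false :&: sympow_gr true = 0)%VS.
Proof.
apply/eqP; rewrite -subv0; apply/subvP => w.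
rewrite memv_cap => /andP[/sympow_grP[x ->] /sympow_grP[y /eqP]].
rewrite -subr_eq0 -linearB cls_eq0 => /(tproj_symker false).
have -> : tproj false (tproj false x - tproj true y) = tproj false x.
  by apply/ffunP => t; rewrite !ffunE; case: (tpar t); rewrite /= ?subr0.
by rewrite memv0 cls_eq0.
Qed.

Definition sympow : superspace F := Superspace sympow_gr_full sympow_gr_direct.

Definition vee (v : 'I_n -> M) : sympow := cls (tens v).

(* [v] lists p even vectors followed by n - p odd ones. *)
Definition parity_ordered (p : nat) (v : 'I_n -> M) : Prop :=
  forall i : 'I_n, v i \in gr M (p <= i)%N.

Definition endo_part (a : bool) (g : M -> M) (v : M) : M :=
  \sum_(c : bool) hcomp (c (+) a) (g (hcomp c v)).

(* Action of an endomorphism of M on the symmetric superpower, by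
   superderivation; [vsval w] is a representative of w in the tensor power. *)
Definition sympow_act (g : M -> M) (w : sympow) : sympow :=
  \sum_(a : bool) \sum_(t : tidx) (vsval w) t *:
    \sum_(i < n) (\prod_(k < n | (k < i)%N) eta a (hpar (t k))) *:
      vee (fun k => if k == i then endo_part a g (hb (t k)) else hb (t k)).

End SymmetricSuperpower.

Section SymmetricForm.
Variables (F : fieldType) (n : nat) (M N : superspace F) (B : M -> N -> F).

Definition tens_form (x : tpow n M) (y : tpow n N) : F :=
  \sum_(s : tidx n M) \sum_(t : tidx n N) x s * y t *
    ((\prod_(i < n) \prod_(j < n | (j < i)%N) eta (hpar (s i)) (hpar (t j))) *
     \prod_i B (hb (s i)) (hb (t i))).

(* The form induced on the quotients, computed on representatives. *)
Definition sympow_form (w : sympow n M) (z : sympow n N) : F :=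
  \sum_(s : 'S_n) tens_form (vsval w) (tact s (vsval z)).

End SymmetricForm.

(* The index [false] stands for the sign - and [true] for the sign +. *)
Record superpair (F : fieldType) := Superpair {
  sp :> bool -> superspace F;
  tneg : sp false -> sp true -> sp false -> sp false;
  tpos : sp true -> sp false -> sp true -> sp true;
  spform : sp false -> sp true -> F }.

Section Superpair.
Variables (F : fieldType) (V : superpair F).

(* [trip] and [pairing] give access to the triple products and to the form for
   a variable sign s; only their values at (s, ~~ s) are meaningful. *)
Definition trip (s t : bool) : V s -> V t -> V s -> V s :=
  match s, t with
  | false, true => @tneg F V
  | true, false => @tpos F V
  | _, _ => fun _ _ _ => 0
  end.

Definition pairing (s t : bool) : V s -> V t -> F :=
  match s, t with
  | false, true => @spform F V
  | true, false => twist (U := F^o) (@spform F V)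
  | _, _ => fun _ _ => 0
  end.

Definition endpair : vectType F := ('End(V false) * 'End(V true))%type.

Definition ecomp (x : endpair) (s : bool) : 'End(V s) :=
  match s with false => x.1 | true => x.2 end.

Definition nu0 (f : V false) (v : V true) : endpair :=
  (linfun (tneg f v), linfun (fun w => - twist (fun g u => tpos u g w) v f)).

Definition nu (s t : bool) : V s -> V t -> endpair :=
  match s, t with
  | false, true => nu0
  | true, false => fun v f => - twist nu0 v f
  | _, _ => fun _ _ => 0
  end.

(* As nu0 is bilinear, the homogeneous basis vectors suffice. *)
Definition instr : {vspace endpair} :=
  <<[seq nu0 (hb k.1) (hb k.2)
      | k : 'I_(hdim (V false)) * 'I_(hdim (V true))]>>%VS.

Definition ehom (a : bool) (x : endpair) : Prop :=
  forall s c v, v \in gr (V s) c -> ecomp x s v \in gr (V s) (c (+) a).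

Definition ebracket (a b : bool) (x y : endpair) : endpair :=
  (((x.1 \o y.1) - eta a b *: (y.1 \o x.1))%VF,
   ((x.2 \o y.2) - eta a b *: (y.2 \o x.2))%VF).

Record is_instr_form (b : endpair -> endpair -> F) : Prop := {
  instr_form_linl : forall k x y z, x \in instr -> y \in instr ->
    z \in instr -> b (k *: x + y) z = k * b x z + b y z;
  instr_form_linr : forall k x y z, x \in instr -> y \in instr ->
    z \in instr -> b z (k *: x + y) = k * b z x + b z y;
  instr_form_nondeg : forall x, x \in instr ->
    (forall y, y \in instr -> b x y = 0) -> x = 0;
  instr_form_even : forall a c x y, x \in instr -> y \in instr ->
    ehom a x -> ehom c y -> a != c -> b x y = 0;
  instr_form_inv : forall a c d x y z,
    x \in instr -> y \in instr -> z \in instr ->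
    ehom a x -> ehom c y -> ehom d z ->
    b (ebracket a c x y) z = b x (ebracket c d y z);
  instr_form_sym : forall a c x y, x \in instr -> y \in instr ->
    ehom a x -> ehom c y -> b x y = eta a c * b y x;
  instr_form_nu : forall x f v, x \in instr ->
    b x (nu0 f v) = spform (x.1 f) v }.

Definition instr_form : endpair -> endpair -> F :=
  xget (fun _ _ => 0) [set b | is_instr_form b]%classic.

Record trilinear_superpair : Prop := {
  trip_linear1 : forall s (y : V (~~ s)) (z : V s),
    linear (fun x => trip x y z);
  trip_linear2 : forall s (x z : V s),
    linear (fun y : V (~~ s) => trip x y z);
  trip_linear3 : forall s (x : V s) (y : V (~~ s)), linear (trip x y);
  trip_graded : forall s a b c (x : V s) (y : V (~~ s)) (z : V s),
    x \in gr (V s) a -> y \in gr (V (~~ s)) b -> z \in gr (V s) c ->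
    trip x y z \in gr (V s) (a (+) b (+) c) }.

Definition generalized_jordan : Prop :=
  forall s a b c d (x z u : V s) (y w : V (~~ s)),
    x \in gr (V s) a -> y \in gr (V (~~ s)) b ->
    z \in gr (V s) c -> w \in gr (V (~~ s)) d ->
    trip x y (trip z w u) - eta (a (+) b) (c (+) d) *: trip z w (trip x y u) =
    trip (trip x y z) w u - eta3 a b c *: trip z (trip y x w) u.

Record metric_form : Prop := {
  form_linear1 : forall y : V true,
    linear (fun x : V false => @spform F V x y : F^o);
  form_linear2 : forall x : V false,
    linear (fun y : V true => @spform F V x y : F^o);
  form_nondeg1 : forall x : V false, (forall y, spform x y = 0) -> x = 0;
  form_nondeg2 : forall y : V true, (forall x, spform x y = 0) -> y = 0;
  form_even : forall a b (x : V false) (y : V true),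
    x \in gr (V false) a -> y \in gr (V true) b -> a != b -> spform x y = 0;
  form_superinvariant : forall a b c (x z : V false) (y w : V true),
    x \in gr (V false) a -> y \in gr (V true) b -> z \in gr (V false) c ->
    spform (tneg x y z) w = eta3 a b c * spform z (tpos y x w);
  form_supersym1 : forall a b c d (x z : V false) (y w : V true),
    x \in gr (V false) a -> y \in gr (V true) b ->
    z \in gr (V false) c -> w \in gr (V true) d ->
    spform (tneg x y z) w =
    eta (a (+) b) (c (+) d) * spform (tneg z w x) y;
  form_supersym2 : forall a b c d (x z : V false) (y w : V true),
    x \in gr (V false) a -> y \in gr (V true) b ->
    z \in gr (V false) c -> w \in gr (V true) d ->
    spform x (tpos y z w) =
    eta (a (+) b) (c (+) d) * spform z (tpos w x y) }.

(* Finite-dimensionality is built in: superspaces have a vectType carrier. *)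
Record metric_generalized_jordan_superpair : Prop := {
  mgjs_trilinear : trilinear_superpair;
  mgjs_jordan : generalized_jordan;
  mgjs_metric : metric_form }.

Variable n : nat.

(* [faulkner_bracket f v] is the element z of instr such that
   b(x, z) = <x . f, v> for all x in instr. *)
Definition faulkner_bracket
    (f : sympow n (V false)) (v : sympow n (V true)) : endpair :=
  xget 0 [set z | z \in instr /\ forall x, x \in instr ->
    instr_form x z = sympow_form (@spform F V) (sympow_act x.1 f) v]%classic.

Definition sympair : superpair F := @Superpair F
  (fun s => sympow n (V s))
  (fun f v g => sympow_act (faulkner_bracket f v).1 g)
  (fun v f w => sympow_act (- twist faulkner_bracket v f : endpair).2 w)
  (sympow_form (@spform F V)).

End Superpair.

Definition sympair_act (F : fieldType) (V : superpair F) (n : nat)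
    (x : endpair V) : endpair (sympair V n) :=
  (linfun (sympow_act (n := n) x.1), linfun (sympow_act (n := n) x.2)).

Definition omega {F : fieldType} (k : nat) : F := (-1) ^+ (k * k.-1 %/ 2).

Definition permanent (F : fieldType) (m : nat) (A : 'M[F]_m) : F :=
  \sum_(s : 'S_m) \prod_i A i (s i).

Definition mxnth (F : fieldType) (m : nat) (A : 'M[F]_m) (i j : nat) : F :=
  match insub i, insub j with Some i', Some j' => A i' j' | _, _ => 0 end.

Definition perdet (F : fieldType) (m k : nat) (A : 'M[F]_m) : F :=
  permanent (\matrix_(i < k, j < k) mxnth A i j) *
  \det (\matrix_(i < m - k, j < m - k) mxnth A (k + i) (k + j)).

(* Indices start at 0 here, hence the successors in the exponents. *)
Definition scheck {F : fieldType} (n p q : nat) (i j : 'I_n) : F :=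
  match (i < p)%N, (j < q)%N with
  | true, true => 1
  | true, false => (-1) ^+ (j.+1 + n)
  | false, true => (-1) ^+ (i.+1 + n)
  | false, false => (-1) ^+ (i.+1 + j.+1)
  end.

Definition superminor (F : fieldType) (n p q : nat) (B : 'M[F]_n)
    (i j : 'I_n) : F :=
  let p' := (p - (i < p))%N in
  let q' := (q - (j < q))%N in
  if p' == q' then perdet p' (row' i (col' j B)) else 0.

(* comAlgType excludes the zero algebra, on which a representable functor has
   a single point.  A homomorphism of affine group schemes is a quotient map
   (resp. a closed embedding) when its comorphism is injective (resp.
   surjective). *)

Record groupFunctor (F : fieldType) := GroupFunctor {
  pts :> comAlgType F -> groupType;
  pmap : forall R S : comAlgType F, {lrmorphism R -> S} -> pts R -> pts S;
  pmapM : forall (R S : comAlgType F) (g : {lrmorphism R -> S}) (x y : pts R),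
    pmap g (x * y)%g = (pmap g x * pmap g y)%g;
  pmap_id : forall (R : comAlgType F) (g : {lrmorphism R -> R}),
    g =1 id -> pmap g =1 id;
  pmap_comp : forall (R S T : comAlgType F) (g : {lrmorphism R -> S})
      (h : {lrmorphism S -> T}) (k : {lrmorphism R -> T}),
    k =1 h \o g -> pmap k =1 pmap h \o pmap g }.

Record gmor (F : fieldType) (G H : groupFunctor F) := Gmor {
  gm :> forall R : comAlgType F, G R -> H R;
  gmM : forall R (x y : G R), gm (x * y)%g = (gm x * gm y)%g;
  gm_nat : forall (R S : comAlgType F) (g : {lrmorphism R -> S}) (x : G R),
    gm (pmap g x) = pmap g (gm x) }.

Section GroupSchemes.
Variable F : fieldType.
Implicit Types G H Q : groupFunctor F.

Definition represents G (A : comAlgType F) (u : G A) : Prop :=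
  forall (R : comAlgType F) (x : G R),
    exists2 f : {lrmorphism A -> R}, pmap f u = x &
      forall f' : {lrmorphism A -> R}, pmap f' u = x -> f' =1 f.

Definition affine_group_scheme G : Prop :=
  exists (A : comAlgType F) (u : G A), represents u.

Definition isomorphic_gf G H : Prop :=
  exists (f : gmor G H) (g : gmor H G),
    (forall R, cancel (@gm _ _ _ f R) (@gm _ _ _ g R)) /\
    (forall R, cancel (@gm _ _ _ g R) (@gm _ _ _ f R)).

Definition is_comorphism G H (th : gmor G H) (A : comAlgType F) (u : G A)
    (B : comAlgType F) (w : H B) (f : {lrmorphism B -> A}) : Prop :=
  [/\ represents u, represents w & pmap f w = th A u].

Definition quotient_map G H (th : gmor G H) : Prop :=
  exists (A : comAlgType F) (u : G A) (B : comAlgType F) (w : H B)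
    (f : {lrmorphism B -> A}), is_comorphism th u w f /\ injective f.

Definition closed_embedding G H (th : gmor G H) : Prop :=
  exists (A : comAlgType F) (u : G A) (B : comAlgType F) (w : H B)
    (f : {lrmorphism B -> A}), is_comorphism th u w f /\
      forall a : A, exists b : B, f b = a.

(* Q, with the projection pi, is the quotient of G by the subgroup N. *)
Definition is_quotient G (N : forall R : comAlgType F, G R -> Prop) Q
    (pi : gmor G Q) : Prop :=
  quotient_map pi /\ forall R (x : G R), pi R x = 1%g <-> N R x.

Definition quotient_embeds G (N : forall R : comAlgType F, G R -> Prop) H :
    Prop :=
  exists (Q : groupFunctor F) (pi : gmor G Q) (i : gmor Q H),
    is_quotient N pi /\ closed_embedding i.

Definition gker G H (th : gmor G H) (R : comAlgType F) (x : G R) : Prop :=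
  th R x = 1%g.

End GroupSchemes.

(* The multiplicative group: a unit is given together with its inverse. *)
Section Gm.
Variable F : fieldType.

Record Gm_pts (R : comAlgType F) :=
  GmPts { gm_val : R * R; _ : gm_val.1 * gm_val.2 == 1 }.

HB.instance Definition _ (R : comAlgType F) := [isSub for @gm_val R].
HB.instance Definition _ (R : comAlgType F) := [Choice of Gm_pts R by <:].

Section Group.
Variable R : comAlgType F.
Implicit Types x y z : Gm_pts R.

Fact Gm_oneP : (1 : R) * 1 == 1. Proof. by rewrite mulr1. Qed.
Definition Gm_one : Gm_pts R := @GmPts R (1, 1) Gm_oneP.

Fact Gm_invP x : (val x).2 * (val x).1 == 1.
Proof. by rewrite mulrC; exact: (valP x). Qed.
Definition Gm_inv x : Gm_pts R := @GmPts R ((val x).2, (val x).1) (Gm_invP x).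

Fact Gm_mulP x y :
  ((val x).1 * (val y).1) * ((val x).2 * (val y).2) == 1.
Proof.
by rewrite mulrACA (eqP (valP x)) (eqP (valP y)) mulr1.
Qed.
Definition Gm_mul x y : Gm_pts R := @GmPts R (_, _) (Gm_mulP x y).

Fact Gm_mulA : associative Gm_mul.
Proof. by move=> x y z; apply: val_inj; congr pair; rewrite /= mulrA. Qed.
Fact Gm_mul1 : left_id Gm_one Gm_mul.
Proof.
by move=> x; apply: val_inj; rewrite /= !mul1r -surjective_pairing.
Qed.
Fact Gm_1mul : right_id Gm_one Gm_mul.
Proof.
by move=> x; apply: val_inj; rewrite /= !mulr1 -surjective_pairing.
Qed.
Fact Gm_mulV : left_inverse Gm_one Gm_inv Gm_mul.
Proof.
by move=> x; apply: val_inj; rewrite /= (eqP (valP x)) mulrC (eqP (valP x)).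
Qed.
Fact Gm_Vmul : right_inverse Gm_one Gm_inv Gm_mul.
Proof.
by move=> x; apply: val_inj; rewrite /= (eqP (valP x)) mulrC (eqP (valP x)).
Qed.

HB.instance Definition _ :=
  isGroup.Build (Gm_pts R) Gm_mulA Gm_mul1 Gm_1mul Gm_mulV Gm_Vmul.

End Group.

Fact Gm_mapP (R S : comAlgType F) (g : {lrmorphism R -> S}) (x : Gm_pts R) :
  g (val x).1 * g (val x).2 == 1.
Proof. by rewrite -rmorphM (eqP (valP x)) rmorph1. Qed.

Definition Gm_map (R S : comAlgType F) (g : {lrmorphism R -> S})
    (x : Gm_pts R) : Gm_pts S := @GmPts S (_, _) (Gm_mapP g x).

Fact Gm_mapM (R S : comAlgType F) (g : {lrmorphism R -> S}) (x y : Gm_pts R) :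
  Gm_map g (x * y)%g = (Gm_map g x * Gm_map g y)%g.
Proof. by apply: val_inj; rewrite /= !rmorphM. Qed.

Fact Gm_map_id (R : comAlgType F) (g : {lrmorphism R -> R}) :
  g =1 id -> Gm_map g =1 id.
Proof.
by move=> gid x; apply: val_inj; rewrite /= !gid -surjective_pairing.
Qed.

Fact Gm_map_comp (R S T : comAlgType F) (g : {lrmorphism R -> S})
    (h : {lrmorphism S -> T}) (k : {lrmorphism R -> T}) :
  k =1 h \o g -> Gm_map k =1 Gm_map h \o Gm_map g.
Proof. by move=> kE x; apply: val_inj; rewrite /= !kE. Qed.

Definition Gm : groupFunctor F := @GroupFunctor F
  (fun R => Gm_pts R : groupType) Gm_map Gm_mapM Gm_map_id Gm_map_comp.

End Gm.

(* Scalar extension: for a superspace M, the R-module of M (x) R is 'cV[R]_d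
   with d = hdim M, a vector being given by its coordinates with respect to
   hbasis M.  R-linear endomorphisms of M (x) R are matrices acting on
   the left. *)

Section ScalarExtension.
Variables (F : fieldType) (R : comAlgType F).

(* w (x) 1 *)
Definition ext1 (M : superspace F) (w : M) : 'cV[R]_(hdim M) :=
  \col_k (hcoord k w)%:A.

Definition tripR (V : superpair F) (s t : bool) (x : 'cV[R]_(hdim (V s)))
    (y : 'cV[R]_(hdim (V t))) (z : 'cV[R]_(hdim (V s))) :
    'cV[R]_(hdim (V s)) :=
  \sum_i \sum_j \sum_k
    (x i 0 * y j 0 * z k 0) *: ext1 (trip (hb i) (hb j) (hb k)).

Definition formR (V : superpair F) (x : 'cV[R]_(hdim (V false)))
    (y : 'cV[R]_(hdim (V true))) : R :=
  \sum_i \sum_j x i 0 * y j 0 * (spform (hb i) (hb j))%:A.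

Definition veeR (n : nat) (M : superspace F) (x : 'I_n -> 'cV[R]_(hdim M)) :
    'cV[R]_(hdim (sympow n M)) :=
  \sum_(t : tidx n M) (\prod_i x i (t i) 0) *: ext1 (vee (fun i => hb (t i))).

Definition mxpair (V : superpair F) :=
  ('M[R]_(hdim (V false)) * 'M[R]_(hdim (V true)))%type.

Definition mxcomp (V : superpair F) (A : mxpair V) (s : bool) :
    'M[R]_(hdim (V s)) :=
  match s with false => A.1 | true => A.2 end.

Record is_autR (V : superpair F) (A : mxpair V) : Prop := {
  autR_bij : forall s, exists B : 'M[R]_(hdim (V s)),
    mxcomp A s *m B = 1%:M /\ B *m mxcomp A s = 1%:M;
  autR_even : forall s i j, hpar i != hpar j -> mxcomp A s i j = 0;
  autR_trip : forall s (x : 'cV[R]_(hdim (V s)))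
      (y : 'cV[R]_(hdim (V (~~ s)))) (z : 'cV[R]_(hdim (V s))),
    tripR (mxcomp A s *m x) (mxcomp A (~~ s) *m y) (mxcomp A s *m z) =
    mxcomp A s *m tripR x y z;
  autR_form : forall x y, formR (A.1 *m x) (A.2 *m y) = formR x y }.


End ScalarExtension.

Section Aut.
Variables (F : fieldType) (V : superpair F).

Lemma linear_expand (R : pzRingType) (U W : lmodType R) (f : U -> W)
    (I : finType) (p : I -> R) (X : I -> U) :
  linear f -> f (\sum_i p i *: X i) = \sum_i p i *: f (X i).
Proof.
move=> lf; have f0 : f 0 = 0.
  by have := lf (-1) 0 0; rewrite scaler0 addr0 scaleN1r addNr.
by elim/big_rec2: _ => // i y z _ <-; rewrite lf.
Qed.

Lemma mul_cV_expand (R : comPzRingType) m k (A : 'M[R]_(m, k)) (x : 'cV_k) :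
  A *m x = \sum_j x j 0 *: col j A.
Proof.
apply/matrixP => i j; rewrite !mxE summxE; apply: eq_bigr => l _.
by rewrite !mxE mulrC ord1.
Qed.

Section Points.
Variable R : comAlgType F.

Section Trip.
Variables s t : bool.

Fact tripR_linear1 y z : linear (fun x => @tripR F R V s t x y z).
Proof.
move=> k x x'; rewrite /tripR scaler_sumr -big_split; apply: eq_bigr => i _ /=.
rewrite scaler_sumr -big_split; apply: eq_bigr => j _ /=.
rewrite scaler_sumr -big_split; apply: eq_bigr => l _ /=.
by rewrite scalerA -scalerDl !mxE !mulrDl !mulrA.
Qed.

Fact tripR_linear2 x z : linear (fun y => @tripR F R V s t x y z).
Proof.
move=> k y y'; rewrite /tripR scaler_sumr -big_split; apply: eq_bigr => i _ /=.
rewrite scaler_sumr -big_split; apply: eq_bigr => j _ /=.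
rewrite scaler_sumr -big_split; apply: eq_bigr => l _ /=.
by rewrite scalerA -scalerDl !mxE mulrDr mulrDl !mulrA (mulrC k).
Qed.

Fact tripR_linear3 x y : linear (fun z => @tripR F R V s t x y z).
Proof.
move=> k z z'; rewrite /tripR scaler_sumr -big_split; apply: eq_bigr => i _ /=.
rewrite scaler_sumr -big_split; apply: eq_bigr => j _ /=.
rewrite scaler_sumr -big_split; apply: eq_bigr => l _ /=.
by rewrite scalerA -scalerDl !mxE mulrDr (mulrCA _ k).
Qed.

Lemma tripR_expand (I J K : finType) p q r X Y Z :
  @tripR F R V s t (\sum_(i : I) p i *: X i) (\sum_(j : J) q j *: Y j)
    (\sum_(k : K) r k *: Z k) =
  \sum_i \sum_j \sum_k (p i * q j * r k) *: tripR (X i) (Y j) (Z k).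
Proof.
rewrite (linear_expand _ _ (tripR_linear1 _ _)); apply: eq_bigr => i _.
rewrite (linear_expand _ _ (tripR_linear2 _ _)) scaler_sumr.
apply: eq_bigr => j _.
rewrite (linear_expand _ _ (tripR_linear3 _ _)) !scaler_sumr.
by apply: eq_bigr => k _; rewrite !scalerA.
Qed.

Lemma tripR_delta i j k :
  @tripR F R V s t (delta_mx i 0) (delta_mx j 0) (delta_mx k 0) =
  ext1 R (trip (hb i) (hb j) (hb k)).
Proof.
rewrite /tripR (bigD1 i) //= (bigD1 j) //= (bigD1 k) //= !mxE !eqxx !mulr1.
rewrite scale1r !big1 ?addr0 // => [l ne|l ne|l ne].
- rewrite big1 // => m _; rewrite big1 // => u _.
  by rewrite !mxE (negPf ne) !mul0r scale0r.
- rewrite big1 // => m _.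
  by rewrite !mxE (negPf ne) mulr0 mul0r scale0r.
- by rewrite !mxE (negPf ne) mulr0 scale0r.
Qed.

End Trip.

Lemma formR_expand (I J : finType) p q X Y :
  @formR F R V (\sum_(i : I) p i *: X i) (\sum_(j : J) q j *: Y j) =
  \sum_i \sum_j (p i * q j) * formR (X i) (Y j).
Proof.
have l1 y : linear (fun x => @formR F R V x y : R^o).
  move=> k x x'; rewrite /formR scaler_sumr -big_split.
  apply: eq_bigr => i _ /=; rewrite scaler_sumr -big_split.
  apply: eq_bigr => j _ /=.
  by rewrite /GRing.scale /= !mxE !mulrDl !mulrA.
have l2 x : linear (fun y => @formR F R V x y : R^o).
  move=> k y y'; rewrite /formR scaler_sumr -big_split.
  apply: eq_bigr => i _ /=; rewrite scaler_sumr -big_split.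
  apply: eq_bigr => j _ /=.
  by rewrite /GRing.scale /= !mxE mulrDr mulrDl !mulrA (mulrC k).
rewrite (linear_expand _ _ (l1 _)); apply: eq_bigr => i _.
rewrite (linear_expand _ _ (l2 _)) scaler_sumr.
by apply: eq_bigr => j _; rewrite scalerA.
Qed.

Lemma formR_delta i j :
  @formR F R V (delta_mx i 0) (delta_mx j 0) = (spform (hb i) (hb j))%:A.
Proof.
rewrite /formR (bigD1 i) //= (bigD1 j) //= !mxE !eqxx !mul1r.
rewrite !big1 ?addr0 // => [l ne|l ne].
- by rewrite big1 // => m _; rewrite !mxE (negPf ne) !mul0r.
- by rewrite !mxE (negPf ne) mulr0 mul0r.
Qed.

Record autR := AutR { aut_mx : mxpair R V; _ : `[< is_autR aut_mx >] }.

HB.instance Definition _ := [isSub for aut_mx].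
HB.instance Definition _ := [Choice of autR by <:].

Lemma autRP (x : autR) : is_autR (aut_mx x).
Proof. by apply/asboolP; case: x. Qed.

Definition aut_comp (x : autR) (s : bool) := mxcomp (aut_mx x) s.

Definition mulpair (A B : mxpair R V) : mxpair R V :=
  (A.1 *m B.1, A.2 *m B.2).

Lemma mulpairE A B s : mxcomp (mulpair A B) s = mxcomp A s *m mxcomp B s.
Proof. by case: s. Qed.

Fact aut_oneP : `[< is_autR ((1%:M, 1%:M) : mxpair R V) >].
Proof.
have E s : mxcomp ((1%:M, 1%:M) : mxpair R V) s = 1%:M by case: s.
apply/asboolP; split.
- by move=> s; exists 1%:M; rewrite E mul1mx.
- move=> s i j ne; rewrite E mxE; case: eqP => // ij.
  by rewrite ij eqxx in ne.
- by move=> s x y z; rewrite !E !mul1mx.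
- by move=> x y; rewrite !mul1mx.
Qed.
Definition aut_one := AutR aut_oneP.

Fact aut_mulP (x y : autR) : `[< is_autR (mulpair (aut_mx x) (aut_mx y)) >].
Proof.
case: (autRP x) => xb xe xt xf; case: (autRP y) => yb ye yt yf.
apply/asboolP; split.
- move=> s; rewrite mulpairE.
  have [B [B1 B2]] := xb s; have [C [C1 C2]] := yb s.
  exists (C *m B); split.
    by rewrite mulmxA -(mulmxA _ _ C) C1 mulmx1.
  by rewrite mulmxA -(mulmxA _ B) B2 mulmx1.
- move=> s i j ne; rewrite mulpairE mxE big1 // => k _.
  have [e|e] := eqVneq (hpar i) (hpar k); last by rewrite (xe s) ?mul0r.
  by rewrite (ye s k j) ?mulr0 // -e.
- by move=> s u v w; rewrite !mulpairE -!mulmxA xt yt.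
- by move=> u v; rewrite -!mulmxA xf yf.
Qed.
Definition aut_mul x y := AutR (aut_mulP x y).

Definition mx_inverse m (A : 'M[R]_m) : 'M[R]_m :=
  xget A [set B | A *m B = 1%:M /\ B *m A = 1%:M]%classic.

Definition invpair (A : mxpair R V) : mxpair R V :=
  (mx_inverse A.1, mx_inverse A.2).

Lemma invpairP (x : autR) s :
  mxcomp (aut_mx x) s *m mxcomp (invpair (aut_mx x)) s = 1%:M /\
  mxcomp (invpair (aut_mx x)) s *m mxcomp (aut_mx x) s = 1%:M.
Proof.
have -> : mxcomp (invpair (aut_mx x)) s = mx_inverse (mxcomp (aut_mx x) s).
  by case: s.
apply: (@xgetPex _ _ [set B | mxcomp (aut_mx x) s *m B = 1%:M /\
  B *m mxcomp (aut_mx x) s = 1%:M]%classic).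
exact: autR_bij (autRP x) s.
Qed.

Fact aut_invP (x : autR) : `[< is_autR (invpair (aut_mx x)) >].
Proof.
have VP s := (invpairP x s).1; have PV s := (invpairP x s).2.
case: (autRP x) => xb xe xt xf; apply/asboolP; split.
- by move=> s; exists (mxcomp (aut_mx x) s); rewrite VP PV.
- move=> s i j ne.
  set A := mxcomp (aut_mx x) s in xe VP PV.
  set B := mxcomp _ s in VP PV *.
  pose B' := \matrix_(i, j) if hpar i == hpar j then B i j else 0.
  suff -> : B = B' by rewrite mxE (negPf ne).
  suff AB' : A *m B' = 1%:M by rewrite -[B']mul1mx -(PV s) -mulmxA AB' mulmx1.
  apply/matrixP => k l; rewrite mxE.
  have [e|e] := eqVneq (hpar k) (hpar l).
    rewrite -(VP s) mxE; apply: eq_bigr => m _; rewrite mxE.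
    case: eqP => // /eqP ne'; rewrite (xe s k m) ?mul0r //.
    by rewrite e eq_sym.
  rewrite mxE; case: eqP => [kl|_]; first by rewrite kl eqxx in e.
  rewrite big1 // => m _; rewrite mxE; case: eqP => [e'|_].
    by rewrite (xe s k m) ?mul0r // e'.
  by rewrite mulr0.
- move=> s u v w; rewrite -[LHS]mul1mx -(PV s) -mulmxA -xt.
  by rewrite !mulmxA !VP !mul1mx.
- move=> u v; rewrite -xf.
  by rewrite !mulmxA (VP false) (VP true) !mul1mx.
Qed.
Definition aut_inv x := AutR (aut_invP x).

Fact aut_mulA : associative aut_mul.
Proof. by move=> x y z; apply/val_inj; rewrite /= /mulpair /= !mulmxA. Qed.
Fact aut_mul1 : left_id aut_one aut_mul.
Proof.
by move=> x; apply/val_inj; rewrite /= /mulpair /= !mul1mx -surjective_pairing.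
Qed.
Fact aut_1mul : right_id aut_one aut_mul.
Proof.
by move=> x; apply/val_inj; rewrite /= /mulpair /= !mulmx1 -surjective_pairing.
Qed.
Fact aut_mulV : left_inverse aut_one aut_inv aut_mul.
Proof.
move=> x; apply/val_inj; rewrite /= /mulpair /=.
by rewrite (invpairP x false).2 (invpairP x true).2.
Qed.
Fact aut_Vmul : right_inverse aut_one aut_inv aut_mul.
Proof.
move=> x; apply/val_inj; rewrite /= /mulpair /=.
by rewrite (invpairP x false).1 (invpairP x true).1.
Qed.

HB.instance Definition _ :=
  isGroup.Build autR aut_mulA aut_mul1 aut_1mul aut_mulV aut_Vmul.

End Points.

Definition mappair (R S : comAlgType F) (g : R -> S) (A : mxpair R V) :
  mxpair S V := (map_mx g A.1, map_mx g A.2).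

Lemma mappairE (R S : comAlgType F) (g : R -> S) (A : mxpair R V) s :
  mxcomp (mappair g A) s = map_mx g (mxcomp A s).
Proof. by case: s. Qed.

Lemma map_ext1 (R S : comAlgType F) (g : {lrmorphism R -> S})
    (M : superspace F) (w : M) : map_mx g (ext1 R w) = ext1 S w.
Proof. by apply/matrixP => i j; rewrite !mxE rmorph_alg. Qed.

Lemma map_tripR (R S : comAlgType F) (g : {lrmorphism R -> S}) s t x y z :
  map_mx g (@tripR F R V s t x y z) =
  tripR (map_mx g x) (map_mx g y) (map_mx g z).
Proof.
rewrite /tripR !raddf_sum; apply: eq_bigr => i _.
rewrite raddf_sum; apply: eq_bigr => j _.
rewrite raddf_sum; apply: eq_bigr => k _.
by rewrite /= map_mxZ map_ext1 !rmorphM !mxE.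
Qed.

Lemma map_formR (R S : comAlgType F) (g : {lrmorphism R -> S}) x y :
  g (@formR F R V x y) = formR (map_mx g x) (map_mx g y).
Proof.
rewrite /formR rmorph_sum; apply: eq_bigr => i _.
rewrite rmorph_sum; apply: eq_bigr => j _.
by rewrite rmorphM /= rmorphM rmorph_alg !mxE.
Qed.

Fact aut_mapP (R S : comAlgType F) (g : {lrmorphism R -> S}) (x : autR R) :
  `[< is_autR (mappair g (aut_mx x)) >].
Proof.
case: (autRP x) => xb xe xt xf; apply/asboolP; split.
- move=> s; rewrite mappairE; have [B [B1 B2]] := xb s.
  by exists (map_mx g B); rewrite -!map_mxM B1 B2 map_mx1.
- by move=> s i j ne; rewrite mappairE mxE xe ?rmorph0.
- move=> s u v w; rewrite !mappairE.
  rewrite (mul_cV_expand _ u) (mul_cV_expand _ v) (mul_cV_expand _ w).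
  rewrite tripR_expand [in RHS]/tripR mulmx_sumr; apply: eq_bigr => i _.
  rewrite mulmx_sumr; apply: eq_bigr => j _.
  rewrite mulmx_sumr; apply: eq_bigr => k _.
  rewrite -scalemxAr -!map_col -map_tripR !colE xt tripR_delta.
  by rewrite map_mxM map_ext1.
- move=> u v /=; rewrite (mul_cV_expand _ u) (mul_cV_expand _ v) formR_expand.
  rewrite [in RHS]/formR; apply: eq_bigr => i _; apply: eq_bigr => j _.
  by rewrite -!map_col -map_formR !colE xf formR_delta rmorph_alg.
Qed.
Definition aut_map (R S : comAlgType F) (g : {lrmorphism R -> S})
  (x : autR R) : autR S := AutR (aut_mapP g x).

Fact aut_mapM (R S : comAlgType F) (g : {lrmorphism R -> S}) (x y : autR R) :
  aut_map g (x * y)%g = (aut_map g x * aut_map g y)%g.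
Proof. by apply/val_inj; rewrite /= /mappair /mulpair /= !map_mxM. Qed.

Fact aut_map_id (R : comAlgType F) (g : {lrmorphism R -> R}) :
  g =1 id -> aut_map g =1 id.
Proof.
move=> gid x; apply/val_inj; rewrite /= /mappair !map_mx_id //.
by rewrite -surjective_pairing.
Qed.

Fact aut_map_comp (R S T : comAlgType F) (g : {lrmorphism R -> S})
    (h : {lrmorphism S -> T}) (k : {lrmorphism R -> T}) :
  k =1 h \o g -> aut_map k =1 aut_map h \o aut_map g.
Proof.
move=> kE x; apply/val_inj; rewrite /= /mappair /=.
by congr pair; apply/matrixP => i j; rewrite !mxE kE.
Qed.

Definition Aut_scheme : groupFunctor F := @GroupFunctor F
  (fun R => autR R : groupType) aut_map aut_mapM aut_map_id aut_map_comp.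

Fact scal_tripR (R : comAlgType F) (c d : R) s t x y z : c * d = 1 ->
  @tripR F R V s t (c *: x) (d *: y) (c *: z) = c *: tripR x y z.
Proof.
move=> cd; rewrite /tripR scaler_sumr; apply: eq_bigr => i _.
rewrite scaler_sumr; apply: eq_bigr => j _.
rewrite scaler_sumr; apply: eq_bigr => k _.
by rewrite !mxE scalerA (mulrACA c) cd mul1r mulrCA.
Qed.

(* c_l = (l^-1 id, l id) *)
Fact scal_autP (R : comAlgType F) (l : Gm F R) :
  `[< is_autR (((val l).2%:M, (val l).1%:M) : mxpair R V) >].
Proof.
have := valP l; case: (val l) => a b /= /eqP ab.
have ba : b * a = 1 by rewrite mulrC.
apply/asboolP; split => /=.
- by case; [exists b%:M|exists a%:M]; rewrite /= -!scalar_mxM ab ba.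
- by case=> i j ne; rewrite mxE; case: eqP => // ij; rewrite ij eqxx in ne.
- by case=> x y z; rewrite /= !mul_scalar_mx scal_tripR.
- move=> x y; rewrite /formR; apply: eq_bigr => i _; apply: eq_bigr => j _.
  by rewrite !mul_scalar_mx !mxE mulrACA ba mul1r.
Qed.
Definition scal_aut (R : comAlgType F) (l : Gm F R) : Aut_scheme R :=
  AutR (scal_autP l).

(* The points of the image of mu_n under l |-> c_l *)
Definition mu_aut (n : nat) (R : comAlgType F) (phi : Aut_scheme R) : Prop :=
  exists l : Gm F R, (l ^+ n)%g = 1%g /\ phi = scal_aut l.

End Aut.

(* Main.v *)
(** On parity-homogeneous families, the form of the superpower and the
    operators nu(f, v) are sums over permutations whose signs depend only on
    the parities.  For the form this is a perdet; for nu, the invariance of the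
    form identifies the Faulkner bracket with a sum over pairs (i, j) of the
    derivations nu(f_i, v_j), whose coefficient is a perdet in which row i and
    column j are deleted.

    The same formulas hold, by multilinearity, for R-linear combinations with
    homogeneous coefficients, so the matrix of the n-th power of an automorphism
    preserves the form and the triple products.  Quotients are images: the
    points of the target at which every polynomial vanishing on the image of
    the group vanishes form a closed subgroup functor whose comorphism from
    the target is onto and whose comorphism to the group is injective.

    For the kernel, let A be the matrix of an automorphism of V^+ with trivial
    n-th power.  If V^+ is odd of dimension > n, all n-minors of A are those of
    the identity, so every principal submatrix M of size n + 1 has adjugate 1
    and M = det(M).  If V^+ has an even vector e_s, the families e_s, ..., e_s,
    e_j isolate the entries of A, as n! is invertible. *)

From HB Require Import structures.
Require Import Defs.
From mathcomp Require Import all_boot all_order all_algebra all_fingroup.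
From mathcomp Require Import ring zify.
From mathcomp Require Import boolp classical_sets.

Set Implicit Arguments.
Unset Strict Implicit.
Unset Printing Implicit Defensive.

Import GRing.Theory.
Local Open Scope ring_scope.

(** * Signs of permutations *)

(** [instr_form] and [faulkner_bracket] are picked by [xget], so nothing is known of them until a
    witness is exhibited: [bform], defined from arbitrary coefficients over the generators, and
    [bracket_vee]. The generators nu(f, v) may be linearly dependent, and supersymmetry of the form
    of V is what makes [bform] independent of the coefficients.

    Likewise [sympow] is a complement of [symker] and its operations are defined on the chosen
    representative [vsval]. Any other representative may be used as soon as the operation is
    invariant under S_n, which is each time a check of signs. Since [kap] and [ksgn] are products
    over unordered pairs of indices, such a check amounts to finding the pairs whose sign changes.

    For schemes, the obstacle is that the closed image of a group must be shown stable under
    multiplication. Two points over different algebras S and T have to be multiplied, which needs a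
    nonzero algebra receiving both: their tensor product. It is built with linear functionals, which
    separate vectors over a field in any dimension. *)

Section Eta.
Variable F : fieldType.
Local Notation eta := (@eta F).

Lemma etaC a b : eta a b = eta b a.
Proof. by rewrite /Defs.eta andbC. Qed.

Lemma eta_sqr a b : eta a b * eta a b = 1.
Proof. by rewrite -expr2 /Defs.eta sqrr_sign. Qed.

Lemma eta0l b : eta false b = 1. Proof. by []. Qed.
Lemma eta0r b : eta b false = 1. Proof. by rewrite etaC. Qed.

Lemma etaDl a b c : eta (a (+) b) c = eta a c * eta b c.
Proof. by rewrite /Defs.eta -signr_addb -andb_addl. Qed.

Lemma etaDr a b c : eta c (a (+) b) = eta c a * eta c b.
Proof. by rewrite !(etaC c) etaDl. Qed.

Lemma eta_neq0 a b : eta a b != 0.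
Proof. by rewrite signr_eq0. Qed.

Lemma eta3E a b c : eta3 a b c = eta a b * eta b c * eta c a.
Proof. by []. Qed.

Lemma prod_eta (I : finType) (P : pred I) c (a : I -> bool) :
  \prod_(i | P i) eta c (a i) = eta c (\big[addb/false]_(i | P i) a i).
Proof.
apply: (big_rec2 (fun x y => x = eta c y)) => [|i y x _ ->].
  by rewrite eta0r.
by rewrite etaDr.
Qed.

Lemma odd_sum (I : finType) (P : pred I) (a : I -> bool) :
  odd (\sum_(i | P i) a i) = \big[addb/false]_(i | P i) a i.
Proof.
apply: (big_rec2 (fun x y => odd x = y)) => // i y x _ <-.
by rewrite oddD oddb.
Qed.

End Eta.

Definition upd (T : Type) n (i : 'I_n) (x : T) (a : 'I_n -> T) : 'I_n -> T :=
  fun k => if k == i then x else a k.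

Section UnorderedPairs.
Variable R : comPzRingType.

(** The signs [kap] and [ksgn] are products over unordered pairs of a symmetric function; the
    condition [i < j] only picks one order for each pair. *)
Definition pairprod n (g : 'I_n -> 'I_n -> R) : R :=
  \prod_(i < n) \prod_(j < n) (if (i < j)%N then g i j else 1).

Definition symmetric2 n (g : 'I_n -> 'I_n -> R) := forall i j, g i j = g j i.

Lemma eq_pairprod n (g h : 'I_n -> 'I_n -> R) :
  (forall i j : 'I_n, (i < j)%N -> g i j = h i j) -> pairprod g = pairprod h.
Proof.
move=> gh; apply: eq_bigr => i _; apply: eq_bigr => j _.
by case: ifP => // /gh.
Qed.

Lemma pairprodM n (g h : 'I_n -> 'I_n -> R) :
  pairprod g * pairprod h = pairprod (fun i j => g i j * h i j).
Proof.
rewrite -big_split; apply: eq_bigr => i _ /=.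
rewrite -big_split; apply: eq_bigr => j _ /=.
by case: ifP; rewrite ?mulr1.
Qed.

Lemma pairprod1 n (g : 'I_n -> 'I_n -> R) :
  (forall i j : 'I_n, (i < j)%N -> g i j = 1) -> pairprod g = 1.
Proof.
move=> g1; rewrite /pairprod big1 // => i _; rewrite big1 // => j _.
by case: ifP => // /g1.
Qed.

(** Like [<], the relation [T] selects one order of each pair. Where the two selections disagree the
    pair is swapped, and the symmetry of [g] makes both factors equal. *)
Lemma tournament_prod n (T : rel 'I_n) (g : 'I_n -> 'I_n -> R) :
  (forall i j, i != j -> T j i = ~~ T i j) -> (forall i, T i i = false) ->
  symmetric2 g ->
  \prod_(i < n) \prod_(j < n) (if T i j then g i j else 1) = pairprod g.
Proof.
move=> Tne Tid gs.
have E (S : rel 'I_n) : \prod_i \prod_j (if S i j then g i j else 1) =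
    \prod_(p : 'I_n * 'I_n | S p.1 p.2) g p.1 p.2.
  by rewrite pair_bigA /= [RHS]big_mkcond.
rewrite /pairprod !E (bigID (fun p : 'I_n * 'I_n => (p.1 < p.2)%N)) /=.
rewrite [RHS](bigID (fun p : 'I_n * 'I_n => T p.1 p.2)) /=; congr (_ * _).
  by apply: eq_bigl => p; rewrite andbC.
rewrite (reindex_inj (h := fun p : 'I_n * 'I_n => (p.2, p.1))) /=; last first.
  by move=> [a b] [c d] /= [-> ->].
apply: eq_big => [[i j]|[i j] _] /=; last exact: gs.
have [->|ne] := eqVneq i j; first by rewrite Tid ltnn.
rewrite (Tne i j) // ltnNge -ltnS; case: (T i j); rewrite /= ?andbF //.
by rewrite negbK ltnS ltn_neqAle -val_eqE /= andbT in ne *; rewrite ne.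
Qed.

Lemma pairprod_perm n (s : 'S_n) (g : 'I_n -> 'I_n -> R) : symmetric2 g ->
  pairprod (fun i j => g (s i) (s j)) = pairprod g.
Proof.
move=> gs; pose T (i j : 'I_n) := (s^-1%g i < s^-1%g j)%N.
rewrite -[RHS](@tournament_prod _ T) //; first last.
- by move=> i; rewrite /T ltnn.
- move=> i j ne; rewrite /T -leqNgt ltn_neqAle; case: eqP => //= e.
  by case/eqP: ne; apply/esym/(@perm_inj _ s^-1%g)/val_inj.
rewrite /pairprod [RHS](reindex_inj (@perm_inj _ s)); apply: eq_bigr => i _.
rewrite [RHS](reindex_inj (@perm_inj _ s)); apply: eq_bigr => j _.
by rewrite /T !permK.
Qed.

Lemma pairprod_lift n (i : 'I_n.+1) (g : 'I_n.+1 -> 'I_n.+1 -> R) :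
  symmetric2 g ->
  pairprod g = pairprod (fun j k => g (lift i j) (lift i k)) *
               \prod_j g i (lift i j).
Proof.
move=> gs; rewrite /pairprod (bigD1_ord i) //= (bigD1_ord i) //= ltnn mul1r.
under [X in _ * X]eq_bigr => j _ do rewrite (bigD1_ord i) //=.
rewrite big_split /= mulrA mulrC; congr (_ * _); last first.
  rewrite -big_split; apply: eq_bigr => j _ /=.
  have ne : bump i j != i by rewrite eq_sym neq_bump.
  by case: (ltngtP (bump i j) i) ne => //=; rewrite ?mulr1 ?mul1r // => _ _; rewrite gs.
apply: eq_bigr => j _; apply: eq_bigr => k _.
by rewrite !ltnNge leq_bump2.
Qed.

(** Meant for one sign before and after the parity of the [i]-th factor changes: the pairs avoiding
    [i] then contribute squares of signs. *)
Lemma pairprod_upd n (i : 'I_n) (g h : 'I_n -> 'I_n -> R) :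
  symmetric2 g -> symmetric2 h ->
  (forall j k, j != i -> k != i -> g j k * h j k = 1) ->
  pairprod g * pairprod h = \prod_(k | k != i) (g i k * h i k).
Proof.
case: n => [|n] in i g h *; first by case: i.
move=> gs hs gh; rewrite pairprodM (pairprod_lift i); last first.
  by move=> j k; rewrite gs hs.
rewrite pairprod1 ?mul1r; last first.
  by move=> j k _; rewrite gh // eq_sym neq_lift.
rewrite [RHS]big_mkcond (bigD1_ord i) //= eqxx mul1r.
by apply: eq_bigr => j _; rewrite eq_sym neq_lift.
Qed.

End UnorderedPairs.

Section Signs.
Variables (F : fieldType) (n : nat).
Local Notation eta := (@eta F).
Implicit Types (a : 'I_n -> bool) (s t : 'S_n).

(** The sign in the pairing of two tensors whose [i]-th factors share the parity [a i]. As the form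
    is even, the product of values vanishes in all other cases. *)
Definition kap a : F := \prod_(i < n) \prod_(j < n | (j < i)%N) eta (a i) (a j).

Lemma kapE a : kap a = pairprod (fun i j => eta (a i) (a j)).
Proof.
rewrite /kap /pairprod (exchange_big_dep xpredT) //=; apply: eq_bigr => i _.
rewrite big_mkcond; apply: eq_bigr => j _.
by case: ifP => // _; rewrite etaC.
Qed.

(** The exclusive or makes the relation symmetric in [i] and [j], so that [ksgn] becomes a
    [pairprod]. *)
Definition inverted s (i j : 'I_n) := (i < j)%N (+) (s i < s j)%N.

Definition ksg s a (i j : 'I_n) :=
  if inverted s i j then eta (a i) (a j) else 1.

Lemma ltn_perm s (i j : 'I_n) : i != j -> (s j < s i)%N = ~~ (s i < s j)%N.
Proof.
move=> ne; rewrite -leqNgt ltn_neqAle; case: eqP => //= e.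
by case/eqP: ne; apply/esym/(@perm_inj _ s)/val_inj.
Qed.

Lemma ltn_ordC (i j : 'I_n) : i != j -> (j < i)%N = ~~ (i < j)%N.
Proof. by move=> ne; rewrite -leqNgt ltn_neqAle eq_sym ne. Qed.

Lemma invertedC s i j : inverted s i j = inverted s j i.
Proof.
rewrite /inverted; have [->//|ne] := eqVneq i j.
by rewrite (ltn_perm s ne) (ltn_ordC ne) addbN addNb negbK.
Qed.

Lemma ksg_sym s a : symmetric2 (ksg s a).
Proof. by move=> i j; rewrite /ksg invertedC etaC. Qed.

Lemma eta_sym a : symmetric2 (fun i j => eta (a i) (a j)).
Proof. by move=> i j; rewrite etaC. Qed.

Lemma ksgnE s a : ksgn F s a = pairprod (ksg s a).
Proof.
apply: eq_bigr => i _; rewrite big_mkcond; apply: eq_bigr => j _.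
rewrite /ksg /inverted; case: (ltnP i j) => //= ij.
by rewrite ltn_perm // -val_eqE /= (ltn_eqF ij).
Qed.

Lemma eq_ksgn s a b : a =1 b -> ksgn F s a = ksgn F s b.
Proof.
by move=> ab; apply: eq_bigr => i _; apply: eq_bigr => j _; rewrite !ab.
Qed.

Lemma eq_kap a b : a =1 b -> kap a = kap b.
Proof.
by move=> ab; apply: eq_bigr => i _; apply: eq_bigr => j _; rewrite !ab.
Qed.

Lemma kap_perm s a : kap (fun i => a (s i)) = kap a.
Proof. by rewrite !kapE (pairprod_perm s (eta_sym a)). Qed.

(** Cocycle rule: a pair is inverted by the composite when exactly one of the two steps inverts it,
    and a pair inverted twice contributes a squared sign. *)
Lemma ksgnM s t a : ksgn F (t * s)%g (fun i => a (t i)) =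
  ksgn F s a * ksgn F t (fun i => a (t i)).
Proof.
rewrite !ksgnE -(pairprod_perm t (ksg_sym s a)) pairprodM.
apply: eq_pairprod => i j ij; rewrite /ksg /inverted !permM ij /=.
by do 2!case: (_ < _)%N => //=; rewrite ?mulr1 ?mul1r ?eta_sqr.
Qed.

Lemma ksgn_sqr s a : ksgn F s a * ksgn F s a = 1.
Proof.
rewrite !ksgnE pairprodM pairprod1 // => i j _; rewrite /ksg.
by case: ifP; rewrite ?mulr1 ?eta_sqr.
Qed.

Lemma ksgn1 a : ksgn F 1%g a = 1.
Proof.
by rewrite ksgnE pairprod1 // => i j _; rewrite /ksg /inverted !perm1 addbb.
Qed.

Lemma ksgnV s a : ksgn F s^-1%g (fun i => a (s^-1%g i)) = ksgn F s a.
Proof.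
have := ksgnM s s^-1%g a; rewrite mulVg ksgn1.
by move/(congr1 (fun x => ksgn F s a * x)); rewrite mulr1 mulrA ksgn_sqr mul1r.
Qed.

Lemma kap_sqr a : kap a * kap a = 1.
Proof. by rewrite !kapE pairprodM pairprod1 // => i j _; rewrite eta_sqr. Qed.

(** Only the pairs containing [i] change, and [eta (a i) x * eta (a i (+) c) x = eta c x]. *)
Lemma kap_upd a i c : kap a * kap (upd i (a i (+) c) a) =
  \prod_(k | k != i) eta c (a k).
Proof.
rewrite !kapE (@pairprod_upd _ _ i) //; first last.
- by move=> j k /negPf ji /negPf ki; rewrite /upd ji ki eta_sqr.
- exact: eta_sym.
- exact: eta_sym.
by apply: eq_bigr => k /negPf ki; rewrite /upd ki eqxx -etaDl addKb.
Qed.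

(** A pair {i, k} is inverted when exactly one of [k < i] and [s k < s i] holds, which splits the
    product in two. It is the ratio of the signs with which an operator of parity [c] reaches the
    factor before and after the permutation. *)
Lemma ksgn_upd s a i c : ksgn F s a * ksgn F s (upd i (a i (+) c) a) =
  (\prod_(k < n | (k < i)%N) eta c (a k)) *
  \prod_(k < n | (s k < s i)%N) eta c (a k).
Proof.
rewrite !ksgnE (@pairprod_upd _ _ i); first last.
- move=> j k /negPf ji /negPf ki; rewrite /ksg /upd ji ki.
  by case: ifP; rewrite ?mulr1 ?eta_sqr.
- exact: ksg_sym.
- exact: ksg_sym.
rewrite [LHS]big_mkcond [X in _ = X * _]big_mkcond [X in _ = _ * X]big_mkcond.
rewrite -big_split; apply: eq_bigr => k _ /=.
have [->|ki] := eqVneq k i; first by rewrite !ltnn mulr1.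
rewrite /ksg /inverted /upd (negPf ki) eqxx /= (ltn_ordC ki) (ltn_perm s ki).
rewrite addbN addNb negbK.
by do 2!case: (_ < _)%N; rewrite /= ?mulr1 ?mul1r ?eta_sqr // -etaDl addKb.
Qed.

End Signs.

Lemma kap_lift (F : fieldType) n (i : 'I_n.+1) (a : 'I_n.+1 -> bool) :
  kap F a = kap F (fun k => a (lift i k)) * \prod_k eta (a i) (a (lift i k)).
Proof. by rewrite !kapE (pairprod_lift i (@eta_sym F _ a)). Qed.

(** The pairs avoiding [i] give the sign of [s]. The factor [i] crosses those that precede it on one
    side only, the common ones cancelling. The hypothesis says that [s] carries the parities [a] to
    [b] away from [i] and [j]. *)
Lemma ksgn_lift (F : fieldType) n (i j : 'I_n.+1) (s : 'S_n)
    (a b : 'I_n.+1 -> bool) :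
  (forall k, b (lift j (s k)) = a (lift i k)) ->
  ksgn F (lift_perm i j s) a = ksgn F s (fun k => a (lift i k)) *
   ((\prod_(k < n.+1 | (k < i)%N) eta (a i) (a k)) *
    (\prod_(k < n.+1 | (k < j)%N) eta (a i) (b k))).
Proof.
move=> ab; rewrite !ksgnE (pairprod_lift i (@ksg_sym _ _ _ _)).
congr (_ * _).
  apply: eq_pairprod => k l _; rewrite /ksg /inverted !lift_perm_lift.
  by rewrite !ltnNge !leq_bump2 -!ltnNge.
rewrite [X in X * _]big_mkcond [X in _ * X]big_mkcond.
rewrite (bigD1_ord i) //= [X in _ * X](bigD1_ord j) //= !ltnn !mul1r.
rewrite [X in _ * X](reindex_inj (@perm_inj _ s)) -big_split.
apply: eq_bigr => k _ /=; rewrite /ksg /inverted lift_perm_id lift_perm_lift ab.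
have -> : (i < lift i k)%N = ~~ (lift i k < i)%N by rewrite ltn_ordC // eq_sym neq_lift.
have -> : (j < lift j (s k))%N = ~~ (lift j (s k) < j)%N.
  by rewrite ltn_ordC // eq_sym neq_lift.
rewrite addbN addNb negbK /=.
by do 2!case: (_ < _)%N; rewrite /= ?mulr1 ?mul1r ?eta_sqr.
Qed.

(** * Symmetric superpowers *)

Section LinearPredicate.
Variables (R : pzRingType) (U W : lmodType R) (f : U -> W).
Hypothesis f_lin : linear f.

Lemma lin0 : f 0 = 0.
Proof. by have := f_lin (-1) 0 0; rewrite scaler0 addr0 scaleN1r addNr. Qed.

Lemma linZ c x : f (c *: x) = c *: f x.
Proof. by have := f_lin c x 0; rewrite lin0 !addr0. Qed.

Lemma linD x y : f (x + y) = f x + f y.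
Proof. by have := f_lin 1 x y; rewrite !scale1r. Qed.

End LinearPredicate.

Section Homogeneous.
Variables (F : fieldType) (M : superspace F).
Implicit Types (a b : bool) (v : M).

Lemma gr_disjoint a : (gr M a :&: gr M (~~ a) = 0)%VS.
Proof. by case: a; [rewrite capvC|]; exact: gr_direct. Qed.

Lemma gr_sum a : (gr M a + gr M (~~ a) = fullv)%VS.
Proof. by case: a; [rewrite addvC|]; exact: gr_full. Qed.

Lemma hcomp_is_linear a : linear (@hcomp F M a).
Proof. by move=> k x y; rewrite /hcomp linearP. Qed.
HB.instance Definition _ a :=
  GRing.isLinear.Build F M M *:%R (@hcomp F M a) (hcomp_is_linear a).

Lemma hcomp_mem a v : hcomp a v \in gr M a.
Proof. exact: memv_pi. Qed.

Lemma hcomp_id a v : v \in gr M a -> hcomp a v = v.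
Proof. by move=> va; rewrite /hcomp daddv_pi_id ?gr_disjoint. Qed.

Lemma hcomp_add v : hcomp false v + hcomp true v = v.
Proof.
by rewrite /hcomp daddv_pi_add ?gr_disjoint ?gr_sum ?memvf //.
Qed.

Lemma hcompE a b v : v \in gr M b -> hcomp a v = (a == b)%:R *: v.
Proof.
move=> vb; have [->|ne] := eqVneq a b; first by rewrite hcomp_id ?scale1r.
have := hcomp_add v; rewrite scale0r.
by case: a b vb ne => [] [] // vb _; rewrite (hcomp_id vb) => /eqP;
  rewrite ?(addrC (hcomp _ _)) -subr_eq0 ?(addrC v) addrK => /eqP.
Qed.

Lemma gr_eq0 a b v : v \in gr M a -> v \in gr M b -> a != b -> v = 0.
Proof.
by move=> va vb ne; rewrite -(hcomp_id va) (hcompE _ vb) (negPf ne) scale0r.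
Qed.

Lemma par_gr a v : v \in gr M a -> v != 0 -> par v = a.
Proof.
move=> va nz; rewrite /par; case: a va => [va|->//].
by apply/negP => v0; rewrite (gr_eq0 va v0) // eqxx in nz.
Qed.

Lemma hbasisP : basis_of fullv (hbasis M).
Proof.
rewrite -(gr_full M) cat_basis ?vbasisP //.
exact/directv_addP/gr_direct.
Qed.

Lemma hdimE : hdim M = \dim {: M}.
Proof. by rewrite -(gr_full M) dimv_disjoint_sum ?gr_direct. Qed.

Lemma hcoord_is_linear k : linear (hcoord k : M -> F^o).
Proof. by move=> c x y; rewrite /hcoord linearP. Qed.
HB.instance Definition _ k :=
  GRing.isLinear.Build F M F^o *:%R (hcoord k : M -> F^o) (hcoord_is_linear k).

Lemma hb_gr (k : 'I_(hdim M)) : hb k \in gr M (hpar k).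
Proof.
rewrite /hb (tnth_nth 0) /= nth_cat size_tuple /hpar ltnNge.
case: leqP => /= lek; apply: vbasis_mem; apply: mem_nth; rewrite size_tuple //.
by rewrite ltn_subLR // ltn_ord.
Qed.

Lemma hb_nth (k : 'I_(hdim M)) : hb k = (hbasis M)`_k.
Proof. by rewrite /hb (tnth_nth 0). Qed.

Lemma hcoord_hb (i j : 'I_(hdim M)) : hcoord i (hb j) = (i == j)%:R.
Proof.
by rewrite hb_nth /hcoord coord_free ?(basis_free hbasisP) // eq_sym.
Qed.

Lemma hcoord_sum v : v = \sum_k hcoord k v *: hb k.
Proof.
rewrite {1}(coord_basis hbasisP (memvf v)).
by apply: eq_bigr => k _; rewrite hb_nth.
Qed.

Lemma hcoord_gr a v (k : 'I_(hdim M)) :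
  v \in gr M a -> hpar k != a -> hcoord k v = 0.
Proof.
move=> va ne; have E : hcoord k (hcomp (hpar k) v) = hcoord k v.
  rewrite (hcoord_sum v) linear_sum !linear_sum; apply: eq_bigr => j _ /=.
  rewrite linearZ /= (hcompE _ (hb_gr j)) !linearZ /=; congr (_ * _).
  rewrite hcoord_hb; have [->|_] := eqVneq k j; rewrite ?eqxx /GRing.scale /=.
    by rewrite mulr1.
  by rewrite mulr0.
by rewrite -E (hcompE _ va) (negPf ne) scale0r linear0.
Qed.

End Homogeneous.

Section Tensors.
Variables (F : fieldType) (n : nat) (M : superspace F).
Local Notation eta := (@eta F).
Local Notation tidx := (tidx n M).
Local Notation tpow := (tpow n M).
Implicit Types (v : 'I_n -> M) (t u : tidx) (s : 'S_n) (a : 'I_n -> bool).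

Definition hbt t : 'I_n -> M := fun i => hb (t i).
Definition tpars t : 'I_n -> bool := fun i => hpar (t i).

Lemma hbt_gr t i : hbt t i \in gr M (tpars t i).
Proof. exact: hb_gr. Qed.

Lemma eq_tens v w : v =1 w -> tens v = tens w.
Proof.
by move=> vw; apply/ffunP => t; rewrite !ffunE; apply: eq_bigr => i _; rewrite vw.
Qed.

Lemma eq_vee v w : v =1 w -> vee v = vee w.
Proof. by move=> /eq_tens vw; rewrite /vee vw. Qed.

Lemma tens_hb t u : tens (hbt t) u = (u == t)%:R.
Proof.
rewrite ffunE; under eq_bigr => i _ do rewrite hcoord_hb.
have [->|ne] := eqVneq u t; first by rewrite big1 // => i _; rewrite eqxx.
have [i ui] : exists i, u i != t i.
  by apply/existsP; apply: contraNT ne => /existsPn e; apply/eqP/ffunP => i;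
    have := e i; rewrite negbK => /eqP.
by rewrite (bigD1 i) //= (negPf ui) mul0r.
Qed.

Lemma tpow_sum (x : tpow) : x = \sum_t x t *: tens (hbt t).
Proof.
apply/ffunP => u; rewrite sum_ffunE (bigD1 u) //= big1 ?addr0 => [|t ne].
  by rewrite ffunE tens_hb eqxx /GRing.scale /= mulr1.
by rewrite ffunE tens_hb eq_sym (negPf ne) /GRing.scale /= mulr0.
Qed.

Lemma tens_sum (K : finType) (c : 'I_n -> K -> F) (h : 'I_n -> K -> M) :
  tens (fun i => \sum_k c i k *: h i k) =
  \sum_(f : {ffun 'I_n -> K}) (\prod_i c i (f i)) *: tens (fun i => h i (f i)).
Proof.
apply/ffunP => t; rewrite sum_ffunE ffunE.
under eq_bigr => i _.
  rewrite linear_sum; under eq_bigr => k _ do rewrite linearZ; over.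
rewrite bigA_distr_bigA; apply: eq_bigr => f _.
by rewrite !ffunE [RHS]/GRing.scale /= -big_split.
Qed.

Lemma vee_sum (K : finType) (c : 'I_n -> K -> F) (h : 'I_n -> K -> M) :
  vee (fun i => \sum_k c i k *: h i k) =
  \sum_(f : {ffun 'I_n -> K}) (\prod_i c i (f i)) *: vee (fun i => h i (f i)).
Proof.
rewrite [LHS]/vee (tens_sum c h) linear_sum.
by apply: eq_bigr => f _; rewrite linearZ.
Qed.

Lemma tens_upd_linear v i : linear (fun x => tens (upd i x v)).
Proof.
move=> c x y; apply/ffunP => t; rewrite !ffunE.
have E z : \prod_j hcoord (t j) (upd i z v j) =
    hcoord (t i) z * \prod_(j | j != i) hcoord (t j) (v j).
  rewrite (bigD1 i) //= {1}/upd eqxx; congr (_ * _).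
  by apply: eq_bigr => j /negPf ji; rewrite /upd ji.
by rewrite !E linearP mulrDl /GRing.scale /= mulrA.
Qed.

Lemma vee_upd_linear v i : linear (fun x => vee (upd i x v)).
Proof. by move=> c x y; rewrite /vee tens_upd_linear linearP. Qed.

Lemma vee_eq0 v i : v i = 0 -> vee v = 0.
Proof.
move=> v0; rewrite -(linear0 (cls n M)); congr (cls _ _ _); apply/ffunP => t.
by rewrite !ffunE (bigD1 i) //= v0 linear0 mul0r.
Qed.

Lemma sympow_sum (w : sympow n M) : w = \sum_t (vsval w) t *: vee (hbt t).
Proof.
rewrite -{1}(cls_val w) {1}(tpow_sum (vsval w)) linear_sum.
by apply: eq_bigr => t _; rewrite linearZ.
Qed.

Lemma tact_hb s t :
  tact s (tens (hbt t)) =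
  ksgn F s (tpars t) *: tens (hbt [ffun i => t (s^-1%g i)]).
Proof.
apply/ffunP => u; rewrite [LHS]ffunE tens_hb [RHS]ffunE tens_hb /GRing.scale /=.
have -> : ([ffun i => u (s i)] == t) = (u == [ffun i => t (s^-1%g i)]).
  apply/eqP/eqP => [<-|->]; apply/ffunP => i; rewrite !ffunE ?permKV ?permK //.
have [->|_] := eqVneq; rewrite ?mulr0 // !mulr1.
by apply: eq_ksgn => i; rewrite /tpars !ffunE permK.
Qed.

Lemma cls_tact s (x : tpow) : cls n M (tact s x) = cls n M x.
Proof.
apply/esym/eqP; rewrite -subr_eq0 -linearB cls_eq0.
apply: (subvP (sumv_sup s isT (subvv _))).
by apply/memv_imgP; exists x; rewrite ?memvf // !lfun_simp.
Qed.

Lemma tact_tens s v a : (forall i, v i \in gr M (a i)) ->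
  tact s (tens v) = ksgn F s a *: tens (fun i => v (s^-1%g i)).
Proof.
move=> va; apply/ffunP => t; rewrite !ffunE /GRing.scale /=.
rewrite [in RHS](reindex_inj (@perm_inj _ s)) /=.
under [in RHS]eq_bigr => i _ do rewrite permK.
under eq_bigr => i _ do rewrite ffunE.
have [/forallP ta|/forallPn[i ti]] :=
    boolP [forall i, hpar (t (s i)) == a i].
  have ta' : (fun i => hpar (t (s i))) =1 a by move=> i; rewrite (eqP (ta i)).
  by rewrite (eq_ksgn F s ta').
by rewrite (bigD1 i) //= (hcoord_gr (va i) ti) mul0r !mulr0.
Qed.

Lemma vee_perm s v a : (forall i, v i \in gr M (a i)) ->
  vee v = ksgn F s a *: vee (fun i => v (s^-1%g i)).
Proof. by move=> va; rewrite -[RHS]linearZ -(tact_tens s va) /= cls_tact. Qed.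

(** A linear map invariant under S_n kills [symker], so it takes the same value on a tensor and on
    the representative chosen for its class. The action, the form and the power of a matrix, all
    defined through [vsval], are computed by this. *)
Lemma ker_of_hb (U : lmodType F) (L : tpow -> U) : linear L ->
  (forall s t, L (tact s (tens (hbt t))) = L (tens (hbt t))) ->
  forall x, L (vsval (cls n M x)) = L x.
Proof.
move=> Llin Linv x; have L0 := lin0 Llin.
have LB y z : L (y - z) = L y - L z by rewrite (linD Llin) -[- z]scaleN1r (linZ Llin) scaleN1r.
have Linv' s z : L (tact s z) = L z.
  rewrite (tpow_sum z) (linear_sum (tact s)).
  under eq_bigr => t _ do rewrite (linearZ_LR (tact s)).
  rewrite !(linear_expand _ _ Llin).
  by apply: eq_bigr => t _; rewrite /= Linv.
have Lker y : y \in symker n M -> L y = 0.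
  case/memv_sumP => f fP ->.
  under eq_bigr => s _ do rewrite -[f s]scale1r.
  rewrite (linear_expand _ _ Llin) big1 // => s _.
  have /memv_imgP[z _ ->] := fP s isT.
  by rewrite !lfun_simp LB /= Linv' subrr scaler0.
apply/eqP; rewrite -subr_eq0 -LB; apply/eqP/Lker.
by rewrite -cls_eq0 linearB /= cls_val subrr.
Qed.

Lemma tens_gr v a : (forall i, v i \in gr M (a i)) ->
  tproj (\big[addb/false]_i a i) (tens v) = tens v.
Proof.
move=> va; apply/ffunP => t; rewrite !ffunE /tpar odd_sum.
case: eqP => // /eqP ne; have [i ti] : exists i, hpar (t i) != a i.
  apply/existsP; apply: contraNT ne => /existsPn e; apply/eqP/eq_bigr => i _.
  by have := e i; rewrite negbK => /eqP.
by rewrite (bigD1 i) //= (hcoord_gr (va i) ti) mul0r.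
Qed.

Lemma vee_gr v a : (forall i, v i \in gr M (a i)) ->
  vee v \in gr (sympow n M) (\big[addb/false]_i a i).
Proof.
by move=> va; apply/sympow_grP; exists (tens v); rewrite tens_gr.
Qed.

Lemma sympow_gr_sum (a0 : bool) (w : sympow n M) : w \in gr (sympow n M) a0 ->
  exists x : tidx -> F, w = \sum_t x t *: vee (hbt t) /\
    forall t, \big[addb/false]_i tpars t i != a0 -> x t = 0.
Proof.
case/sympow_grP => x ->; exists (fun t => tproj a0 x t); split.
  rewrite {1}(tpow_sum (tproj a0 x)) linear_sum.
  by apply: eq_bigr => t _; rewrite linearZ.
by move=> t /negPf ne; rewrite ffunE /tpar odd_sum ne.
Qed.

Lemma sumT_hb t (U : lmodType F) (G : tidx -> U) :
  \sum_u tens (hbt t) u *: G u = G t.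
Proof.
rewrite (bigD1 t) //= tens_hb eqxx scale1r big1 ?addr0 // => u ne.
by rewrite tens_hb (negPf ne) scale0r.
Qed.

End Tensors.

Lemma vee_expand (F : fieldType) n (M : superspace F) (v : 'I_n -> M) :
  vee v = \sum_(t : tidx n M) (\prod_i hcoord (t i) (v i)) *: vee (hbt t).
Proof.
by rewrite -(vee_sum (fun i k => hcoord k (v i)) (fun i k => hb k));
   apply: eq_vee => i; apply: hcoord_sum.
Qed.

(** Composing [u] with [s] permutes the families [u], which frees the second index before the
    product is distributed. *)
Lemma sum_ffun2 (R : comPzSemiRingType) n (K K' : finType) (s : 'S_n)
    (G : 'I_n -> K -> K' -> R) :
  \sum_(t : {ffun 'I_n -> K}) \sum_(u : {ffun 'I_n -> K'})
     \prod_i G i (t i) (u (s i)) = \prod_i \sum_k \sum_k' G i k k'.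
Proof.
rewrite bigA_distr_bigA; apply: eq_bigr => t _; rewrite bigA_distr_bigA.
rewrite (reindex (fun u : {ffun 'I_n -> K'} => [ffun i => u (s^-1%g i)])) /=.
  by apply: eq_bigr => u _; apply: eq_bigr => i _; rewrite ffunE permK.
exists (fun u : {ffun 'I_n -> K'} => [ffun i => u (s i)]) => u _;
  by apply/ffunP => i; rewrite !ffunE ?permK ?permKV.
Qed.

Definition hom_endo (F : fieldType) (M : superspace F) (a : bool)
    (g : 'End(M)) : Prop :=
  forall c v, v \in gr M c -> g v \in gr M (c (+) a).

(** * Action of endomorphisms by superderivations *)

Section Action.
Variables (F : fieldType) (n : nat) (M : superspace F).
Local Notation eta := (@eta F).
Local Notation tidx := (tidx n M).
Implicit Types (v : 'I_n -> M) (t u : tidx) (s : 'S_n) (a : bool).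
Implicit Types (g : 'End(M)).

Definition der_hb a (h : M -> M) t : sympow n M :=
  \sum_(i < n) (\prod_(k < n | (k < i)%N) eta a (hpar (t k))) *:
    vee (upd i (h (hb (t i))) (hbt t)).

Lemma sympow_actE (h : M -> M) (w : sympow n M) : sympow_act h w =
  \sum_(a : bool) \sum_t (vsval w) t *: der_hb a (endo_part a h) t.
Proof.
apply: eq_bigr => a _; apply: eq_bigr => t _; congr (_ *: _).
apply: eq_bigr => i _; congr (_ *: _); apply: eq_vee => k.
by rewrite /upd; case: eqP => // ->.
Qed.

Lemma sympow_act_is_linear (h : M -> M) : linear (@sympow_act F n M h).
Proof.
move=> c x y; rewrite !sympow_actE scaler_sumr -big_split.
apply: eq_bigr => a _ /=; rewrite scaler_sumr -big_split.
by apply: eq_bigr => t _ /=; rewrite !ffunE scalerDl scalerA.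
Qed.
HB.instance Definition _ (h : M -> M) :=
  GRing.isLinear.Build F (sympow n M) (sympow n M) *:%R
    (@sympow_act F n M h) (sympow_act_is_linear h).

Lemma sympow_act_linl (c : F) (g g' : 'End(M)) (w : sympow n M) :
  sympow_act (c *: g + g') w = c *: sympow_act g w + sympow_act g' w.
Proof.
rewrite !sympow_actE scaler_sumr -big_split; apply: eq_bigr => a _ /=.
rewrite scaler_sumr -big_split; apply: eq_bigr => t _ /=.
rewrite scalerA mulrC -scalerA -scalerDr; congr (_ *: _).
rewrite /der_hb scaler_sumr -big_split; apply: eq_bigr => i _ /=.
rewrite scalerA mulrC -scalerA -scalerDr; congr (_ *: _).
rewrite -vee_upd_linear; congr (vee (upd _ _ _)).
rewrite /endo_part scaler_sumr -big_split; apply: eq_bigr => b _ /=.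
by rewrite !lfun_simp linearP.
Qed.

(** Permuting the factors produces [ksgn] for the parities before the action of [g] and for those
    after it. By [ksgn_upd] the product of both trades the factors crossed before place [i] for
    those crossed before place [s i]. *)
Lemma der_hb_perm a g s t : hom_endo a g ->
  ksgn F s (tpars t) *: der_hb a g [ffun i => t (s^-1%g i)] = der_hb a g t.
Proof.
move=> ga; rewrite /der_hb scaler_sumr (reindex_inj (@perm_inj _ s)) /=.
apply: eq_bigr => i _; pose v := upd i (g (hb (t i))) (hbt t).
pose b := upd i (tpars t i (+) a) (tpars t).
have vb k : v k \in gr M (b k).
  by rewrite /v /b /upd; case: eqP => _; [apply/ga/hb_gr|apply: hb_gr].
rewrite (vee_perm s vb) !scalerA.
have -> : vee (upd (s i) (g (hb ([ffun i0 => t (s^-1%g i0)] (s i))))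
    (hbt [ffun i0 => t (s^-1%g i0)])) = vee (fun k => v (s^-1%g k)).
  apply: eq_vee => k; rewrite /v /upd /hbt !ffunE permK.
  by rewrite -[in RHS](inj_eq (@perm_inj _ s)) permKV.
congr (_ *: _).
have -> : \prod_(k < n | (k < s i)%N) eta a (hpar ([ffun i0 => t (s^-1%g i0)] k))
    = \prod_(k < n | (s k < s i)%N) eta a (tpars t k).
  rewrite (reindex_inj (@perm_inj _ s)) /=.
  by apply: eq_bigr => k _; rewrite ffunE permK.
have := ksgn_upd F s (tpars t) i a; rewrite -/b.
set P1 := \prod_(_ | _) _; set P2 := \prod_(_ | _) _ => E.
have P2P2 : P2 * P2 = 1.
  by rewrite /P2 -big_split big1 // => k _; rewrite /= eta_sqr.
rewrite -[ksgn F s (tpars t)]mulr1 -(ksgn_sqr F s b) mulrA E.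
by rewrite (mulrAC _ _ P2) -(mulrA P1) P2P2 mulr1.
Qed.

Lemma der_hb_cls a g (x : tpow n M) : hom_endo a g ->
  \sum_t (vsval (cls n M x)) t *: der_hb a g t = \sum_t x t *: der_hb a g t.
Proof.
move=> ga; pose L (y : tpow n M) : sympow n M := \sum_t y t *: der_hb a g t.
have L_lin : linear L.
  move=> c y z; rewrite /L scaler_sumr -big_split; apply: eq_bigr => t _ /=.
  by rewrite !ffunE scalerDl scalerA.
apply: (ker_of_hb L_lin) => s t.
rewrite tact_hb (linZ L_lin) /L !(sumT_hb _ (der_hb a g)).
exact: der_hb_perm.
Qed.

Lemma endo_part_hom a b g (v0 : M) : hom_endo a g ->
  endo_part b g v0 = if a == b then g v0 else 0.
Proof.
move=> ga; rewrite /endo_part big_bool /= !(hcompE _ (ga _ _ (hcomp_mem _ _))).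
rewrite -[X in if _ then g X else _](hcomp_add v0) linearD addrC.
by case: a b ga => [] [] _ /=; rewrite ?scale1r ?scale0r ?addr0.
Qed.

Lemma der_hb0 a t (h : M -> M) : h =1 (fun=> 0) -> der_hb a h t = 0.
Proof.
move=> h0; rewrite /der_hb big1 // => i _.
by rewrite (@vee_eq0 _ _ _ _ i) ?scaler0 // /upd eqxx h0.
Qed.

Lemma sympow_act_cls a g (x : tpow n M) : hom_endo a g ->
  sympow_act g (cls n M x) = \sum_t x t *: der_hb a g t.
Proof.
move=> ga; rewrite sympow_actE (bigD1 a) //= [X in _ + X]big1 ?addr0.
  rewrite -(der_hb_cls x ga); apply: eq_bigr => t _; congr (_ *: _).
  by apply: eq_bigr => i _; rewrite (endo_part_hom _ _ ga) eqxx.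
move=> b ne; rewrite big1 // => t _; rewrite der_hb0 ?scaler0 // => v0.
by rewrite (endo_part_hom _ _ ga) eq_sym (negPf ne).
Qed.

Lemma sympow_act_vee a g v c : hom_endo a g -> (forall i, v i \in gr M (c i)) ->
  sympow_act g (vee v) =
  \sum_(i < n) (\prod_(k < n | (k < i)%N) eta a (c k)) *:
    vee (upd i (g (v i)) v).
Proof.
move=> ga vc; rewrite (sympow_act_cls _ ga).
under eq_bigr => t _ do rewrite scaler_sumr.
rewrite exchange_big; apply: eq_bigr => i _ /=.
pose h (j : 'I_n) (k : 'I_(hdim M)) := if j == i then g (hb k) else hb k.
have -> : vee (upd i (g (v i)) v) =
    vee (fun j => \sum_k hcoord k (v j) *: h j k).
  apply: eq_vee => j; rewrite /upd /h; case: eqP => [->|_].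
    rewrite {1}(hcoord_sum (v i)) linear_sum.
    by apply: eq_bigr => k _; rewrite linearZ.
  exact: hcoord_sum.
rewrite (vee_sum (fun j k => hcoord k (v j)) h) scaler_sumr.
apply: eq_bigr => t _; rewrite ffunE !scalerA [in RHS]mulrC.
have -> : vee (upd i (g (hb (t i))) (hbt t)) = vee (fun j => h j (t j)).
  by apply: eq_vee => j; rewrite /upd /h /hbt; case: eqP => // ->.
(* A basis tensor whose parities differ from [c] has a zero coordinate, so the sign read off [t] may
   be replaced by the one read off [c]. *)
congr (_ *: _); have [/forallP tc|/forallPn[j tj]] :=
    boolP [forall j, hpar (t j) == c j].
  by congr (_ * _); apply: eq_bigr => k _; rewrite (eqP (tc k)).
by rewrite (bigD1 j) //= (hcoord_gr (vc j) tj) !mul0r.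
Qed.

End Action.

(** * The form of the superpower *)

Section Form.
Variables (F : fieldType) (n : nat) (M N : superspace F) (B : M -> N -> F).
Local Notation eta := (@eta F).
Hypothesis B_linl : forall y, linear (fun x => B x y : F^o).
Hypothesis B_linr : forall x, linear (fun y => B x y : F^o).
Hypothesis B_even : forall a b x y,
  x \in gr M a -> y \in gr N b -> a != b -> B x y = 0.

(** The pairing of two basis tensors summed over S_n. The signs use the parities of [t] alone, since
    those of [u] agree with them along every nonzero product. *)
Definition form_hb (t : tidx n M) (u : tidx n N) : F :=
  kap F (tpars t) *
  \sum_(s : 'S_n) ksgn F s (tpars t) * \prod_i B (hb (t i)) (hb (u (s i))).

Lemma prod_form_even (f : 'I_n -> M) (v : 'I_n -> N) a b :
  (forall i, f i \in gr M (a i)) -> (forall i, v i \in gr N (b i)) ->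
  \prod_i B (f i) (v i) != 0 -> a =1 b.
Proof.
move=> fa vb nz i; apply/eqP; apply: contraNT nz => ne.
by rewrite (bigD1 i) //= (B_even (fa i) (vb i)) // mul0r.
Qed.

Lemma tens_form_sum x y :
  \sum_(s : 'S_n) tens_form B x (tact s y) =
  \sum_t \sum_u x t * y u * form_hb t u.
Proof.
rewrite /tens_form exchange_big; apply: eq_bigr => t _ /=.
under eq_bigr => s _.
  rewrite (reindex (fun u : tidx n N => [ffun i => u (s^-1%g i)])) /=; last first.
    by exists (fun u : tidx n N => [ffun i => u (s i)]) => u _;
      apply/ffunP => i; rewrite !ffunE ?permK ?permKV.
  over.
rewrite exchange_big; apply: eq_bigr => u _ /=; rewrite /form_hb !mulr_sumr.
rewrite (reindex_inj invg_inj); apply: eq_bigr => s _ /=.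
rewrite ffunE invgK.
have -> : [ffun i => [ffun i0 => u (s i0)] (s^-1%g i)] = u.
  by apply/ffunP => i; rewrite !ffunE permKV.
have -> : \prod_i B (hb (t i)) (hb ([ffun i0 => u (s i0)] i)) =
    \prod_i B (hb (t i)) (hb (u (s i))).
  by apply: eq_bigr => i _; rewrite ffunE.
have [->|nz] := eqVneq (\prod_i B (hb (t i)) (hb (u (s i)))) 0.
  by rewrite !mulr0.
have tu : tpars t =1 (fun i => tpars u (s i)).
  exact: prod_form_even (hbt_gr t) (fun i => hbt_gr u (s i)) nz.
have -> : ksgn F s^-1 (fun i => hpar ([ffun i0 => u (s i0)] (s^-1%g i))) =
    ksgn F s (tpars t).
  rewrite -(ksgnV F s (tpars t)); apply: eq_ksgn => i.
  by rewrite tu !ffunE permKV.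
have -> : \prod_(i < n) \prod_(j < n | (j < i)%N)
    eta (hpar (t i)) (hpar ([ffun i0 => u (s i0)] j)) = kap F (tpars t).
  by apply: eq_bigr => i _; apply: eq_bigr => j _; rewrite (tu j) ffunE.
ring.
Qed.

Lemma form_hb_perml p t u :
  ksgn F p (tpars t) * form_hb [ffun i => t (p^-1%g i)] u = form_hb t u.
Proof.
rewrite /form_hb mulrCA.
have -> : kap F (tpars [ffun i => t (p^-1%g i)]) = kap F (tpars t).
  rewrite -(kap_perm F p^-1%g (tpars t)); apply: eq_kap => i.
  by rewrite /tpars ffunE.
congr (_ * _); rewrite mulr_sumr.
rewrite [RHS](reindex_inj (mulgI p)); apply: eq_bigr => s _ /=.
have -> : ksgn F (p * s) (tpars t) =
    ksgn F s (tpars [ffun i => t (p^-1%g i)]) * ksgn F p (tpars t).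
  have E k : tpars t k = tpars [ffun i => t (p^-1%g i)] (p k).
    by rewrite /tpars ffunE permK.
  by rewrite !(eq_ksgn F _ E) ksgnM.
rewrite mulrA (mulrC (ksgn _ p _)); congr (_ * _).
rewrite (reindex_inj (@perm_inj _ p)); apply: eq_bigr => i _.
by rewrite ffunE permK permM.
Qed.

(** The cocycle rule wants the parities of [t] expressed by those of [u] along [s]; they agree
    unless the product of values vanishes. *)
Lemma form_hb_permr p t u :
  ksgn F p (tpars u) * form_hb t [ffun i => u (p^-1%g i)] = form_hb t u.
Proof.
rewrite /form_hb mulrCA; congr (_ * _); rewrite mulr_sumr.
rewrite (reindex_inj (mulIg p)); apply: eq_bigr => s _ /=.
under eq_bigr => i _ do rewrite ffunE permM permK.
have [->|nz] := eqVneq (\prod_i B (hb (t i)) (hb (u (s i)))) 0.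
  by rewrite !mulr0.
have tu : tpars t =1 (fun i => tpars u (s i)).
  exact: prod_form_even (hbt_gr t) (fun i => hbt_gr u (s i)) nz.
by rewrite mulrA !(eq_ksgn F _ tu) ksgnM mulrA ksgn_sqr mul1r.
Qed.

Lemma sympow_form_cls (x : tpow n M) (y : tpow n N) :
  sympow_form B (cls n M x) (cls n N y) =
  \sum_t \sum_u x t * y u * form_hb t u.
Proof.
(* [L] is bilinear and invariant in each variable, so [ker_of_hb] removes the two chosen
   representatives one at a time. *)
pose L (z : tpow n N) (w : tpow n M) : F^o :=
  \sum_t \sum_u w t * z u * form_hb t u.
have L_linl z : linear (L z).
  move=> c w w'; rewrite /L scaler_sumr -big_split; apply: eq_bigr => t _ /=.
  rewrite scaler_sumr -big_split; apply: eq_bigr => u _ /=.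
  by rewrite !ffunE /GRing.scale /=; ring.
have L_linr w : linear (L^~ w).
  move=> c z z'; rewrite /L scaler_sumr -big_split; apply: eq_bigr => t _ /=.
  rewrite scaler_sumr -big_split; apply: eq_bigr => u _ /=.
  by rewrite !ffunE /GRing.scale /=; ring.
have E t u : L (tens (hbt u)) (tens (hbt t)) = form_hb t u.
  rewrite /L (bigD1 t) //= (bigD1 u) //= !tens_hb !eqxx !mul1r.
  rewrite !big1 ?addr0 // => [t' /negPf ne|u' /negPf ne].
    by rewrite big1 // => u' _; rewrite tens_hb ne !mul0r.
  by rewrite tens_hb ne mulr0 mul0r.
have Lx u w : L (tens (hbt u)) (vsval (cls n M w)) = L (tens (hbt u)) w.
  apply: (ker_of_hb (L_linl _)) => s t.
  by rewrite tact_hb (linZ (L_linl _)) !E; apply: form_hb_perml.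
have Ly w z : L (vsval (cls n N z)) (tens (hbt w)) = L z (tens (hbt w)).
  apply: (ker_of_hb (L_linr _)) => s t.
  by rewrite tact_hb (linZ (L_linr _)) !E; apply: form_hb_permr.
rewrite /sympow_form tens_form_sum -/(L _ _).
rewrite [X in L X](tpow_sum (vsval (cls n N y))) (linear_expand _ _ (L_linr _)).
under eq_bigr => u _ do rewrite Lx.
rewrite -(linear_expand _ _ (L_linr _)) -tpow_sum.
rewrite [X in L _ X]tpow_sum (linear_expand _ _ (L_linl _)).
under eq_bigr => t _ do rewrite Ly.
by rewrite -(linear_expand _ _ (L_linl _)) -tpow_sum.
Qed.

Lemma sympow_form_vee (f : 'I_n -> M) (v : 'I_n -> N) a :
  (forall i, f i \in gr M (a i)) ->
  sympow_form B (vee f) (vee v) =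
  kap F a * \sum_(s : 'S_n) ksgn F s a * \prod_i B (f i) (v (s i)).
Proof.
move=> fa; rewrite /vee sympow_form_cls.
have Bsum x y : B x y =
    \sum_k \sum_k' hcoord k x * hcoord k' y * B (hb k) (hb k').
  rewrite {1}(hcoord_sum x) (linear_expand _ _ (B_linl y)).
  apply: eq_bigr => k _; rewrite {1}(hcoord_sum y).
  rewrite (linear_expand _ _ (B_linr _)) scaler_sumr.
  by apply: eq_bigr => k' _; rewrite scalerA.
under [X in _ = _ * X]eq_bigr => s _ do
  (under eq_bigr => i _ do rewrite Bsum; rewrite -(sum_ffun2 s)).
have -> : \sum_t \sum_u tens f t * tens v u * form_hb t u =
    \sum_t \sum_u tens f t * tens v u * (kap F a *
     \sum_(s : 'S_n) ksgn F s a * \prod_i B (hb (t i)) (hb (u (s i)))).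
  apply: eq_bigr => t _; apply: eq_bigr => u _.
  have [/forallP ta|/forallPn[i ti]] := boolP [forall i, hpar (t i) == a i].
    have ta' i : tpars t i = a i by rewrite -(eqP (ta i)).
    rewrite /form_hb (eq_kap F ta'); congr (_ * (_ * _)).
    by apply: eq_bigr => s _; rewrite (eq_ksgn F s ta').
  by rewrite !ffunE (bigD1 i) //= (hcoord_gr (fa i) ti) !mul0r.
transitivity (\sum_(s : 'S_n) \sum_(t : tidx n M) \sum_(u : tidx n N) kap F a *
    (tens f t * tens v u * (ksgn F s a * \prod_i B (hb (t i)) (hb (u (s i)))))).
  rewrite [RHS]exchange_big; apply: eq_bigr => t _ /=.
  rewrite [RHS]exchange_big; apply: eq_bigr => u _ /=.
  by rewrite mulrCA 2!mulr_sumr.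
rewrite mulr_sumr; apply: eq_bigr => s _ /=.
rewrite !mulr_sumr; apply: eq_bigr => t _.
rewrite !mulr_sumr; apply: eq_bigr => u _.
rewrite !ffunE !big_split /=.
rewrite [X in _ * (_ * X * _)](reindex_inj (@perm_inj _ s)) /=.
ring.
Qed.

End Form.

(** * The inner structure superalgebra and the Faulkner construction *)

(** [lfunE] speaks of bundled linear maps, whereas the products of a superpair are linear by
    hypothesis. *)
Lemma linfunE (F : fieldType) (U W : vectType F) (f : U -> W) :
  linear f -> linfun f =1 f.
Proof.
move=> fl; pose LL := GRing.isLinear.Build F U W *:%R f fl.
pose f' : {linear U -> W} := HB.pack f LL.
exact: (lfunE f').
Qed.

Section Twist.
Variables (F : fieldType) (M N : superspace F) (U : lmodType F).
Variable B : M -> N -> U.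
Hypothesis B_linl : forall y, linear (B^~ y).
Hypothesis B_linr : forall x, linear (B x).

Lemma twist_hom a b x y : x \in gr M a -> y \in gr N b ->
  twist B y x = eta a b *: B x y.
Proof.
move=> xa yb; rewrite /twist (bigD1 a) //= (bigD1 b) //= !hcomp_id //.
rewrite !big1 ?addr0 // => [c /negPf ne|c /negPf ne].
  rewrite big1 // => d _.
  by rewrite (hcompE c xa) ne (linZ (B_linl _)) scale0r scaler0.
by rewrite (hcompE c yb) ne (linZ (B_linr _)) scale0r scaler0.
Qed.

Lemma bilin_hcomp x y :
  B x y = \sum_(a : bool) \sum_(b : bool) B (hcomp a x) (hcomp b y).
Proof.
rewrite !big_bool /= -!(linD (B_linr _)) ![hcomp true _ + _]addrC !hcomp_add.
by rewrite -(linD (B_linl _)) [hcomp true _ + _]addrC hcomp_add.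
Qed.

Lemma twist_linl y : linear (fun x => twist B y x).
Proof.
move=> c x x'; rewrite /twist scaler_sumr -big_split; apply: eq_bigr => a _ /=.
rewrite scaler_sumr -big_split; apply: eq_bigr => b _ /=.
by rewrite linearP B_linl scalerDr !scalerA mulrC.
Qed.

Lemma twist_linr x : linear (fun y => twist B y x).
Proof.
move=> c y y'; rewrite /twist scaler_sumr -big_split; apply: eq_bigr => a _ /=.
rewrite scaler_sumr -big_split; apply: eq_bigr => b _ /=.
by rewrite linearP B_linr scalerDr !scalerA mulrC.
Qed.

End Twist.

Section Trilinear.
Variables (F : fieldType) (V : superpair F).
Hypothesis lin1 : forall s (y : V (~~ s)) (z : V s),
  linear (fun x => trip x y z).
Hypothesis lin2 : forall s (x z : V s),
  linear (fun y : V (~~ s) => trip x y z).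
Hypothesis lin3 : forall s (x : V s) (y : V (~~ s)), linear (trip x y).

Lemma nu0_1 f v g : (nu0 f v : endpair V).1 g = tneg f v g.
Proof. exact: (linfunE (@lin3 false f v)). Qed.

Lemma tpos_linl (w : V true) v : linear (fun f : V false => tpos v f w).
Proof. exact: (@lin2 true v w). Qed.

Lemma tpos_linr (w : V true) f : linear (fun v => @tpos F V v f w).
Proof. exact: (@lin1 true f w). Qed.

Lemma tpos_lin3 v f : linear (@tpos F V v f).
Proof. exact: (@lin3 true v f). Qed.

Lemma tneg_linl v g : linear (fun f => @tneg F V f v g).
Proof. exact: (@lin1 false v g). Qed.

Lemma tneg_linr f g : linear (fun v => @tneg F V f v g).
Proof. exact: (@lin2 false f g). Qed.

Lemma nu0_2E f v w :
  (nu0 f v : endpair V).2 w = - twist (fun g u => @tpos F V u g w) v f.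
Proof.
rewrite linfunE // => c x y; rewrite scalerN -opprD; congr (- _).
rewrite /twist scaler_sumr -big_split; apply: eq_bigr => a _ /=.
rewrite scaler_sumr -big_split; apply: eq_bigr => b _ /=.
by rewrite (tpos_lin3 _ _) scalerDr !scalerA mulrC.
Qed.

Lemma nu0_2 a b f v w : f \in gr (V false) a -> v \in gr (V true) b ->
  (nu0 f v : endpair V).2 w = - (eta a b *: tpos v f w).
Proof.
move=> fa vb; rewrite nu0_2E (twist_hom _ _ fa vb) //.
- by move=> u; apply: tpos_linl.
- by move=> g; apply: tpos_linr.
Qed.

Lemma endpair_eq (x y : endpair V) : x.1 =1 y.1 -> x.2 =1 y.2 -> x = y.
Proof. by case: x y => [? ?] [? ?] /= /lfunP -> /lfunP ->. Qed.

Lemma nu0_linl v : linear (fun f => nu0 f v : endpair V).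
Proof.
move=> c f f'; apply: endpair_eq => w.
  by rewrite /= !lfun_simp !nu0_1 (tneg_linl v w).
rewrite [RHS]/= !lfun_simp !nu0_2E scalerN -opprD; congr (- _).
by apply: twist_linl => u; apply: tpos_linl.
Qed.

Lemma nu0_linr f : linear (fun v => nu0 f v : endpair V).
Proof.
move=> c v v'; apply: endpair_eq => w.
  by rewrite /= !lfun_simp !nu0_1 (tneg_linr f w).
rewrite [RHS]/= !lfun_simp !nu0_2E scalerN -opprD; congr (- _).
by apply: twist_linr => u; apply: tpos_linr.
Qed.

Lemma nu_opp a b (v : V true) (f : V false) :
  v \in gr (V true) a -> f \in gr (V false) b ->
  nu v f = - (eta b a *: nu0 f v).
Proof.
move=> va fb; rewrite /nu (twist_hom _ _ fb va) //.
  exact: nu0_linl.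
exact: nu0_linr.
Qed.

Lemma ecomp_lin s c (x y : endpair V) w :
  ecomp (c *: x + y) s w = c *: ecomp x s w + ecomp y s w.
Proof. by case: s w => w /=; rewrite !lfun_simp. Qed.

(** When [x] lies in [V true], both [nu] and the second component of [nu0] are twisted by the same
    sign, which cancels on homogeneous components. *)
Lemma ecomp_nu s (x : V (~~ s)) (y : V s) (z : V (~~ s)) :
  ecomp (nu x y) (~~ s) z = trip x y z.
Proof.
case: s x y z => x y z /=; first exact: nu0_1.
rewrite /twist !lfun_simp.
have -> : tpos x y z =
    \sum_(a : bool) \sum_(b : bool) tpos (hcomp b x) (hcomp a y) z.
  by rewrite (@bilin_hcomp _ _ _ _ (fun f v => tpos v f z)) //;
    [apply: tpos_linl|apply: tpos_linr].
have lin_2 : linear (fun X : endpair V => X.2 z).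
  by move=> c X Y; rewrite /= !lfun_simp.
have sum2 (I : finType) (X : I -> endpair V) :
    (\sum_i X i).2 z = \sum_i (X i).2 z.
  have := linear_expand (fun=> 1) X lin_2.
  by under eq_bigr do rewrite scale1r; under [RHS]eq_bigr do rewrite scale1r.
rewrite sum2 -sumrN; apply: eq_bigr => a _; rewrite sum2 -sumrN.
apply: eq_bigr => b _; rewrite (linZ lin_2).
rewrite (nu0_2 _ (hcomp_mem _ _) (hcomp_mem _ _)).
by rewrite scalerN opprK scalerA eta_sqr scale1r.
Qed.

End Trilinear.

(** * The invariant form on the inner structure superalgebra *)

Section Metric.
Variables (F : fieldType) (V : superpair F).
Hypothesis VM : metric_generalized_jordan_superpair V.
Local Notation eta := (@eta F).
Implicit Types (x y z : endpair V) (c d : bool).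

Let lin1 := trip_linear1 (mgjs_trilinear VM).
Let lin2 := trip_linear2 (mgjs_trilinear VM).
Let lin3 := trip_linear3 (mgjs_trilinear VM).
Let B_linl := form_linear1 (mgjs_metric VM).
Let B_linr := form_linear2 (mgjs_metric VM).
Let B_even := form_even (mgjs_metric VM).
Let n1 := nu0_1 lin3.
Let n2 := nu0_2 lin1 lin2 lin3.
Let n_linl := nu0_linl lin1 lin2 lin3.
Let n_linr := nu0_linr lin1 lin2 lin3.

Local Notation B := (@spform F V).

Definition genidx := ('I_(hdim (V false)) * 'I_(hdim (V true)))%type.
Definition gen (k : genidx) : endpair V := nu0 (hb k.1) (hb k.2).
Definition gpar (k : genidx) : bool := hpar k.1 (+) hpar k.2.

Lemma instrP x : reflect (exists g : genidx -> F, x = \sum_k g k *: gen k)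
  (x \in instr V).
Proof.
have -> : instr V = (\sum_(k : genidx) <[gen k]>)%VS.
  by rewrite /instr span_def big_map big_enum.
apply: (iffP memv_sumP) => [[y yP ->]|[g ->]]; last first.
  by exists (fun k => g k *: gen k) => // k _; rewrite memvZ ?memv_line.
have g k : {c | y k = c *: gen k}.
  by apply: cid; have /vlineP := yP k isT.
exists (fun k => projT1 (g k)); apply: eq_bigr => k _.
exact: projT2 (g k).
Qed.

Lemma gen_instr k : gen k \in instr V.
Proof.
apply/instrP; exists (fun j => (j == k)%:R).
rewrite (bigD1 k) //= eqxx scale1r big1 ?addr0 // => j /negPf ->.
by rewrite scale0r.
Qed.

Lemma nu0_gen f v :
  nu0 f v = \sum_(k : genidx) (hcoord k.1 f * hcoord k.2 v) *: gen k.
Proof.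
rewrite {1}(hcoord_sum f) (linear_expand _ _ (n_linl _)).
rewrite -(pair_bigA _ (fun i j => (hcoord i f * hcoord j v) *: gen (i, j))) /=.
apply: eq_bigr => i _.
rewrite {1}(hcoord_sum v) (linear_expand _ _ (n_linr _)) scaler_sumr.
by apply: eq_bigr => j _; rewrite scalerA.
Qed.

Lemma nu0_instr f v : nu0 f v \in instr V.
Proof. by apply/instrP; rewrite nu0_gen; eexists. Qed.

Lemma tpos_gr a b c f v w : v \in gr (V true) a -> f \in gr (V false) b ->
  w \in gr (V true) c -> tpos v f w \in gr (V true) (a (+) b (+) c).
Proof.
move=> va fb wc.
exact: (@trip_graded _ _ (mgjs_trilinear VM) true _ _ _ _ _ _ va fb wc).
Qed.

Lemma tneg_gr a b c f v g : f \in gr (V false) a -> v \in gr (V true) b ->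
  g \in gr (V false) c -> tneg f v g \in gr (V false) (a (+) b (+) c).
Proof.
move=> fa vb gc.
exact: (@trip_graded _ _ (mgjs_trilinear VM) false _ _ _ _ _ _ fa vb gc).
Qed.

Lemma nu0_ehom a b f v : f \in gr (V false) a -> v \in gr (V true) b ->
  ehom (a (+) b) (nu0 f v).
Proof.
move=> fa vb [|] c w wc /=.
  rewrite (n2 _ fa vb) memvN memvZ //.
  have -> : c (+) (a (+) b) = b (+) a (+) c by case: a b c {fa vb wc} => [] [] [].
  exact: tpos_gr.
rewrite n1.
have -> : c (+) (a (+) b) = a (+) b (+) c by case: a b c {fa vb wc} => [] [] [].
exact: tneg_gr.
Qed.

Lemma gen_ehom k : ehom (gpar k) (gen k).
Proof. exact: nu0_ehom (hb_gr _) (hb_gr _). Qed.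

Lemma ecomp_sum s (I : finType) (g : I -> F) (X : I -> endpair V) w :
  ecomp (\sum_i g i *: X i) s w = \sum_i g i *: ecomp (X i) s w.
Proof.
have l : linear (fun x : endpair V => ecomp x s w).
  by move=> c x y; apply: ecomp_lin.
exact: (linear_expand _ _ l).
Qed.

Lemma sum1 (I : finType) (g : I -> F) (X : I -> endpair V) w :
  (\sum_i g i *: X i).1 w = \sum_i g i *: (X i).1 w.
Proof. exact: (@ecomp_sum false). Qed.

Lemma sum2 (I : finType) (g : I -> F) (X : I -> endpair V) w :
  (\sum_i g i *: X i).2 w = \sum_i g i *: (X i).2 w.
Proof. exact: (@ecomp_sum true). Qed.

Lemma ehom_sum c (g : genidx -> F) : (forall k, gpar k != c -> g k = 0) ->
  ehom c (\sum_k g k *: gen k).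
Proof.
move=> gc s d w wd; rewrite ecomp_sum; apply: memv_suml => k _.
have [<-|/gc ->] := eqVneq (gpar k) c; last by rewrite scale0r mem0v.
by rewrite memvZ //; apply: gen_ehom.
Qed.

Lemma ecomp_eq x y : (forall s, ecomp x s =1 ecomp y s) -> x = y.
Proof. by move=> e; apply: endpair_eq; [apply: (e false)|apply: (e true)]. Qed.

Lemma ehom_eq0 c x : ehom c x -> ehom (~~ c) x -> x = 0.
Proof.
move=> x1 x2; apply: ecomp_eq => s w.
have -> : ecomp (0 : endpair V) s w = 0 by case: s w => w /=; rewrite lfunE.
rewrite -(hcomp_add w) linearD /=.
have E d : ecomp x s (hcomp d w) = 0.
  apply: (gr_eq0 (x1 _ _ _ (hcomp_mem d w)) (x2 _ _ _ (hcomp_mem d w))).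
  by case: c d {x1 x2} => [] [].
by rewrite !E addr0.
Qed.

(** As the generators may be dependent, a homogeneous element can come with coefficients at
    generators of the wrong parity. Those terms sum to an element of both parities, hence to zero,
    and are dropped. *)
Lemma instr_homP c x : x \in instr V -> ehom c x ->
  exists g : genidx -> F, x = \sum_k g k *: gen k /\
    forall k, gpar k != c -> g k = 0.
Proof.
case/instrP => g xE xc.
pose h d k := if gpar k == d then g k else 0.
have xD : x = \sum_k h c k *: gen k + \sum_k h (~~ c) k *: gen k.
  rewrite xE -big_split; apply: eq_bigr => k _ /=; rewrite /h.
  by case: (gpar k) c {xc} => [] []; rewrite /= scale0r ?addr0 ?add0r.
have h_hom d : ehom d (\sum_k h d k *: gen k).
  by apply: ehom_sum => k /negPf; rewrite /h => ->.
exists (h c); split; last by move=> k /negPf; rewrite /h => ->.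
rewrite [LHS]xD; suff -> : \sum_k h (~~ c) k *: gen k = 0 by rewrite addr0.
apply: (@ehom_eq0 (~~ c)) => //; rewrite negbK.
have -> : \sum_k h (~~ c) k *: gen k = x - \sum_k h c k *: gen k.
  by rewrite xD addrC addKr.
move=> s d w wd; rewrite -[_ - _]addrC -scaleN1r ecomp_lin.
by rewrite memvD ?memvZ //; [apply: h_hom|apply: xc].
Qed.

(** The two components of an element of [instr] are superadjoint up to sign; on generators this is
    superinvariance of the form. *)
Lemma spform_inv c b x f v : x \in instr V -> ehom c x ->
  f \in gr (V false) b ->
  B (x.1 f) v = - (eta c b * B f (x.2 v)).
Proof.
move=> xi xc fb; have [g [-> gc]] := instr_homP xi xc.
rewrite sum1 sum2.
rewrite (linear_expand _ _ (B_linl _)) (linear_expand _ _ (B_linr _)).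
rewrite mulr_sumr -sumrN; apply: eq_bigr => k _ /=.
have [kc|/gc ->] := eqVneq (gpar k) c; last by rewrite !scale0r mulr0 oppr0.
rewrite n1 (form_superinvariant (mgjs_metric VM) _ (hb_gr _) (hb_gr _) fb).
rewrite (n2 _ (hb_gr _) (hb_gr _)) -scaleNr (linZ (B_linr _)) -kc /gpar.
rewrite /GRing.scale /= /eta3 etaDl (etaC _ b).
ring.
Qed.

(** Here [x] need not be homogeneous: the form being even, only the part of [x] of parity [a (+) b]
    contributes. *)
Lemma spform_inv2 a b x f v : x \in instr V ->
  f \in gr (V false) a -> v \in gr (V true) b ->
  B (x.1 f) v = - (eta (a (+) b) a * B f (x.2 v)).
Proof.
move=> /instrP[g ->] fa vb.
rewrite sum1 sum2.
rewrite (linear_expand _ _ (B_linl _)) (linear_expand _ _ (B_linr _)).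
rewrite mulr_sumr -sumrN; apply: eq_bigr => k _ /=.
rewrite (spform_inv _ (gen_instr k) (gen_ehom k) fa) scalerN; congr (- _).
have [->|nz] := eqVneq (B f ((gen k).2 v)) 0.
  by rewrite /GRing.scale /= !mulr0.
have -> : gpar k = a (+) b.
  apply/eqP; apply: contraNT nz => ne; apply/eqP.
  apply: (B_even fa (gen_ehom k (s := true) vb)).
  by case: a b (gpar k) ne {fa vb} => [] [] [].
by rewrite /GRing.scale /= mulrCA.
Qed.

Lemma spform_eq0r (v : V true) :
  (forall a f, f \in gr (V false) a -> B f v = 0) -> v = 0.
Proof.
move=> v0; apply: (form_nondeg2 (mgjs_metric VM)) => f.
rewrite -(hcomp_add f) (linD (B_linl v)).
by rewrite (v0 _ _ (hcomp_mem _ _)) (v0 _ _ (hcomp_mem _ _)) addr0.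
Qed.

(** By adjointness and nondegeneracy the component on [V true] is determined by the one on
    [V false]. *)
Lemma instr_eq0 x : x \in instr V -> x.1 =1 (fun=> 0) -> x = 0.
Proof.
move=> xi x0; have x2 b v : v \in gr (V true) b -> x.2 v = 0.
  move=> vb; apply: spform_eq0r => a f fa.
  have := spform_inv2 xi fa vb; rewrite x0 (lin0 (B_linl _)) => /esym/eqP.
  by rewrite oppr_eq0 mulf_eq0 (negPf (eta_neq0 _ _ _)) => /eqP.
apply: endpair_eq => w; first by rewrite x0 lfunE.
rewrite -(hcomp_add w) linearD /= !(x2 _ _ (hcomp_mem _ _)) addr0.
by rewrite lfunE.
Qed.

(** The Gram matrix, on the generators, of the invariant form to be built. *)
Definition genform (j k : genidx) : F := B ((gen j).1 (hb k.1)) (hb k.2).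

Lemma genform0 j k : gpar j != gpar k -> genform j k = 0.
Proof.
move=> ne; apply: (B_even (gen_ehom j (s := false) (hb_gr k.1)) (hb_gr k.2)).
by move: ne; rewrite /gpar; do 4!case: hpar.
Qed.

Lemma genformC j k : genform j k = eta (gpar j) (gpar k) * genform k j.
Proof.
rewrite /genform !n1.
by apply: (form_supersym1 (mgjs_metric VM)); apply: hb_gr.
Qed.

(** By evenness the sign of supersymmetry can be written with one index only, so it leaves sums over
    the other one. *)
Lemma genform_sign j k : genform j k = eta (gpar j) (gpar j) * genform k j.
Proof.
have [e|ne] := eqVneq (gpar j) (gpar k); first by rewrite genformC -e.
by rewrite !genform0 ?mulr0 // eq_sym.
Qed.

(** The right-hand side depends on [g] only through the element that [g] represents: this is why the
    form does not depend on the choice of coefficients. *)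
Lemma sum_genform (g : genidx -> F) j :
  \sum_k g k * genform j k =
  eta (gpar j) (gpar j) * B ((\sum_k g k *: gen k).1 (hb j.1)) (hb j.2).
Proof.
rewrite sum1 (linear_expand _ _ (B_linl _)) mulr_sumr.
by apply: eq_bigr => k _; rewrite genform_sign mulrCA.
Qed.

Definition gcoef (y : endpair V) : genidx -> F :=
  xget (fun=> 0) [set g | y = \sum_k g k *: gen k]%classic.

Lemma gcoefP y : y \in instr V -> y = \sum_k gcoef y k *: gen k.
Proof.
by move=> /instrP yi; apply: (@xgetPex _ _ [set g | y = \sum_k g k *: gen k]%classic).
Qed.

Definition bform x y : F := \sum_k gcoef y k * B (x.1 (hb k.1)) (hb k.2).

Lemma bformE x g : x \in instr V ->
  bform x (\sum_k g k *: gen k) = \sum_k g k * B (x.1 (hb k.1)) (hb k.2).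
Proof.
move=> xi; set y := \sum_k _.
have yi : y \in instr V by apply/instrP; exists g.
have [h ->] := instrP _ xi.
have E (g' : genidx -> F) : \sum_k g' k * B ((\sum_j h j *: gen j).1 (hb k.1)) (hb k.2) =
    \sum_j h j * \sum_k g' k * genform j k.
  under eq_bigr => k _.
    rewrite sum1 (linear_expand _ _ (B_linl _)) mulr_sumr; over.
  rewrite exchange_big; apply: eq_bigr => j _ /=; rewrite mulr_sumr.
  by apply: eq_bigr => k _; rewrite [h j *: _]/(h j * _) mulrCA.
by rewrite /bform !E; apply: eq_bigr => j _; rewrite !sum_genform -gcoefP.
Qed.

Lemma bform_nu x f v : x \in instr V -> bform x (nu0 f v) = B (x.1 f) v.
Proof.
move=> xi; rewrite nu0_gen (bformE _ xi).
have l : linear (fun f => B (x.1 f) v : F^o).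
  by move=> c g g'; rewrite linearP B_linl.
rewrite {2}(hcoord_sum f) (linear_expand _ _ l).
rewrite -(pair_bigA _ (fun i j => hcoord i f * hcoord j v *
  B (x.1 (hb i)) (hb j))) /=.
apply: eq_bigr => i _; rewrite {2}(hcoord_sum v).
rewrite (linear_expand _ _ (B_linr _)) scaler_sumr.
by apply: eq_bigr => j _; rewrite scalerA.
Qed.

Lemma bform_linr (c : F) x y z : x \in instr V -> y \in instr V -> z \in instr V ->
  bform x (c *: y + z) = c * bform x y + bform x z.
Proof.
move=> xi /instrP[g ->] /instrP[h ->].
have -> : c *: (\sum_k g k *: gen k) + \sum_k h k *: gen k =
    \sum_k (c * g k + h k) *: gen k.
  rewrite scaler_sumr -big_split; apply: eq_bigr => k _ /=.
  by rewrite scalerA -scalerDl.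
rewrite !bformE // mulr_sumr -big_split; apply: eq_bigr => k _ /=.
by rewrite mulrDl mulrA.
Qed.

Lemma jordan_pos a b c d (x z : V false) (y w u : V true) :
  x \in gr (V false) a -> y \in gr (V true) b ->
  z \in gr (V false) c -> w \in gr (V true) d ->
  tpos y x (tpos w z u) - eta (b (+) a) (d (+) c) *: tpos w z (tpos y x u) =
  tpos (tpos y x w) z u - eta3 b a d *: tpos w (tneg x y z) u.
Proof. by move=> xa yb zc wd; apply: (mgjs_jordan VM (s := true)). Qed.

Lemma jordan_neg a b c d (x z u : V false) (y w : V true) :
  x \in gr (V false) a -> y \in gr (V true) b ->
  z \in gr (V false) c -> w \in gr (V true) d ->
  tneg x y (tneg z w u) - eta (a (+) b) (c (+) d) *: tneg z w (tneg x y u) =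
  tneg (tneg x y z) w u - eta3 a b c *: tneg z (tpos y x w) u.
Proof. by move=> xa yb zc wd; apply: (mgjs_jordan VM (s := false)). Qed.

(** The generalized Jordan identity, first for a generator [x] and then by linearity: [x] acts on
    nu(f, v) as a superderivation. Hence [instr] is stable under the bracket, and invariance of the
    form can be tested on generators. *)
Lemma ebracket_nu c a b x f v : x \in instr V -> ehom c x ->
  f \in gr (V false) a -> v \in gr (V true) b ->
  ebracket c (a (+) b) x (nu0 f v) =
  nu0 (x.1 f) v + eta c a *: nu0 f (x.2 v).
Proof.
move=> xi xc fa vb; have [g [-> gc]] := instr_homP xi xc.
have -> : nu0 ((\sum_k g k *: gen k).1 f) v + eta c a *:
    nu0 f ((\sum_k g k *: gen k).2 v) =
    \sum_k g k *: (nu0 ((gen k).1 f) v + eta c a *: nu0 f ((gen k).2 v)).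
  rewrite sum1 sum2 (linear_expand _ _ (n_linl _)) (linear_expand _ _ (n_linr _)).
  rewrite scaler_sumr -big_split; apply: eq_bigr => k _ /=.
  by rewrite scalerDr !scalerA mulrC.
have br s (X Y : endpair V) w : ecomp (ebracket c (a (+) b) X Y) s w =
    ecomp X s (ecomp Y s w) - eta c (a (+) b) *: ecomp Y s (ecomp X s w).
  by case: s w => w /=; rewrite !lfun_simp.
apply: ecomp_eq => s w; rewrite br !ecomp_sum.
have -> : ecomp (nu0 f v) s (\sum_k g k *: ecomp (gen k) s w) =
    \sum_k g k *: ecomp (nu0 f v) s (ecomp (gen k) s w).
  by rewrite linear_sum; apply: eq_bigr => k _; rewrite linearZ.
rewrite scaler_sumr -sumrB.
apply: eq_bigr => k _; rewrite [X in _ - X]scalerA.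
rewrite [X in _ - X *: _]mulrC.
rewrite -scalerA -scalerBr.
have [kc|/gc ->] := eqVneq (gpar k) c; last by rewrite !scale0r.
congr (_ *: _); have hf := hb_gr k.1; have hv := hb_gr k.2.
rewrite [in RHS]addrC ecomp_lin.
have eT X u : ecomp X true u = X.2 u by [].
have eF X u : ecomp X false u = X.1 u by [].
case: s w => w; rewrite ?eT ?eF {eT eF}.
  (* On [V true] every nu carries a twist. Once the Jordan identity has been applied, the remaining
     signs depend on four parities and are checked case by case. *)
  rewrite /gen !(n2 _ hf hv) !(n2 _ fa vb).
  have gv := tpos_gr hv hf vb; have gf := tneg_gr hf hv fa.
  rewrite (n2 _ fa (b := hpar k.2 (+) hpar k.1 (+) b)); last first.
    by rewrite memvN memvZ //; apply: gv.
  rewrite n1 (n2 _ gf vb).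
  have tl f' w' : linear (fun u : V true => tpos u f' w') by apply: tpos_linr.
  have tl3 u' f' : linear (@tpos F V u' f') by apply: tpos_lin3.
  rewrite -!scaleNr !(linZ (tl3 _ _)) (linZ (tl _ _)) !scalerA.
  have := jordan_pos w hf hv fa vb; move/eqP; rewrite subr_eq => /eqP ->.
  rewrite !scalerDr !scalerN !scalerA -kc /gpar -!scaleNr.
  set T1 := tpos (tpos _ _ _) _ _; set T2 := tpos _ (tneg _ _ _) _.
  set T3 := tpos _ _ (tpos _ _ _); rewrite -!addrA; congr (_ *: _ + _).
    have E (p q a' b' : bool) : - eta p q * - eta a' b' =
        eta (p (+) q) a' * - eta a' (q (+) p (+) b') * - eta p q.
      by case: p q a' b' => [] [] [] []; rewrite /Defs.eta /= ?expr0 ?expr1; ring.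
    exact: E.
  rewrite -scalerDl [X in _ + X *: _](_ : _ = 0); last first.
    by rewrite [hpar k.2 (+) _]addbC [b (+) a]addbC; ring.
  rewrite scale0r addr0; congr (_ *: _).
  have E (p q a' b' : bool) : - (- eta p q * - eta a' b' * eta3 q p b') =
      - eta (p (+) q (+) a') b'.
    by case: p q a' b' => [] [] [] []; rewrite /eta3 /Defs.eta /= ?expr0 ?expr1; ring.
  exact: E.
rewrite /gen !n1.
have gv := tpos_gr hv hf vb; have gf := tneg_gr hf hv fa.
rewrite (n2 _ hf hv).
have tl f' w' : linear (fun u : V true => @tneg F V f' u w') by apply: tneg_linr.
rewrite -!scaleNr (linZ (tl _ _)) scalerA.
have := jordan_neg w hf hv fa vb; move/eqP; rewrite subr_eq => /eqP ->.
rewrite -kc /gpar [X in _ + X]scaleNr addrK addrC -scaleNr; congr (_ *: _ + _).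
by rewrite eta3E etaDl [eta (hpar k.1) a]etaC; ring.
Qed.

Lemma ebracket_sumr c d x (g : genidx -> F) (X : genidx -> endpair V) :
  ebracket c d x (\sum_k g k *: X k) = \sum_k g k *: ebracket c d x (X k).
Proof.
have l : linear (ebracket c d x).
  move=> e y z; apply: endpair_eq => w /=; rewrite !lfun_simp linearP /=;
    by rewrite scalerDr scalerBr opprD addrACA !scalerA (mulrC e).
exact: (linear_expand _ _ l).
Qed.

(** The left side is b(x, [y, nu(f, v)]) by [ebracket_nu], the right side pairs [x, y] f with v:
    this is invariance of the form on generators. *)
Lemma bform_nu2 c a b x y f v : x \in instr V -> y \in instr V ->
  ehom a x -> ehom c y -> f \in gr (V false) b ->
  bform x (nu0 (y.1 f) v + eta c b *: nu0 f (y.2 v)) =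
  B (x.1 (y.1 f)) v - eta a c * B (y.1 (x.1 f)) v.
Proof.
move=> xi yi xa yc fb; rewrite addrC bform_linr ?nu0_instr // !bform_nu //.
rewrite addrC; congr (_ + _).
rewrite (spform_inv _ yi yc (xa false _ _ fb)) mulrN opprK mulrA; congr (_ * _).
by case: a b c {xa yc fb} => [] [] []; rewrite /Defs.eta /= ?expr0 ?expr1; ring.
Qed.

(** The witness that the choice in [instr_form] requires. Nondegeneracy and evenness come from the
    form of V, invariance from [ebracket_nu], supersymmetry from [genformC]. *)
Lemma bform_instr_form : is_instr_form bform.
Proof.
split.
- move=> k x y z xi yi zi; rewrite /bform mulr_sumr -big_split.
  apply: eq_bigr => j _ /=; rewrite !lfun_simp (B_linl _ k).
  by rewrite [k *: _]/(k * _) mulrDr mulrCA.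
- by move=> k x y z xi yi zi; apply: bform_linr.
- move=> x xi x0; apply: (instr_eq0 xi) => f.
  apply: (form_nondeg1 (mgjs_metric VM)) => v.
  by rewrite -bform_nu // x0 // nu0_instr.
- move=> a c x y xi yi xa yc ne.
  have [g [-> gc]] := instr_homP yi yc; rewrite bformE // big1 // => k _.
  have [kc|/gc ->] := eqVneq (gpar k) c; last by rewrite mul0r.
  rewrite (B_even (xa false _ _ (hb_gr k.1)) (hb_gr k.2)) ?mulr0 //.
  by move: ne; rewrite -kc /gpar; case: a {xa}; do 2!case: hpar.
- move=> a c d x y z xi yi zi xa yc zd.
  have [g [-> gc]] := instr_homP zi zd.
  have brE : ebracket c d y (\sum_k g k *: gen k) =
      \sum_k g k *: (nu0 (y.1 (hb k.1)) (hb k.2) +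
                     eta c (hpar k.1) *: nu0 (hb k.1) (y.2 (hb k.2))).
    rewrite ebracket_sumr; apply: eq_bigr => k _.
    have [kd|/gc ->] := eqVneq (gpar k) d; last by rewrite !scale0r.
    by rewrite -kd (ebracket_nu yi yc (hb_gr _) (hb_gr _)).
  have xb (X : genidx -> endpair V) : (forall k, X k \in instr V) ->
      bform x (\sum_k g k *: X k) = \sum_k g k * bform x (X k).
    move=> Xi; have : \sum_k g k *: X k \in instr V /\
        bform x (\sum_k g k *: X k) = \sum_k g k * bform x (X k).
      apply: (big_rec2 (fun u r => u \in instr V /\ bform x u = r)).
        split; first exact: mem0v.
        have := bform_linr 1 xi (mem0v _) (mem0v _).
        rewrite scale1r addr0 mul1r => /eqP.
        by rewrite -subr_eq0 opprD addNKr oppr_eq0 => /eqP.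
      move=> k r u _ [ui ur]; split; first by rewrite memvD ?memvZ.
      by rewrite bform_linr // ur.
    by case.
  rewrite brE xb => [|k]; last by rewrite memvD ?memvZ ?nu0_instr.
  have bi : ebracket a c x y \in instr V.
    have [h [-> hc]] := instr_homP yi yc.
    rewrite ebracket_sumr; apply: memv_suml => k _.
    have [kc|/hc ->] := eqVneq (gpar k) c; last by rewrite scale0r mem0v.
    rewrite -kc memvZ // (ebracket_nu xi xa (hb_gr _) (hb_gr _)).
    by rewrite memvD ?memvZ ?nu0_instr.
  rewrite bformE //; apply: eq_bigr => k _; congr (_ * _).
  rewrite (bform_nu2 _ xi yi xa yc (hb_gr _)) /= !lfun_simp.
  by rewrite addrC -scaleNr (B_linl _) [_ *: _]mulNr addrC.
- move=> a c x y xi yi xa yc.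
  have [g [xE ga]] := instr_homP xi xa; have [h [yE hc]] := instr_homP yi yc.
  have bE u (p q : genidx -> F) : u = \sum_k p k *: gen k -> u \in instr V ->
      bform u (\sum_k q k *: gen k) = \sum_j \sum_k p j * q k * genform j k.
    move=> uE ui; rewrite bformE //; rewrite exchange_big; apply: eq_bigr => k _ /=.
    rewrite uE sum1 (linear_expand _ _ (B_linl _)) mulr_sumr.
    by apply: eq_bigr => j _; rewrite [_ *: _]/(_ * _) mulrA (mulrC (q k)).
  have -> : bform x y = \sum_j \sum_k g j * h k * genform j k.
    by rewrite yE; apply: bE.
  have -> : bform y x = \sum_j \sum_k h j * g k * genform j k.
    by rewrite xE; apply: bE.
  rewrite exchange_big mulr_sumr.
  apply: eq_bigr => k _ /=; rewrite mulr_sumr; apply: eq_bigr => j _.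
  have [kc|/hc ->] := eqVneq (gpar k) c; last by rewrite mulr0 !mul0r mulr0.
  have [ja|/ga ->] := eqVneq (gpar j) a; last by rewrite mulr0 !mul0r mulr0.
  by rewrite genformC ja kc mulrCA (mulrC (g j)).
- by move=> x f v xi; apply: bform_nu.
Qed.

Lemma instr_formP : is_instr_form (@instr_form F V).
Proof.
apply: (@xgetPex _ _ [set b | is_instr_form b]%classic).
by exists bform; apply: bform_instr_form.
Qed.

Lemma instr_form_sum (I : finType) (g : I -> F) (X : I -> endpair V) x :
  x \in instr V -> (forall i, X i \in instr V) ->
  instr_form x (\sum_i g i *: X i) = \sum_i g i * instr_form x (X i).
Proof.
move=> xi Xi; have H := instr_formP.
suff : \sum_i g i *: X i \in instr V /\ instr_form x (\sum_i g i *: X i) =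
    \sum_i g i * instr_form x (X i) by case.
apply: (big_rec2 (fun u r => u \in instr V /\ instr_form x u = r)).
  split; first exact: mem0v.
  have := instr_form_linr H 1 (mem0v _) (mem0v _) xi.
  rewrite scale1r addr0 mul1r => /eqP.
  by rewrite -subr_eq0 opprD addNKr oppr_eq0 => /eqP.
move=> k r u _ [ui ur]; split; first by rewrite memvD ?memvZ.
by rewrite (instr_form_linr H) // ur.
Qed.

Lemma instr_form_sum_nu (I : finType) (g : I -> F) f v x : x \in instr V ->
  instr_form x (\sum_(i : I) g i *: nu0 (f i) (v i)) =
  \sum_i g i * B (x.1 (f i)) (v i).
Proof.
move=> xi; rewrite instr_form_sum // => [|i]; last exact: nu0_instr.
by apply: eq_bigr => i _; rewrite (instr_form_nu instr_formP).
Qed.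

Lemma instr_formE x g : x \in instr V ->
  instr_form x (\sum_k g k *: gen k) = \sum_k g k * B (x.1 (hb k.1)) (hb k.2).
Proof. exact: instr_form_sum_nu. Qed.

(** [is_instr_form] gives nondegeneracy in the first argument. For the second, pairing the
    generators with [z] recovers the values of [z] up to sign, by [sum_genform]. *)
Lemma instr_form_nondegr z : z \in instr V ->
  (forall x, x \in instr V -> instr_form x z = 0) -> z = 0.
Proof.
move=> zi z0; have [g zE] := instrP _ zi.
apply: (instr_eq0 zi) => f; apply: (form_nondeg1 (mgjs_metric VM)) => v.
have gz j : B (z.1 (hb j.1)) (hb j.2) = 0.
  have := z0 _ (gen_instr j); rewrite zE instr_formE ?gen_instr //.
  rewrite -/(genform j _) sum_genform -zE => /eqP.
  by rewrite mulf_eq0 (negPf (eta_neq0 _ _ _)) => /eqP.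
have l : linear (fun f => B (z.1 f) v : F^o).
  by move=> c f1 f2; rewrite linearP B_linl.
rewrite (hcoord_sum f) (linear_expand _ _ l) big1 // => i _.
rewrite (hcoord_sum v) (linear_expand _ _ (B_linr _)) big1 ?scaler0 // => j _.
by rewrite (gz (i, j)) scaler0.
Qed.

(** * The Faulkner bracket of the superpower *)

Section Bracket.
Variable n : nat.
Local Notation Bn := (sympow_form (n := n) B).

Lemma sympow_form_linl (z : sympow n (V true)) : linear (fun w => Bn w z : F^o).
Proof.
move=> c w w'; rewrite /sympow_form !(tens_form_sum B_even) scaler_sumr -big_split.
apply: eq_bigr => t _ /=; rewrite scaler_sumr -big_split; apply: eq_bigr => u _ /=.
by rewrite !ffunE /GRing.scale /=; ring.
Qed.

Lemma sympow_form_linr (w : sympow n (V false)) :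
  linear (fun z : sympow n (V true) => Bn w z : F^o).
Proof.
move=> c z z'; rewrite /sympow_form !(tens_form_sum B_even) scaler_sumr -big_split.
apply: eq_bigr => t _ /=; rewrite scaler_sumr -big_split; apply: eq_bigr => u _ /=.
by rewrite !ffunE /GRing.scale /=; ring.
Qed.

(** [a i (+) b] is the parity of an operator taking the [i]-th factor from parity [a i] to [b]. The
    first product moves this operator past the preceding factors; [kap] and [ksgn] are the signs of
    the form after it has acted. *)
Definition bracket_sign (i : 'I_n) (s : 'S_n) (a : 'I_n -> bool) (b : bool) : F :=
  (\prod_(k < n | (k < i)%N) eta (a i (+) b) (a k)) *
  (kap F (upd i b a) * ksgn F s (upd i b a)).

(** As b(x, nu(f, v)) is the pairing of x f with v, the term of <x . f, v> in which [x] hits place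
    [i] and [s] matches the factors is represented by a multiple of nu(f_i, v_(s i)). *)
Definition bracket_vee (f : 'I_n -> V false) (v : 'I_n -> V true)
    (a b : 'I_n -> bool) : endpair V :=
  \sum_i \sum_(s : 'S_n)
    (bracket_sign i s a (b (s i)) * \prod_(l | l != i) B (f l) (v (s l))) *:
      nu0 (f i) (v (s i)).

Lemma bracket_vee_instr f v a b : bracket_vee f v a b \in instr V.
Proof.
by apply: memv_suml => i _; apply: memv_suml => s _; rewrite memvZ ?nu0_instr.
Qed.

Lemma hom_endo1 c x : ehom c x -> hom_endo c x.1.
Proof. by move=> xc d w wd; apply: (xc false). Qed.

Lemma bracket_veeP f v a b x : x \in instr V ->
  (forall i, f i \in gr (V false) (a i)) -> (forall i, v i \in gr (V true) (b i)) ->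
  instr_form x (bracket_vee f v a b) = Bn (sympow_act x.1 (vee f)) (vee v).
Proof.
move=> xi fa vb; pose R (x : endpair V) := \sum_i \sum_(s : 'S_n)
  (bracket_sign i s a (b (s i)) * \prod_(l | l != i) B (f l) (v (s l))) *
    B (x.1 (f i)) (v (s i)) : F^o.
have -> : instr_form x (bracket_vee f v a b) = R x.
  rewrite /bracket_vee /R pair_bigA /= (instr_form_sum_nu _ (fun p => f p.1)
    (fun p => v ((p.2 : 'S_n) p.1))) //.
  by rewrite [RHS]pair_bigA.
have R_lin : linear R.
  move=> c y z; rewrite /R scaler_sumr -big_split; apply: eq_bigr => i _ /=.
  rewrite scaler_sumr -big_split; apply: eq_bigr => s _ /=.
  by rewrite !lfun_simp (B_linl _ c) /GRing.scale /=; ring.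
have Q_lin : linear (fun y : endpair V => Bn (sympow_act y.1 (vee f)) (vee v) : F^o).
  by move=> c y z; rewrite sympow_act_linl sympow_form_linl.
have [g ->] := instrP _ xi.
rewrite (linear_expand _ _ R_lin) (linear_expand _ _ Q_lin).
apply: eq_bigr => j _; congr (_ * _).
have xc := gen_ehom j; set y := gen j in xc *; set c := gpar j in xc.
rewrite (sympow_act_vee (hom_endo1 xc) fa).
rewrite (linear_expand _ _ (sympow_form_linl _)) /R; apply: eq_bigr => i _.
pose a' := upd i (a i (+) c) a.
have fa' k : upd i (y.1 (f i)) f k \in gr (V false) (a' k).
  by rewrite /a' /upd; case: eqP => // _; apply: (xc false).
rewrite (sympow_form_vee B_linl B_linr B_even _ fa') !mulr_sumr scaler_sumr.
apply: eq_bigr => s _.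
have -> : \prod_k B (upd i (y.1 (f i)) f k) (v (s k)) =
    B (y.1 (f i)) (v (s i)) * \prod_(k | k != i) B (f k) (v (s k)).
  rewrite (bigD1 i) //= {1}/upd eqxx; congr (_ * _).
  by apply: eq_bigr => k /negPf ki; rewrite /upd ki.
(* [bracket_sign] guesses the parity of the operator from [f] and [v]; the guess is right wherever
   evenness of the form leaves a nonzero term. *)
have [bc|ne] := eqVneq (b (s i)) (a i (+) c); last first.
  rewrite (B_even (xc false _ _ (fa i)) (vb (s i))) 1?eq_sym //.
  by rewrite mul0r !mulr0 scaler0.
rewrite /bracket_sign bc addKb -/a' /GRing.scale /=; ring.
Qed.

Local Notation is_bracket f v z := (z \in instr V /\
  forall x, x \in instr V -> instr_form x z = Bn (sympow_act x.1 f) v).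

(** Existence of a solution is enough: both arguments are expanded in basis tensors, for which
    [bracket_vee] solves the equation. *)
Lemma faulkner_bracketP f v : is_bracket f v (@faulkner_bracket F V n f v).
Proof.
apply: (@xgetPex _ _ [set z | is_bracket f v z]%classic).
exists (\sum_(p : tidx n (V false) * tidx n (V true)) ((vsval f) p.1 * (vsval v) p.2) *:
  bracket_vee (hbt p.1) (hbt p.2) (tpars p.1) (tpars p.2)); split.
  by apply: memv_suml => p _; rewrite memvZ ?bracket_vee_instr.
move=> x xi; rewrite instr_form_sum // => [|p]; last exact: bracket_vee_instr.
under eq_bigr => p _ do rewrite (bracket_veeP xi (hbt_gr _) (hbt_gr _)).
rewrite -(pair_bigA _ (fun t u => (vsval f) t * (vsval v) u *
  Bn (sympow_act x.1 (vee (hbt t))) (vee (hbt u)))) /=.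
have l : linear (fun w => Bn (sympow_act x.1 w) v : F^o).
  by move=> c w w'; rewrite linearP sympow_form_linl.
rewrite {2}(sympow_sum f) (linear_expand _ _ l); apply: eq_bigr => t _.
rewrite {2}(sympow_sum v) (linear_expand _ _ (sympow_form_linr _)) scaler_sumr.
by apply: eq_bigr => u _; rewrite [RHS]scalerA.
Qed.

Lemma faulkner_bracket_uniq f v z : is_bracket f v z ->
  @faulkner_bracket F V n f v = z.
Proof.
move=> [zi zE]; have [yi yE] := faulkner_bracketP f v.
apply/eqP; rewrite -subr_eq0; apply/eqP/instr_form_nondegr.
  by rewrite memvB.
move=> x xi; rewrite addrC -scaleN1r (instr_form_linr instr_formP) //.
by rewrite yE // zE // mulN1r addNr.
Qed.

Lemma faulkner_bracket_vee f v a b :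
  (forall i, f i \in gr (V false) (a i)) -> (forall i, v i \in gr (V true) (b i)) ->
  faulkner_bracket (vee f) (vee v) = bracket_vee f v a b.
Proof.
move=> fa vb; apply: faulkner_bracket_uniq; split; first exact: bracket_vee_instr.
by move=> x xi; apply: bracket_veeP.
Qed.

Lemma faulkner_bracket_linl v : linear ((@faulkner_bracket F V n)^~ v).
Proof.
move=> c f f'; apply: faulkner_bracket_uniq.
have [yi yE] := faulkner_bracketP f v; have [zi zE] := faulkner_bracketP f' v.
split=> [|x xi]; first by rewrite memvD ?memvZ.
rewrite (instr_form_linr instr_formP) // yE // zE //.
by rewrite linearP [RHS]sympow_form_linl.
Qed.

Lemma faulkner_bracket_linr f : linear (@faulkner_bracket F V n f).
Proof.
move=> c v v'; apply: faulkner_bracket_uniq.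
have [yi yE] := faulkner_bracketP f v; have [zi zE] := faulkner_bracketP f v'.
split=> [|x xi]; first by rewrite memvD ?memvZ.
by rewrite (instr_form_linr instr_formP) // yE // zE // [RHS]sympow_form_linr.
Qed.

Lemma sympair_act_linear : linear (@sympair_act F V n).
Proof.
move=> c x y; apply: endpair_eq => w /=; rewrite !lfun_simp.
  exact: sympow_act_linl.
exact: sympow_act_linl.
Qed.

Lemma ecomp_sympair_act x s (w : sympow n (V s)) :
  ecomp (sympair_act n x) s w = sympow_act (ecomp x s) w.
Proof. by case: s w => w /=; rewrite lfunE. Qed.

Local Notation W := (sympair V n).

Lemma sympow_act2_linear (w : sympow n (V true)) :
  linear (fun x : endpair V => sympow_act x.2 w).
Proof. by move=> c x y; apply: sympow_act_linl. Qed.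

Lemma sympow_act2N (x : endpair V) (w : sympow n (V true)) :
  sympow_act (- x : endpair V).2 w = - sympow_act x.2 w.
Proof. by rewrite -scaleN1r (linZ (sympow_act2_linear w)) scaleN1r. Qed.

Lemma sympair_trip1 s (y : W (~~ s)) (z : W s) :
  linear (fun x : W s => trip x y z).
Proof.
case: s y z => y z c x x'; last first.
  by rewrite /= faulkner_bracket_linl sympow_act_linl.
have E u : trip u y z = - sympow_act (twist (@faulkner_bracket F V n) u y).2 z.
  exact: sympow_act2N.
rewrite !E (twist_linr faulkner_bracket_linr _ c x x').
by rewrite sympow_act2_linear opprD scalerN.
Qed.

Lemma sympair_trip2 s (x z : W s) :
  linear (fun y : W (~~ s) => trip x y z).
Proof.
case: s x z => x z c y y'; last first.
  by rewrite /= faulkner_bracket_linr sympow_act_linl.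
have E u : trip x u z = - sympow_act (twist (@faulkner_bracket F V n) x u).2 z.
  exact: sympow_act2N.
rewrite !E (twist_linl faulkner_bracket_linl _ c y y').
by rewrite sympow_act2_linear opprD scalerN.
Qed.

Lemma sympair_trip3 s (x : W s) (y : W (~~ s)) : linear (trip x y).
Proof. by case: s x y => x y c z z'; rewrite /= linearP. Qed.

(** Both components act by the same element of [instr V], since in the second one the two twists
    cancel. *)
Lemma nu0_sympair (f : W false) (v : W true) :
  nu0 f v = sympair_act n (faulkner_bracket f v) :> endpair W.
Proof.
apply: endpair_eq => w; first exact/(etrans (nu0_1 sympair_trip3 _ _ _))/esym/lfunE.
rewrite (nu0_2E sympair_trip3) /= lfunE /=.
rewrite [in RHS](bilin_hcomp faulkner_bracket_linl faulkner_bracket_linr).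
rewrite /twist -sumrN.
have l := sympow_act2_linear w.
have sumE (X : bool -> endpair V) :
    sympow_act (\sum_(a : bool) X a).2 w = \sum_(a : bool) sympow_act (X a).2 w.
  by rewrite !big_bool (linD l).
rewrite sumE; apply: eq_bigr => a _; rewrite sumE -sumrN; apply: eq_bigr => b _.
rewrite -/(twist _ (hcomp b v) (hcomp a f)) sympow_act2N.
rewrite (twist_hom faulkner_bracket_linl faulkner_bracket_linr
  (hcomp_mem a (f : sympow n (V false))) (hcomp_mem b (v : sympow n (V true)))).
by rewrite (linZ l) scalerN opprK scalerA eta_sqr scale1r.
Qed.

(** Exchanging the two families replaces [s] by its inverse; the left side carries the twist of [nu]
    by the total parities. With [c] the parity of nu(f_i, v_(s i)) and [e] that of the other
    factors, [kap_upd] and [ksgn_upd] reduce the claim to a finite check in [a i], [b (s i)] and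
    [e]. *)
Lemma bracket_sign_inv (i : 'I_n) (s : 'S_n) (a b : 'I_n -> bool) :
  (forall k, k != i -> b (s k) = a k) ->
  eta (\big[addb/false]_k b k) (\big[addb/false]_k a k) *
    bracket_sign (s i) s^-1 b (a i) =
  bracket_sign i s a (b (s i)) *
    ((\prod_(k | k != i) eta (b (s k)) (a k)) * eta (b (s i)) (a i)).
Proof.
move=> ba; pose c := a i (+) b (s i); pose e := \big[addb/false]_(k | k != i) a k.
pose Pa := \prod_(k < n | (k < i)%N) eta c (a k).
pose Pb := \prod_(k < n | (k < s i)%N) eta c (b k).
have cE : b (s i) = a i (+) c by rewrite /c addKb.
have sumb : \big[addb/false]_k b k = b (s i) (+) e.
  rewrite (reindex_inj (@perm_inj _ s)) (bigD1 i) //=; congr (_ (+) _).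
  by apply: eq_bigr => k /ba.
have suma : \big[addb/false]_k a k = a i (+) e by rewrite (bigD1 i).
have updb : upd (s i) (a i) b =1 (fun k => a (s^-1%g k)).
  move=> k; rewrite /upd; case: eqP => [->|/eqP ne]; first by rewrite permK.
  rewrite -{1}(permKV s k) ba //; apply: contraNneq ne => <-.
  by rewrite permKV.
have upda : (fun k => b (s k)) =1 upd i (a i (+) c) a.
  by move=> k; rewrite /upd -cE; case: eqP => [->|/eqP /ba].
have S1 : bracket_sign i s a (b (s i)) = Pa * (kap F b * ksgn F s (upd i (a i (+) c) a)).
  rewrite /bracket_sign -/c -/Pa; congr (_ * _); rewrite cE; congr (_ * _).
  by rewrite -(kap_perm F s b); apply/esym/eq_kap.
have S2 : bracket_sign (s i) s^-1 b (a i) = Pb * (kap F a * ksgn F s a).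
  rewrite /bracket_sign addbC -/c -/Pb; congr (_ * (_ * _)).
    by rewrite (eq_kap F updb) kap_perm.
  by rewrite (eq_ksgn F _ updb) ksgnV.
have K1 : kap F a * kap F b = eta c e.
  rewrite -(kap_perm F s b) (eq_kap F upda) kap_upd.
  exact: (prod_eta F (fun k => k != i) c a).
have K2 : ksgn F s a * ksgn F s (upd i (a i (+) c) a) = Pa * Pb.
  rewrite ksgn_upd; congr (_ * _).
  rewrite /Pb [RHS](reindex_inj (@perm_inj _ s)) /=; apply: eq_bigr => k lt.
  by rewrite ba //; apply: contraTneq lt => ->; rewrite ltnn.
have E1 : \prod_(k | k != i) eta (b (s k)) (a k) = eta true e.
  rewrite -(prod_eta F (fun k => k != i) true a).
  by apply: eq_bigr => k /ba ->; rewrite /Defs.eta andbb.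
rewrite E1 S1 S2 sumb suma.
have sq : (Pa * Pa = 1) * (Pb * Pb = 1).
  by split; rewrite -big_split big1 // => k _ /=; rewrite eta_sqr.
have kb : kap F b = kap F a * eta c e.
  by rewrite -K1 mulrA kap_sqr mul1r.
have ks : ksgn F s (upd i (a i (+) c) a) = ksgn F s a * (Pa * Pb).
  by rewrite -K2 mulrA ksgn_sqr mul1r.
rewrite kb ks.
have -> : Pa * (kap F a * eta c e * (ksgn F s a * (Pa * Pb))) =
    Pa * Pa * (eta c e * (Pb * (kap F a * ksgn F s a))) by ring.
rewrite sq mul1r [RHS]mulrAC; congr (_ * _).
have E (x y z : bool) : eta (y (+) z) (x (+) z) =
    eta (x (+) y) z * (eta true z * eta y x).
  by case: x y z => [] [] []; rewrite /Defs.eta /= ?expr0 ?expr1; ring.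
exact: E.
Qed.

(** For [s = true] this is the Faulkner bracket. For [s = false] the families are exchanged, the
    permutations are inverted, and [bracket_sign_inv] matches the signs. *)
Lemma nu_sympair_vee s (f : 'I_n -> V (~~ s)) (v : 'I_n -> V s) a b :
  (forall i, f i \in gr (V (~~ s)) (a i)) -> (forall i, v i \in gr (V s) (b i)) ->
  @nu F W (~~ s) s (vee f) (vee v) =
  \sum_i \sum_(t : 'S_n)
    (bracket_sign i t a (b (t i)) * \prod_(l | l != i) pairing (f l) (v (t l))) *:
      sympair_act n (nu (f i) (v (t i))).
Proof.
have sumE (g : 'I_n -> 'S_n -> F) (X : 'I_n -> 'S_n -> endpair V) :
    sympair_act n (\sum_i \sum_(t : 'S_n) g i t *: X i t) =
    \sum_i \sum_(t : 'S_n) g i t *: sympair_act n (X i t).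
  by rewrite !pair_bigA (linear_expand (fun p => g p.1 p.2) (fun p => X p.1 p.2)
    sympair_act_linear).
case: s f v => f v fa vb.
  rewrite /= nu0_sympair (faulkner_bracket_vee fa vb); exact: sumE.
rewrite (nu_opp sympair_trip1 sympair_trip2 sympair_trip3 (vee_gr fa) (vee_gr vb)).
rewrite nu0_sympair (faulkner_bracket_vee vb fa) sumE -scaleNr.
rewrite exchange_big (reindex_inj invg_inj) scaler_sumr [RHS]exchange_big.
apply: eq_bigr => t _.
rewrite [X in _ *: X](reindex_inj (@perm_inj _ t)) scaler_sumr.
apply: eq_bigr => i _; rewrite permK (nu_opp lin1 lin2 lin3 (fa i) (vb (t i))) -scaleNr.
rewrite (linZ sympair_act_linear) !scalerA; congr (_ *: _).
have -> : \prod_(l | l != t i) B (v l) (f (t^-1%g l)) =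
    \prod_(l | l != i) B (v (t l)) (f l).
  rewrite (reindex_inj (@perm_inj _ t)).
  by apply: eq_big => k; rewrite ?(inj_eq (@perm_inj _ t)) ?permK.
have -> : \prod_(l | l != i) (twist (U := F^o) B (f l) (v (t l)) : F) =
   (\prod_(l | l != i) eta (b (t l)) (a l)) * \prod_(l | l != i) B (v (t l)) (f l).
  rewrite -big_split; apply: eq_bigr => l _ /=.
  by rewrite (twist_hom B_linl B_linr (vb (t l)) (fa l)).
have [->|nz] := eqVneq (\prod_(l | l != i) B (v (t l)) (f l)) 0.
  by rewrite !(mulr0, mul0r).
have ba k : k != i -> b (t k) = a k.
  move=> ki; apply/eqP; apply: contraNT nz => ne.
  by rewrite (bigD1 k) //= (B_even (vb (t k)) (fa k)) // mul0r.
by rewrite [LHS]mulrA mulNr (bracket_sign_inv ba); ring.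
Qed.

Lemma nu_ehom s a b (x : V (~~ s)) (y : V s) :
  x \in gr (V (~~ s)) a -> y \in gr (V s) b -> ehom (a (+) b) (nu x y).
Proof.
case: s x y => x y xa yb; first exact: nu0_ehom.
rewrite (nu_opp lin1 lin2 lin3 xa yb) -scaleNr addbC => t c w wc.
have -> : - eta b a *: (nu0 y x : endpair V) = - eta b a *: nu0 y x + 0.
  by rewrite addr0.
rewrite ecomp_lin; have -> : ecomp (0 : endpair V) t w = 0.
  by case: t w {wc} => w /=; rewrite lfunE.
by rewrite addr0 memvZ //; apply: nu0_ehom wc.
Qed.

Lemma ecomp_nuV s (x : V (~~ s)) (y : V s) (z : V (~~ s)) :
  ecomp (nu x y) (~~ s) z = trip x y z.
Proof. exact: ecomp_nu. Qed.

Lemma trip_sympair s (x : W (~~ s)) (y : W s) (z : W (~~ s)) :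
  trip x y z = ecomp (nu x y) (~~ s) z.
Proof.
exact/esym/(ecomp_nu sympair_trip1 sympair_trip2 sympair_trip3).
Qed.

End Bracket.

End Metric.

(** * Permanents, determinants and superminors *)

Lemma linear_expand2 (R : pzRingType) (U W : lmodType R) (f : U -> W)
    (I J : finType) (p : I -> J -> R) (X : I -> J -> U) :
  linear f -> f (\sum_i \sum_j p i j *: X i j) =
    \sum_i \sum_j p i j *: f (X i j).
Proof.
move=> lf; rewrite !pair_bigA.
exact: (linear_expand (fun k => p k.1 k.2) (fun k => X k.1 k.2) lf).
Qed.

Lemma sum_perm_lift (U : nmodType) m (i j : 'I_m.+1) (G : 'S_m.+1 -> U) :
  \sum_(s : 'S_m.+1 | s i == j) G s = \sum_(s : 'S_m) G (lift_perm i j s).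
Proof.
have inj : {in predT &, injective (@lift_perm m i j)}.
  move=> s t _ _ st; apply/permP => k; apply: (@lift_inj _ j).
  by rewrite -!(lift_perm_lift i) st.
have img (s : 'S_m.+1) : s i = j -> exists t, s = lift_perm i j t.
  move=> sij; pose h k := odflt k (unlift j (s (lift i k))).
  have hE k : lift j (h k) = s (lift i k).
    rewrite /h; case: unliftP => [l -> //|e].
    by have := neq_lift i k; rewrite -(inj_eq (@perm_inj _ s)) sij e eqxx.
  have h_inj : injective h.
    by move=> k l e; apply/(@lift_inj _ i)/(@perm_inj _ s); rewrite -!hE e.
  exists (perm h_inj); apply/permP => k.
  case: (unliftP i k) => [l ->|->]; first by rewrite lift_perm_lift permE hE.
  by rewrite lift_perm_id.
rewrite [RHS](eq_bigl (fun s : 'S_m => s \in [set: 'S_m])); last first.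
  by move=> s; rewrite inE.
rewrite -(big_imset G (h := lift_perm i j)) /=; last first.
  by move=> s t _ _; apply: inj.
apply: eq_bigl => s; apply/eqP/imsetP => [/img[t ->]|[t _ ->]].
  by exists t; rewrite ?inE.
exact: lift_perm_id.
Qed.

Lemma sum_perm_split (U : nmodType) m (i : 'I_m.+1) (G : 'S_m.+1 -> U) :
  \sum_(s : 'S_m.+1) G s = \sum_j \sum_(s : 'S_m) G (lift_perm i j s).
Proof.
rewrite (partition_big (fun s : 'S_m.+1 => s i) xpredT) //=.
by apply: eq_bigr => j _; rewrite -sum_perm_lift.
Qed.

Section Permanent.
Variable F : fieldType.
Local Notation eta := (@eta F).

Lemma prod_lt_const (c : F) m i : (i <= m)%N -> \prod_(k < m | (k < i)%N) c = c ^+ i.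
Proof. by move=> im; rewrite (big_ord_narrow im) prodr_const card_ord. Qed.

(** Interpolates between the permanent, for even parities, and the determinant, for odd ones. *)
Definition signed_perm_sum m (a : 'I_m -> bool) (A : 'M[F]_m) : F :=
  \sum_(s : 'S_m) ksgn F s a * \prod_i A i (s i).

Lemma prod_lift_perm m (A : 'M[F]_m.+1) (i j : 'I_m.+1) (s : 'S_m) :
  \prod_(k | k != i) A k (lift_perm i j s k) =
  \prod_k row' i (col' j A) k (s k).
Proof.
rewrite big_mkcond (bigD1_ord i) //= eqxx mul1r; apply: eq_bigr => k _.
by rewrite eq_sym neq_lift lift_perm_lift !mxE.
Qed.

Lemma permanent_row m (A : 'M[F]_m.+1) (i : 'I_m.+1) :
  permanent A = \sum_j A i j * permanent (row' i (col' j A)).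
Proof.
rewrite /permanent (sum_perm_split i); apply: eq_bigr => j _.
rewrite mulr_sumr; apply: eq_bigr => s _.
by rewrite (bigD1 i) //= lift_perm_id prod_lift_perm.
Qed.

Lemma mxnthE m (A : 'M[F]_m) (i j : 'I_m) : mxnth A i j = A i j.
Proof. by rewrite /mxnth !valK. Qed.

Lemma mxnthP m (A : 'M[F]_m) i j (im : (i < m)%N) (jm : (j < m)%N) :
  mxnth A i j = A (Ordinal im) (Ordinal jm).
Proof. by rewrite -mxnthE. Qed.

Lemma mxnth_minor m (A : 'M[F]_m.+1) (i j : 'I_m.+1) k l :
  (k < m)%N -> (l < m)%N ->
  mxnth (row' i (col' j A)) k l = mxnth A (bump i k) (bump j l).
Proof.
move=> km lm; rewrite (mxnthP _ km lm) !mxE -mxnthE.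
by rewrite /lift.
Qed.

Lemma det_eqn k m (e : k = m) (g : nat -> nat -> F) :
  \det (\matrix_(i < k, j < k) g i j) = \det (\matrix_(i < m, j < m) g i j).
Proof. by case: m / e. Qed.

(** Expansion along the first row: in [ksgn_lift] an odd factor moved to place [j] crosses [j] odd
    ones, which is the sign of the cofactor. *)
Lemma signed_perm_sum_odd m (A : 'M[F]_m) :
  signed_perm_sum (fun=> true) A = \det A.
Proof.
elim: m A => [|m IH] A.
  rewrite det_mx00 /signed_perm_sum (big_pred1 1%g) => [|s].
    by rewrite ksgn1 big_ord0 mul1r.
  by apply/esym/eqP/permP => -[].
rewrite (expand_det_row _ ord0) /signed_perm_sum (sum_perm_split ord0).
apply: eq_bigr => j _; rewrite /cofactor -IH !mulr_sumr; apply: eq_bigr => s _.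
rewrite (bigD1 ord0) //= lift_perm_id prod_lift_perm.
rewrite (@ksgn_lift F _ ord0 j s (fun=> true) (fun=> true) (fun=> erefl)).
rewrite !prod_lt_const ?(ltnW (ltn_ord j)) // expr0 mul1r.
by rewrite /Defs.eta expr1 add0n; ring.
Qed.

Definition block_even m p q (A : 'M[F]_m) :=
  forall i j : 'I_m, (i < p)%N != (j < q)%N -> A i j = 0.

(** Induction on the number of even rows. An even first row crosses the others without sign, so its
    expansion follows that of the permanent; when no even row is left, the sum is a determinant. *)
Lemma signed_perm_sum_perdet m p (A : 'M[F]_m) : (p <= m)%N ->
  block_even p p A ->
  signed_perm_sum (fun i => (p <= i)%N) A = perdet p A.
Proof.
elim: p m A => [|p IH] m A pm ev.
  rewrite /perdet /permanent (big_pred1 1%g) => [|s]; last first.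
    by apply/esym/eqP/permP => -[].
  rewrite big_ord0 mul1r (signed_perm_sum_odd A) (det_eqn (subn0 m)); congr (\det _).
  by apply/matrixP => i j; rewrite !mxE mxnthE.
case: m pm A ev => // m pm A ev.
rewrite /perdet (permanent_row _ ord0) mulr_suml.
rewrite /signed_perm_sum (sum_perm_split ord0) (bigID (fun j : 'I_m.+1 => (j < p.+1)%N)) /=.
rewrite [X in _ + X]big1 ?addr0 => [|j jp]; last first.
  rewrite big1 // => s _.
  by rewrite (bigD1 ord0) //= lift_perm_id ev ?mul0r ?mulr0.
rewrite (big_ord_narrow pm); apply: eq_bigr => j _.
set j' := widen_ord pm j; pose M := row' ord0 (col' j' A).
have jp : (j <= p)%N by rewrite -ltnS.
have bumpE l : (bump j l < p.+1)%N = (l < p)%N.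
  by rewrite /bump; case: (leqP j l) => /= jl; lia.
have evM : block_even p p M.
  by move=> k l ne; rewrite !mxE ev //= bumpE.
have -> : \sum_(s : 'S_m) ksgn F (lift_perm ord0 j' s) (fun i => (p < i)%N) *
    \prod_i A i (lift_perm ord0 j' s i) =
    A ord0 j' * signed_perm_sum (fun i => (p <= i)%N) M.
  rewrite mulr_sumr; apply: eq_bigr => s _.
  rewrite (bigD1 ord0) //= lift_perm_id prod_lift_perm mulrCA; congr (_ * _).
  have [->|nz] := eqVneq (\prod_k row' ord0 (col' j' A) k (s k)) 0.
    by rewrite !mulr0.
  congr (_ * _); rewrite (@ksgn_lift F _ ord0 j' s _ (fun i => (p < i)%N)).
    by rewrite !big1 ?mulr1.
  move=> k; have [e|ne] := eqVneq (k < p)%N (s k < p)%N; last first.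
    by case/eqP: nz; rewrite (bigD1 k) //= evM ?mul0r.
  rewrite [in LHS]ltnNge -ltnS [(lift j' (s k) < _)%N]bumpE -e.
  by rewrite [RHS]ltnNge -ltnS.
rewrite (IH _ _ _ evM) // [X in _ = X * _ * _]mxE -(mxnthE A ord0 j') -mulrA.
congr (_ * _); rewrite /perdet; congr (_ * _).
  congr (permanent _); apply/matrixP => k l; rewrite !mxE mxnth_minor.
  - by [].
  - by have := ltn_ord k; lia.
  - by have := ltn_ord l; lia.
rewrite subSS; congr (\det _); apply/matrixP => k l; rewrite !mxE mxnth_minor.
- by rewrite /= /bump leq0n; congr (mxnth _ _ _); have := ltn_ord l; lia.
- by have := ltn_ord k; lia.
- by have := ltn_ord l; lia.
Qed.

(** A permutation avoiding the zero blocks would match the [p] even rows with the [q] even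
    columns. *)
Lemma block_even_prod0 m p q (A : 'M[F]_m) (s : 'S_m) : (p <= m)%N ->
  (q <= m)%N -> p != q -> block_even p q A -> \prod_i A i (s i) = 0.
Proof.
move=> pm qm ne ev.
have card_lt r : (r <= m)%N -> #|[set i : 'I_m | (i < r)%N]| = r.
  move=> rm; rewrite cardsE -sum1_card (big_ord_narrow rm).
  by rewrite sum1_card card_ord.
have [/forallP e|/forallPn[i ie]] := boolP [forall i : 'I_m, (i < p)%N == (s i < q)%N].
  case/eqP: ne; rewrite -(card_lt p pm) -(card_lt q qm).
  rewrite -(card_imset _ (@perm_inj _ s)); apply: eq_card => j; rewrite inE.
  apply/imsetP/idP => [[i + ->]|jq]; first by rewrite inE (eqP (e i)).
  exists (s^-1%g j); last by rewrite permKV.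
  by rewrite inE (eqP (e _)) permKV.
by rewrite (bigD1 i) //= ev ?mul0r.
Qed.

(** If p < q, the first column of the determinant is an even column, zero on odd rows. If q < p,
    column [q] of the permanent is odd, zero on even rows. *)
Lemma perdet_block_even0 m p q (A : 'M[F]_m) : (p <= m)%N ->
  (q <= m)%N -> p != q -> block_even p q A -> perdet p A = 0.
Proof.
move=> pm qm; rewrite neq_ltn => /orP[lt|lt] ev; rewrite /perdet.
  have d0 : (0 < m - p)%N by lia.
  rewrite [\det _](expand_det_col _ (Ordinal d0)) big1 ?mulr0 // => i _.
  have im : (p + i < m)%N by have := ltn_ord i; lia.
  have jm : (p + 0 < m)%N by lia.
  by rewrite mxE (mxnthP _ im jm) ev ?mul0r //=; lia.
rewrite /permanent big1 ?mul0r // => s _.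
rewrite (bigD1 (s^-1%g (Ordinal lt))) //= permKV mxE.
have im : (s^-1%g (Ordinal lt) < m)%N by apply: leq_trans (ltn_ord _) pm.
have jm : (q < m)%N by apply: leq_trans lt pm.
by rewrite (mxnthP _ im jm) ev ?mul0r //= ltn_ord ltnn.
Qed.

(** Each pair of odd factors contributes -1, and the exponent in [omega] is the number of such
    pairs, a binomial coefficient. *)
Lemma kap_omega n p : (p <= n)%N -> kap F (fun i : 'I_n => (p <= i)%N) = omega (n - p).
Proof.
elim: n p => [|n IH] p pn.
  by rewrite /kap big_ord0 sub0n /omega mul0n div0n expr0.
rewrite (kap_lift F ord0) /=; case: p pn => [|p] pn; last first.
  rewrite big1 ?mulr1 => [|k _]; last exact: eta0l.
  by rewrite subSS -IH //; apply: eq_kap.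
rewrite (eq_kap F (b := fun k : 'I_n => (0 <= k)%N)) // IH // !subn0.
rewrite (eq_bigr (fun=> -1)) // prodr_const card_ord /omega -exprD.
by rewrite !divn2 -!bin2 binS bin1.
Qed.

End Permanent.

Lemma parity_sort (F : fieldType) n (M : superspace F) (t : tidx n M) :
  exists (s : 'S_n) (p : nat), (p <= n)%N /\
    forall i : 'I_n, hpar (t (s i)) = (p <= i)%N.
Proof.
pose r (k l : 'I_(hdim M)) := hpar k ==> hpar l.
pose T := [tuple t i | i < n]; pose S := sort_tuple r T.
have /tuple_permP[s Ss] : perm_eq S T by rewrite perm_sort.
have tS i : t (s i) = tnth S i.
  by rewrite (tnth_nth (tnth S i)) Ss -tnth_nth !tnth_mktuple.
have rS : sorted r S by apply: sort_sorted => k l; rewrite /r; do 2!case: hpar.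
have r_tr : transitive r.
  by move=> k l m; rewrite /r; do 3!case: hpar.
pose p := find (fun k => hpar k) S; exists s, p.
have pn : (p <= n)%N by rewrite -[leqRHS](size_tuple S) find_size.
split=> // i; rewrite tS; case: leqP => pi; last first.
  by rewrite (tnth_nth (tnth S i)) (before_find _ pi).
have [e|lt] := eqVneq p i.
  rewrite (tnth_nth (tnth S i)) -e; apply: (nth_find _ (a := fun k => hpar k)).
  by rewrite has_find size_tuple -/p e.
have pn' : (p < n)%N by apply: leq_ltn_trans pi (ltn_ord i).
have := sorted_ltn_nth r_tr (tnth S i) rS.
move=> /(_ p i); rewrite !inE !size_tuple ltn_ord pn' ltn_neqAle lt pi.
move=> /(_ isT isT isT); rewrite -tnth_nth /r => /implyP; apply.
apply: (nth_find _ (a := fun k => hpar k)).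
by rewrite has_find size_tuple -/p.
Qed.

(** Sorting the factors by parity costs a sign only, so the parity-ordered elements span the
    superpower. *)
Lemma vee_parity_sort (F : fieldType) n (M : superspace F) (t : tidx n M) :
  exists (c : F) (p : nat) (v : 'I_n -> M), [/\ (p <= n)%N, parity_ordered p v &
    vee (hbt t) = c *: vee v].
Proof.
have [s [p [pn ps]]] := parity_sort t.
exists (ksgn F s^-1 (tpars t)), p, (fun i => hbt t (s i)); split=> // [i|].
  by rewrite -ps; apply: hb_gr.
rewrite (vee_perm s^-1%g (hbt_gr t)); congr (_ *: _).
by apply: eq_vee => i; rewrite invgK.
Qed.

(** Once index [i] is deleted, the surviving even indices are the first [p - (i < p)]: this numbers
    the parities in a minor. *)
Lemma leq_bump_sub p i k : (p <= bump i k)%N = (p - (i < p) <= k)%N.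
Proof.
rewrite /bump; case: (ltnP i p) => ip; case: (leqP i k) => ik; rewrite /= ?subn0 ?subn1.
- by rewrite add1n; case: p ip.
- rewrite add0n; apply/idP/idP => h; first exact: leq_trans (leq_pred _) h.
  by have := leq_trans h (ltnW ik); case: p ip h => // p ip h _; lia.
- by rewrite add1n; rewrite (leqW (leq_trans ip ik)) (leq_trans ip ik).
- by rewrite add0n.
Qed.

(** * The form, the operators and the products on parity-ordered elements *)

Section Parts.
Variables (F : fieldType) (V : superpair F) (n : nat).
Hypothesis VM : metric_generalized_jordan_superpair V.
Local Notation eta := (@eta F).
Local Notation W := (sympair V n).

Let B_linl := form_linear1 (mgjs_metric VM).
Let B_linr := form_linear2 (mgjs_metric VM).
Let B_even := form_even (mgjs_metric VM).

Lemma form_perdet (p q : nat) (f : 'I_n -> V false) (v : 'I_n -> V true) :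
  (p <= n)%N -> (q <= n)%N -> parity_ordered p f -> parity_ordered q v ->
  @spform F W (vee f) (vee v) =
    omega (n - p) * perdet p (\matrix_(i, j) @spform F V (f i) (v j)) /\
  (p != q -> @spform F W (vee f) (vee v) = 0).
Proof.
move=> pn qn fp vq; rewrite /= (sympow_form_vee B_linl B_linr B_even _ fp).
rewrite kap_omega //; set A := \matrix_(i, j) _.
have -> : \sum_(s : 'S_n) ksgn F s (fun i => (p <= i)%N) *
    \prod_i spform (f i) (v (s i)) = signed_perm_sum (fun i => (p <= i)%N) A.
  by apply: eq_bigr => s _; congr (_ * _); apply: eq_bigr => i _; rewrite mxE.
have evA : block_even p q A.
  move=> i j ne; rewrite mxE (B_even (fp i) (vq j)) //.
  by apply: contra ne => /eqP e; rewrite !ltnNge e.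
have [pq|pq] := eqVneq p q; first by rewrite signed_perm_sum_perdet // {2}pq.
have s0 : signed_perm_sum (fun i : 'I_n => (p <= i)%N) A = 0.
  rewrite /signed_perm_sum big1 // => s _.
  by rewrite (block_even_prod0 _ pn qn pq evA) mulr0.
by rewrite s0 (perdet_block_even0 pn qn pq evA) mulr0.
Qed.

Lemma form_perdet_uniq (B : W false -> W true -> F) :
  (forall y, linear (fun x => B x y : F^o)) ->
  (forall x, linear (fun y => B x y : F^o)) ->
  (forall (p q : nat) (f : 'I_n -> V false) (v : 'I_n -> V true),
    (p <= n)%N -> (q <= n)%N -> parity_ordered p f -> parity_ordered q v ->
    B (vee f) (vee v) =
      omega (n - p) * perdet p (\matrix_(i, j) @spform F V (f i) (v j))) ->
  forall x y, @spform F W x y = B x y.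
Proof.
move=> Bl Br BE x y /=; have Wl := sympow_form_linl VM (n := n).
have Wr := sympow_form_linr VM (n := n).
rewrite (sympow_sum x) (linear_expand _ _ (Wl y)) (linear_expand _ _ (Bl y)).
apply: eq_bigr => t _; congr (_ * _).
rewrite (sympow_sum y) (linear_expand _ _ (Wr _)) (linear_expand _ _ (Br _)).
apply: eq_bigr => u _; congr (_ * _).
have [c [p [f [pn fp ->]]]] := vee_parity_sort t.
have [d [q [v [qn vq ->]]]] := vee_parity_sort u.
rewrite (linZ (Wl _)) (linZ (Wr _)) (linZ (Bl _)) (linZ (Br _)).
by rewrite (BE p q) // -(form_perdet pn qn fp vq).1.
Qed.

Lemma prod_par_lt m p i : (i <= m)%N ->
  \prod_(k < m | (k < i)%N) eta true (p <= k)%N = (-1) ^+ (i - p).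
Proof.
elim: i => [|i IH] im; first by rewrite big_pred0.
rewrite (bigD1 (Ordinal im)) //=.
have -> : \prod_(k < m | (k < i.+1)%N && (k != Ordinal im)) eta true (p <= k)%N =
    \prod_(k < m | (k < i)%N) eta true (p <= k)%N.
  by apply: eq_bigl => k; rewrite -val_eqE /= ltnS [RHS]ltn_neqAle andbC.
rewrite (IH (ltnW im)) /Defs.eta /=; case: leqP => pi /=.
  by rewrite subSn // expr1 exprS.
by rewrite expr0 mul1r; congr (_ ^+ _); lia.
Qed.

Lemma prod_par m p : \prod_(k < m) eta true (p <= k)%N = (-1) ^+ (m - p).
Proof. by rewrite -(prod_par_lt p (leqnn m)); apply: eq_bigl => k; rewrite ltn_ord. Qed.

Lemma prod_eta_par m p c (P : pred 'I_m) :
  \prod_(k < m | P k) eta c (p <= k)%N =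
  if c then \prod_(k < m | P k) eta true (p <= k)%N else 1.
Proof. by case: c => //; rewrite big1. Qed.

End Parts.

(** Separating row [i] and column [j] leaves the sign of the minor times a sign in [i], [j], [p],
    [q]. The latter comes from counting odd indices: [i - p] of them, a truncated difference, lie
    below [i]. *)
Lemma bracket_sign_lift (F : fieldType) m p q (i j : 'I_m.+1) (s : 'S_m) :
  (p <= m.+1)%N -> (q <= m.+1)%N ->
  let a (k : 'I_m.+1) := (p <= k)%N in let b (k : 'I_m.+1) := (q <= k)%N in
  (forall k, b (lift j (s k)) = a (lift i k)) ->
  (p - (i < p) = q - (j < q))%N ->
  bracket_sign F i (lift_perm i j s) a (b j) =
  omega (m.+1 - p) * (scheck p q i j * ksgn F s (fun k => (p - (i < p) <= k)%N)).
Proof.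
move=> pm qm a b ab pq; rewrite -kap_omega // -/a.
have aE k : a (lift i k) = (p - (i < p) <= k)%N.
  exact: leq_bump_sub.
rewrite /bracket_sign (kap_lift F i (upd i _ a)) (kap_lift F i a).
have uE k : upd i (b j) a (lift i k) = a (lift i k).
  by rewrite /upd eq_sym (negPf (neq_lift i k)).
have ui : upd i (b j) a i = b j by rewrite /upd eqxx.
rewrite (@ksgn_lift F _ i j s _ b) => [|k]; last by rewrite uE ab.
rewrite ui (eq_kap F uE).
have E1 : \prod_(k < m.+1 | (k < i)%N) @eta F (b j) (upd i (b j) a k) =
    \prod_(k < m.+1 | (k < i)%N) eta (b j) (a k).
  by apply: eq_bigr => k ki; rewrite /upd; case: eqP => // e; rewrite e ltnn in ki.
have E2 c : \prod_k @eta F c (upd i (b j) a (lift i k)) =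
    \prod_k eta c (a (lift i k)) by apply: eq_bigr => k _; rewrite uE.
rewrite E1 E2.
have -> : ksgn F s (fun k => upd i (b j) a (lift i k)) =
    ksgn F s (fun k => (p - (i < p) <= k)%N).
  by apply: eq_ksgn => k; rewrite uE aE.
have E3 c : \prod_k @eta F c (a (lift i k)) =
    \prod_(k < m) eta c (p - (i < p) <= k)%N.
  by apply: eq_bigr => k _; rewrite aE.
rewrite !E3 /scheck.
have E4 r l : (l <= m.+1)%N ->
    \prod_(k < m.+1 | (k < l)%N) @eta F true (r <= k)%N = (-1) ^+ (l - r).
  exact: prod_par_lt.
have E5 r : \prod_(k < m) @eta F true (r <= k)%N = (-1) ^+ (m - r) by apply: prod_par.
set K := kap _ _; set S := ksgn _ _ _.
have im := ltnW (ltn_ord i); have jm := ltnW (ltn_ord j).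
have sgnE x y : odd x = odd y -> (-1) ^+ x = (-1) ^+ y :> F.
  by move=> e; rewrite -signr_odd e signr_odd.
have E6 c r l : (l <= m.+1)%N ->
    \prod_(k < m.+1 | (k < l)%N) @eta F c (r <= k)%N = if c then (-1) ^+ (l - r) else 1.
  by move=> lm; rewrite prod_eta_par E4.
have E7 c r : \prod_(k < m) @eta F c (r <= k)%N = if c then (-1) ^+ (m - r) else 1.
  by rewrite prod_eta_par E5.
rewrite /a /b !E6 // !E7 [(p <= i)%N]leqNgt [(q <= j)%N]leqNgt.
have im' : (i <= m)%N by rewrite -ltnS.
have jm' : (j <= m)%N by rewrite -ltnS.
move: K S pq im' jm' => K S; clear -sgnE pm qm.
move: (nat_of_ord i) (nat_of_ord j) => {}i {}j.
(* The four cases of [scheck]; with [pq] tying [p] to [q], each one reduces to a congruence of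
   exponents modulo 2. *)
case: (ltnP i p) => ip; case: (ltnP j q) => jq /= pq im jm.
- ring.
- have e : (-1) ^+ (m - (p - 1)) * (-1) ^+ (j - q) = (-1) ^+ (j.+1 + m.+1) :> F.
    rewrite -exprD; apply: sgnE; lia.
  have -> : (i - p = 0)%N by lia.
  by rewrite !mulr1 -e expr0; ring.
- have e : (-1) ^+ (i - p) * (-1) ^+ (m - (p - 0)) = (-1) ^+ (i.+1 + m.+1) :> F.
    rewrite -exprD; apply: sgnE; lia.
  have Y2 : (-1) ^+ (m - (p - 0)) * (-1) ^+ (m - (p - 0)) = 1 :> F.
    by rewrite -expr2 sqrr_sign.
  rewrite -e; transitivity ((-1) ^+ (i - p) * K * S *
    ((-1) ^+ (m - (p - 0)) * (-1) ^+ (m - (p - 0)))); last by ring.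
  by rewrite Y2; ring.
- have e : (-1) ^+ (i - p) * (-1) ^+ (j - q) = (-1) ^+ (i.+1 + j.+1) :> F.
    rewrite -exprD; apply: sgnE; lia.
  by rewrite -e; ring.
Qed.

Section Parts23.
Variables (F : fieldType) (V : superpair F) (n : nat).
Hypothesis VM : metric_generalized_jordan_superpair V.
Local Notation eta := (@eta F).
Local Notation W := (sympair V n).

Lemma pairing_even s a b (x : V (~~ s)) (y : V s) :
  x \in gr (V (~~ s)) a -> y \in gr (V s) b -> a != b -> pairing x y = 0.
Proof.
case: s x y => x y xa yb ne; first exact: (form_even (mgjs_metric VM) xa yb ne).
apply: (etrans (twist_hom (form_linear1 (mgjs_metric VM))
  (form_linear2 (mgjs_metric VM)) yb xa)).
by rewrite (form_even (mgjs_metric VM) yb xa) ?scaler0 // eq_sym.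
Qed.

(** The permutations sending [i] to [j] are those of the minor. When the numbers of remaining even
    rows and columns differ, every product vanishes, in agreement with the zero value of
    [superminor]. *)
Lemma sum_bracket_sign p q (A : 'M[F]_n) (i j : 'I_n) :
  (p <= n)%N -> (q <= n)%N -> block_even p q A ->
  \sum_(s : 'S_n | s i == j)
    bracket_sign F i s (fun k => (p <= k)%N) (q <= s i)%N *
    \prod_(l | l != i) A l (s l) =
  omega (n - p) * (scheck p q i j * superminor p q A i j).
Proof.
case: n A i j => [|m] A i j pm qm ev; first by case: i.
rewrite sum_perm_lift /superminor.
under eq_bigr => s _ do rewrite prod_lift_perm lift_perm_id.
have pm' : (p - (i < p) <= m)%N by have := ltn_ord i; case: (ltnP i p) => /=; lia.
have qm' : (q - (j < q) <= m)%N by have := ltn_ord j; case: (ltnP j q) => /=; lia.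
have evM : block_even (p - (i < p)) (q - (j < q)) (row' i (col' j A)).
  move=> k l ne; rewrite !mxE ev //; apply: contraNneq ne => e.
  by rewrite ltnNge [X in _ == X]ltnNge -!leq_bump_sub -!ltnNge; apply/eqP.
have [pq|pq] := eqVneq (p - (i < p))%N (q - (j < q))%N; last first.
  by rewrite !mulr0 big1 // => s _; rewrite (block_even_prod0 _ pm' qm' pq evM) mulr0.
rewrite -pq in evM.
rewrite -(signed_perm_sum_perdet pm' evM) !mulr_sumr; apply: eq_bigr => s _.
have [->|nz] := eqVneq (\prod_k row' i (col' j A) k (s k)) 0.
  by rewrite !mulr0.
rewrite (@bracket_sign_lift F m p q i j s pm qm _ pq) ?mulrA //.
move=> k; have [e|ne] := eqVneq (lift i k < p)%N (lift j (s k) < q)%N.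
  by rewrite [LHS]leqNgt [RHS]leqNgt e.
by case/eqP: nz; rewrite (bigD1 k) //= !mxE ev ?mul0r.
Qed.

Lemma nu_sympair_superminor s (p q : nat) (f : 'I_n -> V (~~ s)) (v : 'I_n -> V s) :
  (p <= n)%N -> (q <= n)%N -> parity_ordered p f -> parity_ordered q v ->
  let B := \matrix_(i, j) pairing (f i) (v j) in
  @nu F W (~~ s) s (vee f) (vee v) =
    omega (n - p) *: \sum_(i < n) \sum_(j < n)
      (scheck p q i j * superminor p q B i j) *: sympair_act n (nu (f i) (v j)).
Proof.
move=> pn qn fp vq B; rewrite (nu_sympair_vee VM fp vq) scaler_sumr.
have evB : block_even p q B.
  move=> i j ne; rewrite mxE (pairing_even (fp i) (vq j)) //.
  by apply: contra ne => /eqP e; rewrite !ltnNge e.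
apply: eq_bigr => i _.
rewrite (partition_big (fun t : 'S_n => t i) xpredT) //= scaler_sumr.
apply: eq_bigr => j _; rewrite scalerA -(sum_bracket_sign i j pn qn evB) scaler_suml.
apply: eq_bigr => t /eqP tij; congr (_ * _ *: _); last by rewrite tij.
by apply: eq_bigr => l _; rewrite mxE.
Qed.

Lemma sympow_act_nu s a b c (x : V (~~ s)) (y : V s) (g : 'I_n -> V (~~ s)) :
  x \in gr (V (~~ s)) a -> y \in gr (V s) b ->
  (forall i, g i \in gr (V (~~ s)) (c i)) ->
  sympow_act (ecomp (nu x y) (~~ s)) (vee g) =
  \sum_(k < n) (\prod_(t < n | (t < k)%N) eta (a (+) b) (c t)) *:
    vee (upd k (trip x y (g k)) g).
Proof.
move=> xa yb gc; have h : hom_endo (a (+) b) (ecomp (nu x y) (~~ s)).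
  by move=> d w wd; apply: (nu_ehom VM xa yb).
rewrite (sympow_act_vee h gc); apply: eq_bigr => k _.
by rewrite (ecomp_nuV VM).
Qed.

Lemma trip0l s (y : V s) (z : V (~~ s)) : trip (0 : V (~~ s)) y z = 0.
Proof.
case: s y z => y z; first exact: (lin0 (tneg_linl (trip_linear1 (mgjs_trilinear VM)) y z)).
exact: (lin0 (tpos_linr (trip_linear1 (mgjs_trilinear VM)) z y)).
Qed.

Lemma trip0r s (x z : V (~~ s)) : trip x (0 : V s) z = 0.
Proof.
case: s x z => x z; first exact: (lin0 (tneg_linr (trip_linear2 (mgjs_trilinear VM)) x z)).
exact: (lin0 (tpos_linl (trip_linear2 (mgjs_trilinear VM)) z x)).
Qed.

Lemma trip_sympair_superminor s (p q r : nat) (f : 'I_n -> V (~~ s))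
    (v : 'I_n -> V s) (g : 'I_n -> V (~~ s)) :
  (p <= n)%N -> (q <= n)%N -> (r <= n)%N ->
  parity_ordered p f -> parity_ordered q v -> parity_ordered r g ->
  let B := \matrix_(i, j) pairing (f i) (v j) in
  @trip F W (~~ s) s (vee f) (vee v) (vee g) =
    omega (n - p) *: \sum_(i < n) \sum_(j < n) \sum_(k < n)
      (scheck p q i j * superminor p q B i j *
       \prod_(t < n | (t < k)%N) eta (par (g t)) (par (f i) (+) par (v j))) *:
      vee (fun t => if t == k then trip (f i) (v j) (g k) else g t).
Proof.
move=> pn qn rn fp vq gr B.
rewrite (trip_sympair VM) (nu_sympair_superminor pn qn fp vq) -/B.
have l : linear (fun X : endpair W => ecomp X (~~ s) (vee g)).
  by move=> c X Y; apply: ecomp_lin.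
rewrite (linZ l); congr (_ *: _).
rewrite (linear_expand2 _ _ l); apply: eq_bigr => i _; apply: eq_bigr => j _.
rewrite ecomp_sympair_act (sympow_act_nu (fp i) (vq j) gr) scaler_sumr.
apply: eq_bigr => k _; rewrite scalerA.
set w := vee _; rewrite -/w.
(* [par] counts the zero vector as even, which may contradict its place in the family; but a zero
   among the vectors concerned makes [w] vanish. *)
have [->|w0] := eqVneq w 0; first by rewrite !scaler0.
congr (_ * _ *: _); apply: eq_bigr => t tk; rewrite etaC.
have tne : t != k by apply: contraTneq tk => ->; rewrite ltnn.
have -> : par (g t) = (r <= t)%N.
  apply: (par_gr (gr t)); apply: contra w0 => /eqP g0; apply/eqP.
  by apply: (@vee_eq0 _ _ _ _ t); rewrite /upd (negPf tne).
have -> : par (f i) = (p <= i)%N.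
  apply: (par_gr (fp i)); apply: contra w0 => /eqP f0; apply/eqP.
  apply: (@vee_eq0 _ _ _ _ k); rewrite /upd eqxx f0.
  exact: trip0l.
have -> // : par (v j) = (q <= j)%N.
apply: (par_gr (vq j)); apply: contra w0 => /eqP v0; apply/eqP.
apply: (@vee_eq0 _ _ _ _ k); rewrite /upd eqxx v0.
exact: trip0r.
Qed.

End Parts23.

(** * Affine group schemes *)

(** An algebra up to an undecided equivalence. Tensor products (lists of pairs) and coordinate
    algebras (polynomial expressions) are both obtained as quotients of such data. *)
Record alg_presentation (F : fieldType) := AlgPresentation {
  ap_car : Type;
  ap_eq : ap_car -> ap_car -> Prop;
  ap0 : ap_car;
  ap1 : ap_car;
  ap_add : ap_car -> ap_car -> ap_car;
  ap_mul : ap_car -> ap_car -> ap_car;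
  ap_opp : ap_car -> ap_car;
  ap_scale : F -> ap_car -> ap_car;
  ap_refl : forall x, ap_eq x x;
  ap_sym : forall x y, ap_eq x y -> ap_eq y x;
  ap_trans : forall x y z, ap_eq x y -> ap_eq y z -> ap_eq x z;
  ap_addE : forall x x' y y', ap_eq x x' -> ap_eq y y' ->
    ap_eq (ap_add x y) (ap_add x' y');
  ap_mulE : forall x x' y y', ap_eq x x' -> ap_eq y y' ->
    ap_eq (ap_mul x y) (ap_mul x' y');
  ap_oppE : forall x x', ap_eq x x' -> ap_eq (ap_opp x) (ap_opp x');
  ap_scaleE : forall c x x', ap_eq x x' -> ap_eq (ap_scale c x) (ap_scale c x');
  ap_addA : forall x y z, ap_eq (ap_add x (ap_add y z)) (ap_add (ap_add x y) z);
  ap_addC : forall x y, ap_eq (ap_add x y) (ap_add y x);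
  ap_add0 : forall x, ap_eq (ap_add ap0 x) x;
  ap_addN : forall x, ap_eq (ap_add (ap_opp x) x) ap0;
  ap_mulA : forall x y z, ap_eq (ap_mul x (ap_mul y z)) (ap_mul (ap_mul x y) z);
  ap_mulC : forall x y, ap_eq (ap_mul x y) (ap_mul y x);
  ap_mul1 : forall x, ap_eq (ap_mul ap1 x) x;
  ap_mulD : forall x y z,
    ap_eq (ap_mul (ap_add x y) z) (ap_add (ap_mul x z) (ap_mul y z));
  ap_10 : ~ ap_eq ap1 ap0;
  ap_scaleA : forall a b x, ap_eq (ap_scale a (ap_scale b x)) (ap_scale (a * b) x);
  ap_scale1 : forall x, ap_eq (ap_scale 1 x) x;
  ap_scaleDr : forall a x y,
    ap_eq (ap_scale a (ap_add x y)) (ap_add (ap_scale a x) (ap_scale a y));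
  ap_scaleDl : forall x a b,
    ap_eq (ap_scale (a + b) x) (ap_add (ap_scale a x) (ap_scale b x));
  ap_scaleAl : forall a x y,
    ap_eq (ap_scale a (ap_mul x y)) (ap_mul (ap_scale a x) y) }.

Section Quotient.
Variables (F : fieldType) (P : alg_presentation F).

(** Elements are equivalence classes seen as predicates; equivalent representatives give equal
    elements by extensionality. *)
Record pquot := PQuot {
  pq_set : ap_car P -> Prop; _ : exists x, pq_set = ap_eq x }.

HB.instance Definition _ := gen_eqMixin pquot.
HB.instance Definition _ := gen_choiceMixin pquot.

Lemma pquot_eq s s' p p' : s = s' -> @PQuot s p = @PQuot s' p'.
Proof. by move=> e; subst s'; congr PQuot; apply: Prop_irrelevance. Qed.

Definition pclass (x : ap_car P) : pquot := PQuot (ex_intro _ x erefl).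

Lemma pclassP x y : pclass x = pclass y <-> ap_eq x y.
Proof.
split=> [[e]|xy]; first by rewrite e; apply: ap_refl.
have e : ap_eq x = ap_eq y.
  apply: funext => z; apply: propext; split=> h.
    exact: ap_trans (ap_sym xy) h.
  exact: ap_trans xy h.
exact: pquot_eq.
Qed.

Lemma pclass_surj (q : pquot) : exists x, q = pclass x.
Proof.
by case: q => s p; have [x e] := p; exists x; apply: pquot_eq.
Qed.

Definition prepr (q : pquot) : ap_car P := projT1 (cid (pclass_surj q)).

Lemma preprK q : pclass (prepr q) = q.
Proof. by rewrite /prepr; case: cid. Qed.

Lemma prepr_eq x : ap_eq (prepr (pclass x)) x.
Proof. by apply/pclassP; rewrite preprK. Qed.

Definition pq_add q r := pclass (ap_add (prepr q) (prepr r)).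
Definition pq_mul q r := pclass (ap_mul (prepr q) (prepr r)).
Definition pq_opp q := pclass (ap_opp (prepr q)).
Definition pq_scale c q := pclass (ap_scale c (prepr q)).

Lemma pq_addE x y : pq_add (pclass x) (pclass y) = pclass (ap_add x y).
Proof. by apply/pclassP/ap_addE; apply: prepr_eq. Qed.
Lemma pq_mulE x y : pq_mul (pclass x) (pclass y) = pclass (ap_mul x y).
Proof. by apply/pclassP/ap_mulE; apply: prepr_eq. Qed.
Lemma pq_oppE x : pq_opp (pclass x) = pclass (ap_opp x).
Proof. by apply/pclassP/ap_oppE/prepr_eq. Qed.
Lemma pq_scaleE c x : pq_scale c (pclass x) = pclass (ap_scale c x).
Proof. by apply/pclassP/ap_scaleE/prepr_eq. Qed.

Let pqE := (pq_addE, pq_mulE, pq_oppE, pq_scaleE).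

Fact pq_addA : associative pq_add.
Proof.
move=> q r s; rewrite -(preprK q) -(preprK r) -(preprK s) !pqE.
exact/pclassP/ap_addA.
Qed.
Fact pq_addC : commutative pq_add.
Proof. by move=> q r; rewrite -(preprK q) -(preprK r) !pqE; apply/pclassP/ap_addC. Qed.
Fact pq_add0 : left_id (pclass (ap0 P)) pq_add.
Proof. by move=> q; rewrite -(preprK q) !pqE; apply/pclassP/ap_add0. Qed.
Fact pq_addN : left_inverse (pclass (ap0 P)) pq_opp pq_add.
Proof. by move=> q; rewrite -(preprK q) !pqE; apply/pclassP/ap_addN. Qed.

HB.instance Definition _ :=
  GRing.isZmodule.Build pquot pq_addA pq_addC pq_add0 pq_addN.

Fact pq_mulA : associative pq_mul.
Proof.
move=> q r s; rewrite -(preprK q) -(preprK r) -(preprK s) !pqE.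
exact/pclassP/ap_mulA.
Qed.
Fact pq_mulC : commutative pq_mul.
Proof. by move=> q r; rewrite -(preprK q) -(preprK r) !pqE; apply/pclassP/ap_mulC. Qed.
Fact pq_mul1 : left_id (pclass (ap1 P)) pq_mul.
Proof. by move=> q; rewrite -(preprK q) !pqE; apply/pclassP/ap_mul1. Qed.
Fact pq_mulD : left_distributive pq_mul pq_add.
Proof.
move=> q r s; rewrite -(preprK q) -(preprK r) -(preprK s) !pqE.
exact/pclassP/ap_mulD.
Qed.
Fact pq_10 : pclass (ap1 P) != 0.
Proof. by apply/eqP => /pclassP/ap_10. Qed.

HB.instance Definition _ := GRing.Zmodule_isComNzRing.Build pquot
  pq_mulA pq_mulC pq_mul1 pq_mulD pq_10.

Fact pq_scaleA a b q : pq_scale a (pq_scale b q) = pq_scale (a * b) q.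
Proof. by rewrite -(preprK q) !pqE; apply/pclassP/ap_scaleA. Qed.
Fact pq_scale1 : left_id 1 pq_scale.
Proof. by move=> q; rewrite -(preprK q) !pqE; apply/pclassP/ap_scale1. Qed.
Fact pq_scaleDr : right_distributive pq_scale +%R.
Proof.
move=> a q r; rewrite -(preprK q) -(preprK r).
by rewrite [_ + _ in LHS]pq_addE !pqE [RHS]pq_addE; apply/pclassP/ap_scaleDr.
Qed.
Fact pq_scaleDl q : {morph pq_scale^~ q : a b / a + b}.
Proof.
move=> a b; rewrite -(preprK q) !pqE [RHS]pq_addE.
exact/pclassP/ap_scaleDl.
Qed.

HB.instance Definition _ := GRing.Zmodule_isLmodule.Build F pquot
  pq_scaleA pq_scale1 pq_scaleDr pq_scaleDl.

Fact pq_scaleAl (a : F) (q r : pquot) : a *: (q * r) = a *: q * r.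
Proof.
rewrite -(preprK q) -(preprK r).
rewrite [_ * _ in LHS]pq_mulE [LHS]pq_scaleE [X in _ = X * _]pq_scaleE.
by rewrite [RHS]pq_mulE; apply/pclassP/ap_scaleAl.
Qed.

HB.instance Definition _ := GRing.Lmodule_isLalgebra.Build F pquot pq_scaleAl.
HB.instance Definition _ := GRing.Lalgebra_isComAlgebra.Build F pquot.

Definition pquot_alg : comAlgType F := pquot.

Lemma pclassD x y : pclass (ap_add x y) = pclass x + pclass y :> pquot_alg.
Proof. exact/esym/pq_addE. Qed.
Lemma pclassM x y : pclass (ap_mul x y) = pclass x * pclass y :> pquot_alg.
Proof. exact/esym/pq_mulE. Qed.
Lemma pclassZ c x : pclass (ap_scale c x) = c *: pclass x :> pquot_alg.
Proof. exact/esym/pq_scaleE. Qed.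
Lemma pclass1 : pclass (ap1 P) = 1 :> pquot_alg. Proof. by []. Qed.
Lemma pclass0 : pclass (ap0 P) = 0 :> pquot_alg. Proof. by []. Qed.

End Quotient.

(** * Linear functionals in arbitrary dimension *)

Section Functionals.
Variables (F : fieldType) (S : lmodType F).
Implicit Types (A U : set S) (x y : S).
Local Notation functional l := (linear (l : S -> F^o)).

Definition subspace A := A 0 /\ forall c x y, A x -> A y -> A (c *: x + y).

Lemma subspaceZ A c x : subspace A -> A x -> A (c *: x).
Proof. by move=> [A0 AD] Ax; have := AD c x 0 Ax A0; rewrite addr0. Qed.

Lemma subspaceD A x y : subspace A -> A x -> A y -> A (x + y).
Proof. by move=> [A0 AD] Ax Ay; have := AD 1 x y Ax Ay; rewrite scale1r. Qed.

Lemma subspaceB A x y : subspace A -> A x -> A y -> A (x - y).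
Proof. by move=> As Ax Ay; apply: subspaceD => //; rewrite -scaleN1r; apply: subspaceZ. Qed.

(** A maximal subspace [H] containing [U] but not [x] is a complement of the line of [x], and [l] is
    the coordinate along [x]. *)
Lemma functional_separation U x : subspace U -> ~ U x ->
  exists l : S -> F, [/\ functional l, l x = 1 & forall y, U y -> l y = 0].
Proof.
move=> Us Ux.
pose good A := [/\ subspace A, (forall y, U y -> A y) & ~ A x].
have goodU : good U by split.
have [|H [HP Hmax]] := @Zorn_bigcup S [set A | A = set0 \/ good A]%classic.
  move=> Fam FamP tot.
  have [[A0 [FA0 [A0s UA0 A0x]]]|none] :=
    pselect (exists A, Fam A /\ good A); last first.
    left; apply/seteqP; split=> // y [A FA Ay].
    by have [e|gA] := FamP A FA; [rewrite e in Ay|case: none; exists A].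
  right; split; last first.
  - by move=> [A FA Ax]; have [e|[_ _]] := FamP A FA; [rewrite e in Ax|apply].
  - by move=> y /UA0 A0y; exists A0.
  split; first by exists A0 => //; case: A0s.
  move=> c y z [A FA Ay] [A' FA' A'z].
  have As : subspace A by have [e|[]//] := FamP A FA; rewrite e in Ay.
  have A's : subspace A' by have [e|[]//] := FamP A' FA'; rewrite e in A'z.
  have [AA'|A'A] := tot A A' FA FA'.
    by exists A' => //; case: A's => _; apply=> //; apply: AA'.
  by exists A => //; case: As => _; apply=> //; apply: A'A.
have [e|[Hs UH Hx]] := HP.
  case: (Hmax U); last by right.
  by rewrite e; split; [move=> y []|case: Us => U0 _ /(_ 0 U0)].
have decomp y : exists c, H (y - c *: x).
  have [Hy|Hy] := pselect (H y); first by exists 0; rewrite scale0r subr0.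
  pose H' := [set z | exists c, H (z - c *: y)]%classic.
  have H's : subspace H'.
    split; first by exists 0; rewrite scale0r subr0; case: Hs.
    move=> c z z' [d Hd] [d' Hd']; exists (c * d + d').
    have -> : c *: z + z' - (c * d + d') *: y = c *: (z - d *: y) + (z' - d' *: y).
      by rewrite scalerBr scalerA scalerDl opprD addrACA.
    by case: Hs => _; apply.
  (* By maximality H + F y contains [x]; solving that relation for [y] gives its coordinate. *)
  have [H'x|H'x] := pselect (H' x).
    have [c Hc] := H'x; have [c0|c0] := eqVneq c 0.
      by case: Hx; rewrite c0 scale0r subr0 in Hc.
    exists c^-1; have -> : y - c^-1 *: x = - c^-1 *: (x - c *: y).
      by rewrite scalerBr !scaleNr scalerA mulVf // scale1r opprK addrC.
    exact: subspaceZ.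
  case: (Hmax H').
    split; first by move=> z Hz; exists 0; rewrite scale0r subr0.
    by move=> HH'; apply/Hy/HH'; exists 1; rewrite scale1r subrr; case: Hs.
  right; split=> // z /UH Hz; exists 0; by rewrite scale0r subr0.
have uniq y c c' : H (y - c *: x) -> H (y - c' *: x) -> c = c'.
  move=> h h'; apply/eqP; rewrite -subr_eq0; apply/negPn/negP => ne.
  have := subspaceB Hs h' h.
  rewrite opprB addrC addrA subrK -scalerBl => /(subspaceZ (c - c')^-1 Hs).
  by rewrite scalerA mulVf // scale1r.
pose l y := projT1 (cid (decomp y)).
have lP y : H (y - l y *: x) by rewrite /l; case: cid.
exists l; split.
- move=> c y z; apply: (uniq (c *: y + z)) => //.
  have -> : c *: y + z - (c * l y + l z) *: x = c *: (y - l y *: x) + (z - l z *: x).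
    by rewrite scalerBr scalerA scalerDl opprD addrACA.
  by case: Hs => _; apply.
- by apply: (uniq x) => //; rewrite scale1r subrr; case: Hs.
- by move=> y Uy; apply: (uniq y) => //; rewrite scale0r subr0; apply: UH.
Qed.

(** Coordinates on the span of finitely many vectors, built one vector at a time: the new functional
    vanishes on the vectors already recovered, so the earlier formulas survive. *)
Lemma dual_frame (s : seq S) :
  exists fr : seq ((S -> F) * S), (forall p, List.In p fr -> functional p.1) /\
    forall y, y \in s -> y = \sum_(p <- fr) p.1 y *: p.2.
Proof.
elim: s => [|y s [fr [frl frE]]]; first by exists [::].
pose U := [set z | z = \sum_(p <- fr) p.1 z *: p.2]%classic.
have E c z z' : \sum_(p <- fr) p.1 (c *: z + z') *: p.2 =
    c *: (\sum_(p <- fr) p.1 z *: p.2) + \sum_(p <- fr) p.1 z' *: p.2.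
  elim: fr frl {frE U} => [|p fr IH] frl; first by rewrite !big_nil scaler0 addr0.
  rewrite !big_cons IH => [|q qfr]; last by apply: frl; right.
  have pl : p.1 (c *: z + z') = c * p.1 z + p.1 z' := frl p (or_introl erefl) c z z'.
  by rewrite pl scalerDl -scalerA scalerDr addrACA.
have Us : subspace U.
  split=> [|c z z' Uz Uz']; last by rewrite /U /= E -Uz -Uz'.
  by have := E (-1) 0 0; rewrite /U /= scaler0 addr0 scaleN1r addNr.
have [Uy|Uy] := pselect (U y).
  exists fr; split=> // z; rewrite inE => /orP[/eqP ->//|]; exact: frE.
have [l [ll ly lU]] := functional_separation Us Uy.
exists ((l, y - \sum_(p <- fr) p.1 y *: p.2) :: fr); split.
  by move=> p /= [<-//|]; apply: frl.
move=> z; rewrite inE big_cons /= => /orP[/eqP ->|zs].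
  by rewrite ly scale1r subrK.
by rewrite (lU z) ?scale0r ?add0r; apply: frE.
Qed.

End Functionals.

(** The hypothesis says that a tensor is zero, the conclusion that its image under multiplication
    is. A frame for the left factors writes this image as a combination of slices. *)
Lemma functionals_separate (F : fieldType) (S : comAlgType F) (l : seq (S * S)) :
  (forall e : S -> F, linear (e : S -> F^o) ->
    \sum_(p <- l) e p.1 *: p.2 = 0) -> \sum_(p <- l) p.1 * p.2 = 0.
Proof.
move=> l0; have [fr [frl frE]] := dual_frame [seq p.1 | p <- l].
have -> : \sum_(p <- l) p.1 * p.2 =
    \sum_(q <- fr) q.2 * \sum_(p <- l) q.1 p.1 *: p.2.
  under [RHS]eq_bigr => q _ do rewrite mulr_sumr.
  rewrite exchange_big /=; apply: eq_big_seq => p pl.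
  rewrite {1}(frE p.1) ?map_f // mulr_suml; apply: eq_bigr => q _.
  by rewrite -scalerAl scalerAr.
elim: fr frl {frE} => [|q fr IH] frl; first by rewrite big_nil.
rewrite big_cons IH => [|p pfr]; last by apply: frl; right.
by rewrite l0 ?mulr0 ?addr0 //; apply: frl; left.
Qed.

(** * Tensor products of commutative algebras *)

Section Tensor.
Variables (F : fieldType) (S T : comAlgType F).
Implicit Types (l : seq (S * T)).
Local Notation functional e := (linear (e : S -> F^o)).

Definition slice (e : S -> F) l : T := \sum_(p <- l) e p.1 *: p.2.

(* A list stands for a sum of pure tensors; functionals on the left factor
   separate the elements of the tensor product. *)
Definition tns_eq l l' := forall e, functional e -> slice e l = slice e l'.
Definition tns_mul l l' := [seq (p.1 * q.1, p.2 * q.2) | p <- l, q <- l'].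
Definition tns_scale (c : F) l := [seq (c *: p.1, p.2) | p <- l].

Lemma slice_cat e l l' : slice e (l ++ l') = slice e l + slice e l'.
Proof. by rewrite /slice big_cat. Qed.

Lemma slice_mul e l l' : slice e (tns_mul l l') =
  \sum_(p <- l) \sum_(q <- l') e (p.1 * q.1) *: (p.2 * q.2).
Proof. by rewrite /slice /tns_mul big_allpairs_dep. Qed.

Lemma slice_scale e c l : functional e -> slice e (tns_scale c l) = c *: slice e l.
Proof.
move=> el; rewrite /slice big_map scaler_sumr; apply: eq_bigr => p _ /=.
have e0 : e 0 = 0 by have := el (-1) 0 0; rewrite scaler0 addr0 scaleN1r addNr.
by have := el c p.1 0; rewrite !addr0 e0 addr0 => ->; rewrite scalerA.
Qed.

Lemma functional_mul e (x : S) : functional e -> functional (fun y => e (x * y)).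
Proof. by move=> el c y z; rewrite mulrDr -scalerAr el. Qed.

Lemma slice_mulr e l l' : slice e (tns_mul l l') =
  \sum_(p <- l) p.2 * slice (fun y => e (p.1 * y)) l'.
Proof.
rewrite slice_mul; apply: eq_bigr => p _; rewrite mulr_sumr.
by apply: eq_bigr => q _; rewrite scalerAr.
Qed.

Lemma slice_mulC e l l' : slice e (tns_mul l l') = slice e (tns_mul l' l).
Proof.
rewrite !slice_mul exchange_big; apply: eq_bigr => q _; apply: eq_bigr => p _.
by rewrite mulrC [p.2 * _]mulrC.
Qed.

(** A functional composed with multiplication by a fixed element is again a functional, which
    settles one argument; commutativity settles the other. *)
Lemma tns_mulE l k l' k' : tns_eq l k -> tns_eq l' k' ->
  tns_eq (tns_mul l l') (tns_mul k k').
Proof.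
have half m m' n : tns_eq m m' -> tns_eq (tns_mul n m) (tns_mul n m').
  move=> mm e el; rewrite !slice_mulr; apply: eq_bigr => p _.
  by rewrite mm //; apply: functional_mul.
move=> lk lk' e el; rewrite (half l' k') // slice_mulC (half l k) //.
by rewrite slice_mulC.
Qed.

(** Otherwise every functional would vanish at 1, and [functionals_separate] would give 1 = 0 in
    [S]. *)
Lemma tns_10 : ~ tns_eq [:: (1, 1)] [::].
Proof.
move=> h; have := @functionals_separate F S [:: (1, 1)].
rewrite big_seq1 /= mulr1 => h1; have /eqP := oner_neq0 S; apply; apply: h1 => e el.
have := h e el; rewrite /slice big_seq1 big_nil /= => /eqP.
rewrite scaler_eq0 oner_eq0 orbF => /eqP e1.
by rewrite big_seq1 /= e1 scale0r.
Qed.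

Fact tns_sym l l' : tns_eq l l' -> tns_eq l' l.
Proof. by move=> h e el; rewrite h. Qed.
Fact tns_trans l l' l'' : tns_eq l l' -> tns_eq l' l'' -> tns_eq l l''.
Proof. by move=> h h' e el; rewrite h ?h'. Qed.
Fact tns_addE l k l' k' : tns_eq l k -> tns_eq l' k' -> tns_eq (l ++ l') (k ++ k').
Proof. by move=> h h' e el; rewrite !slice_cat h ?h'. Qed.
Fact tns_scaleE c l k : tns_eq l k -> tns_eq (tns_scale c l) (tns_scale c k).
Proof. by move=> h e el; rewrite !slice_scale // h. Qed.
Fact tns_addA l l' l'' : tns_eq (l ++ (l' ++ l'')) ((l ++ l') ++ l'').
Proof. by move=> e el; rewrite catA. Qed.
Fact tns_addC l l' : tns_eq (l ++ l') (l' ++ l).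
Proof. by move=> e el; rewrite !slice_cat addrC. Qed.
Fact tns_addN l : tns_eq (tns_scale (-1) l ++ l) [::].
Proof.
by move=> e el; rewrite slice_cat slice_scale // scaleN1r addNr /slice big_nil.
Qed.
Fact tns_mulA l l' l'' : tns_eq (tns_mul l (tns_mul l' l'')) (tns_mul (tns_mul l l') l'').
Proof.
move=> e el; rewrite slice_mulr [RHS]slice_mulr big_allpairs_dep /=.
apply: eq_bigr => p _; rewrite slice_mulr mulr_sumr; apply: eq_bigr => q _ /=.
by rewrite mulrA; congr (_ * _); apply: eq_bigr => r _; rewrite mulrA.
Qed.
Fact tns_mulC l l' : tns_eq (tns_mul l l') (tns_mul l' l).
Proof. by move=> e el; rewrite slice_mulC. Qed.
Fact tns_mul1 l : tns_eq (tns_mul [:: (1, 1)] l) l.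
Proof.
move=> e el; rewrite slice_mulr big_seq1 mul1r.
by apply: eq_bigr => p _; rewrite mul1r.
Qed.
Fact tns_mulD l l' l'' :
  tns_eq (tns_mul (l ++ l') l'') (tns_mul l l'' ++ tns_mul l' l'').
Proof. by move=> e el; rewrite slice_cat !slice_mulr big_cat. Qed.
Fact tns_scaleA a b l : tns_eq (tns_scale a (tns_scale b l)) (tns_scale (a * b) l).
Proof. by move=> e el; rewrite !slice_scale // scalerA. Qed.
Fact tns_scale1 l : tns_eq (tns_scale 1 l) l.
Proof. by move=> e el; rewrite slice_scale // scale1r. Qed.
Fact tns_scaleDr a l l' :
  tns_eq (tns_scale a (l ++ l')) (tns_scale a l ++ tns_scale a l').
Proof. by move=> e el; rewrite slice_cat !slice_scale // slice_cat scalerDr. Qed.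
Fact tns_scaleDl l a b : tns_eq (tns_scale (a + b) l) (tns_scale a l ++ tns_scale b l).
Proof. by move=> e el; rewrite slice_cat !slice_scale // scalerDl. Qed.
Fact tns_scaleAl a l l' : tns_eq (tns_scale a (tns_mul l l')) (tns_mul (tns_scale a l) l').
Proof.
move=> e el; rewrite slice_scale // !slice_mul big_map scaler_sumr.
apply: eq_bigr => p _; rewrite scaler_sumr; apply: eq_bigr => q _ /=.
have e0 : e 0 = 0 by have := el (-1) 0 0; rewrite scaler0 addr0 scaleN1r addNr.
have := el a (p.1 * q.1) 0; rewrite !addr0 e0 addr0 -scalerAl => ->.
by rewrite scalerA.
Qed.

Definition tensor_presentation := @AlgPresentation F (seq (S * T)) tns_eq
  [::] [:: (1, 1)] cat tns_mul (tns_scale (-1)) tns_scale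
  (fun l e _ => erefl) tns_sym tns_trans tns_addE tns_mulE (@tns_scaleE (-1))
  tns_scaleE tns_addA tns_addC (fun l e _ => erefl) tns_addN tns_mulA tns_mulC
  tns_mul1 tns_mulD tns_10 tns_scaleA tns_scale1 tns_scaleDr tns_scaleDl
  tns_scaleAl.

Definition tensor : comAlgType F := pquot_alg tensor_presentation.

Definition tensl (x : S) : tensor := pclass (P := tensor_presentation) [:: (x, 1)].
Definition tensr (y : T) : tensor := pclass (P := tensor_presentation) [:: (1, y)].

Fact tensl_linear : linear tensl.
Proof.
move=> c x y; rewrite -pclassZ -pclassD; apply/pclassP => e el.
by rewrite /slice /= !big_cons !big_nil /= !addr0 !el;
  rewrite -scalerDl; congr (_ *: _); have := el c x 0; rewrite !addr0 => ->;
  have := el (-1) 0 0; rewrite scaler0 addr0 scaleN1r addNr => ->; rewrite addr0.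
Qed.
HB.instance Definition _ := GRing.isLinear.Build F S tensor *:%R tensl tensl_linear.

Fact tensl_monoid : monoid_morphism tensl.
Proof.
split=> // x y; rewrite -pclassM; apply/pclassP => e el.
by rewrite /slice /= !big_cons !big_nil /= mulr1.
Qed.
HB.instance Definition _ := GRing.isMonoidMorphism.Build S tensor tensl tensl_monoid.

Fact tensr_linear : linear tensr.
Proof.
move=> c x y; rewrite -pclassZ -pclassD; apply/pclassP => e el.
have e0 : e 0 = 0 by have := el (-1) 0 0; rewrite scaler0 addr0 scaleN1r addNr.
rewrite /slice /= !big_cons !big_nil /= !addr0.
have := el c 1 0; rewrite !addr0 e0 addr0 => ->.
by rewrite scalerDr scalerA mulrC -scalerA scalerA mulrC.
Qed.
HB.instance Definition _ := GRing.isLinear.Build F T tensor *:%R tensr tensr_linear.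

Fact tensr_monoid : monoid_morphism tensr.
Proof.
split=> // x y; rewrite -pclassM; apply/pclassP => e el.
by rewrite /slice /= !big_cons !big_nil /= mulr1.
Qed.
HB.instance Definition _ := GRing.isMonoidMorphism.Build T tensor tensr tensr_monoid.

Lemma tensor_slice (e : S -> F) l : functional e ->
  \sum_(p <- l) tensl p.1 * tensr p.2 = 0 -> \sum_(p <- l) e p.1 *: p.2 = 0.
Proof.
move=> el; have -> : \sum_(p <- l) tensl p.1 * tensr p.2 =
    pclass (P := tensor_presentation) l :> tensor.
  elim: l => [|[x y] l IH]; first by rewrite big_nil.
  rewrite big_cons IH -pclassM -pclassD; apply/pclassP => e' el'.
  by rewrite slice_cat /slice /= !big_cons big_nil addr0 /= mulr1 mul1r.
by move/pclassP => /(_ e el); rewrite /slice big_nil.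
Qed.

End Tensor.

Lemma lrmorphism_inj (F : fieldType) (A B : comAlgType F)
    (f : {lrmorphism A -> B}) : (forall q, f q = 0 -> q = 0) -> injective f.
Proof.
move=> f0 a b ab; apply/eqP; rewrite -subr_eq0; apply/eqP/f0.
by rewrite rmorphB /= ab subrr.
Qed.

(** * Polynomial expressions and coordinate algebras *)

Section Expressions.
Variable F : fieldType.

Inductive pexp (N : Type) :=
  PVar of N | PConst of F | PAdd of pexp N & pexp N | PMul of pexp N & pexp N.

Fixpoint peval (N : Type) (R : comAlgType F) (x : N -> R) (p : pexp N) : R :=
  match p with
  | PVar i => x i
  | PConst c => c%:A
  | PAdd p q => peval x p + peval x q
  | PMul p q => peval x p * peval x q
  end.

Lemma peval_map (N : Type) (R S : comAlgType F) (g : {lrmorphism R -> S})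
    (x : N -> R) p : peval (fun i => g (x i)) p = g (peval x p).
Proof.
elim: p => //= [c|p -> q ->|p -> q ->]; first by rewrite rmorph_alg.
  by rewrite rmorphD.
by rewrite rmorphM.
Qed.

Lemma eq_peval (N : Type) (R : comAlgType F) (x y : N -> R) p : x =1 y ->
  peval x p = peval y p.
Proof. by move=> xy; elim: p => //= [p -> q ->|p -> q ->]. Qed.

(* [co_closed] says that G is cut out by polynomial equations: the coordinate
   algebra is then the algebra of polynomial expressions, two of which are
   identified when they agree at all points. *)
Record coordinates (G : groupFunctor F) := Coordinates {
  cidx : Type;
  co : forall R : comAlgType F, G R -> cidx -> R;
  co_map : forall (R S : comAlgType F) (g : {lrmorphism R -> S}) (x : G R) i,
    co (Defs.pmap g x) i = g (co x i);
  co_inj : forall (R : comAlgType F) (x y : G R), co x =1 co y -> x = y;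
  co_closed : forall (R : comAlgType F) (x : cidx -> R),
    (forall p, (forall (S : comAlgType F) (g : G S), peval (co g) p = 0) ->
       peval x p = 0) -> exists g : G R, co g =1 x }.

Arguments co {G} C {R} _ _ : rename.
Arguments cidx {G} _ : rename.

Lemma peval_co_map (G : groupFunctor F) (C : coordinates G)
    (R S : comAlgType F) (g : {lrmorphism R -> S}) (x : G R) p :
  peval (co C (Defs.pmap g x)) p = g (peval (co C x) p).
Proof. by rewrite -peval_map; apply: eq_peval => i; apply: co_map. Qed.

Section Represent.
Variables (G : groupFunctor F) (C : coordinates G).
Local Notation E := (pexp (cidx C)).
Local Notation ev g p := (peval (co C g) p).

Definition same_values (p q : E) :=
  forall (S : comAlgType F) (g : G S), ev g p = ev g q.

(** Evaluation at the neutral element over F itself separates the two constants. *)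
Fact coord_alg_10 : ~ same_values (PConst _ 1) (PConst _ 0).
Proof.
move=> /(_ F^o 1%g) /=; rewrite scale1r scale0r => /eqP.
by rewrite oner_eq0.
Qed.

Definition coord_presentation : alg_presentation F.
Proof.
refine (@AlgPresentation F E same_values (PConst _ 0) (PConst _ 1)
  (@PAdd _) (@PMul _) (PMul (PConst _ (-1))) (fun c => PMul (PConst _ c))
  _ _ _ _ _ _ _ _ _ _ _ _ _ _ _ coord_alg_10 _ _ _ _ _);
  try by move=> *; move=> S g /=; ring.
- by move=> p q h S g.
- by move=> p q r h h' S g; rewrite h h'.
- by move=> p p' q q' h h' S g /=; rewrite h h'.
- by move=> p p' q q' h h' S g /=; rewrite h h'.
- by move=> p p' h S g /=; rewrite h.
- by move=> c p p' h S g /=; rewrite h.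
- by move=> p S g /=; rewrite scale0r add0r.
- by move=> p S g /=; rewrite scaleN1r mulN1r addNr scale0r.
- by move=> p S g /=; rewrite scale1r mul1r.
- by move=> a b p S g /=; rewrite !mulr_algl scalerA.
- by move=> p S g /=; rewrite scale1r mul1r.
- by move=> p a b S g /=; rewrite scalerDl mulrDl.
Defined.

Definition coord_alg : comAlgType F := pquot_alg coord_presentation.

Definition pval (p : E) : coord_alg := pclass (P := coord_presentation) p.

Lemma pval_surj (q : coord_alg) : exists p, q = pval p.
Proof. by exists (prepr q); rewrite /pval preprK. Qed.

Lemma peval_pval p : peval (fun i => pval (PVar i)) p = pval p.
Proof.
elim: p => //= [c|p -> q ->|p -> q ->].
- rewrite /pval; transitivity (pclass (P := coord_presentation)
    (PMul (PConst _ c) (PConst _ 1)) : coord_alg).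
    by rewrite pclassZ.
  by apply/pclassP => S g /=; rewrite scale1r mulr1.
- by rewrite /pval -pclassD.
- by rewrite /pval -pclassM.
Qed.

Section EvalAt.
Variables (R : comAlgType F) (x : G R).

Definition eval_at (q : coord_alg) : R := ev x (prepr q).

Lemma eval_atE p : eval_at (pval p) = ev x p.
Proof. exact: (@prepr_eq F coord_presentation p) R x. Qed.

Fact eval_at_linear : linear eval_at.
Proof.
move=> c q r; rewrite -(preprK q) -(preprK r) -pclassZ -pclassD.
by rewrite !eval_atE /= mulr_algl.
Qed.
HB.instance Definition _ :=
  GRing.isLinear.Build F coord_alg R *:%R eval_at eval_at_linear.

Fact eval_at_monoid : monoid_morphism eval_at.
Proof.
split; first by rewrite -pclass1 eval_atE /= scale1r.
move=> q r; rewrite -(preprK q) -(preprK r) -pclassM.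
by rewrite !eval_atE.
Qed.
HB.instance Definition _ :=
  GRing.isMonoidMorphism.Build coord_alg R eval_at eval_at_monoid.

Definition eval_mor : {lrmorphism coord_alg -> R} := eval_at.

End EvalAt.

(** The universal point has the classes of the variables as coordinates: an expression vanishing at
    all points has class zero, so [co_closed] applies. Every element is the value of an expression
    at this point, hence the uniqueness of morphisms. *)
Lemma coord_represents : exists u : G coord_alg,
  represents u /\ forall p, ev u p = pval p.
Proof.
have [u uE] : exists u : G coord_alg, co C u =1 fun i => pval (PVar i).
  apply: co_closed => p p0; rewrite peval_pval -pclass0.
  by apply/pclassP => S g; rewrite p0 /= scale0r.
have uP p : ev u p = pval p by rewrite (eq_peval p uE) peval_pval.
exists u; split=> // R x; exists (eval_mor x).
  by apply: (co_inj (c := C)) => i; rewrite co_map uE /= eval_atE.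
move=> f fu q; have [p ->] := pval_surj q; rewrite [RHS]eval_atE -uP.
by rewrite -peval_co_map fu.
Qed.

Lemma coordinates_affine : affine_group_scheme G.
Proof. by have [u [ru _]] := coord_represents; exists coord_alg, u. Qed.

End Represent.

(** * Closed images and quotients by kernels *)

Section Image.
Variables (G H : groupFunctor F) (th : gmor G H).
Variables (CG : coordinates G) (C : coordinates H).
Local Notation E := (pexp (cidx C)).
Local Notation ev h p := (peval (co C h) p).

Hypothesis comul : forall i, exists l : seq (E * E),
  forall (R : comAlgType F) (x y : H R),
    co C (x * y)%g i = \sum_(p <- l) ev x p.1 * ev y p.2.
Hypothesis coinv : forall i, exists p : E,
  forall (R : comAlgType F) (x : H R), co C (x^-1)%g i = ev x p.

(** Sums of products with separated arguments are stable under products; in this form a functional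
    can be applied to one argument at a time. *)
Lemma comul_exp p : exists l : seq (E * E),
  forall (R : comAlgType F) (x y : H R),
    ev (x * y)%g p = \sum_(q <- l) ev x q.1 * ev y q.2.
Proof.
elim: p => [i|c|p [l lE] q [m mE]|p [l lE] q [m mE]].
- exact: comul.
- by exists [:: (PConst _ c, PConst _ 1)] => R x y /=; rewrite big_seq1 /= scale1r mulr1.
- by exists (l ++ m) => R x y /=; rewrite lE mE big_cat.
- exists [seq (PMul a.1 b.1, PMul a.2 b.2) | a <- l, b <- m] => R x y /=.
  rewrite lE mE big_allpairs_dep mulr_suml; apply: eq_bigr => a _.
  by rewrite mulr_sumr; apply: eq_bigr => b _ /=; rewrite mulrACA.
Qed.

Lemma coinv_exp p : exists q : E,
  forall (R : comAlgType F) (x : H R), ev (x^-1)%g p = ev x q.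
Proof.
elim: p => [i|c|p [l lE] q [m mE]|p [l lE] q [m mE]].
- exact: coinv.
- by exists (PConst _ c).
- by exists (PAdd l m) => R x /=; rewrite lE mE.
- by exists (PMul l m) => R x /=; rewrite lE mE.
Qed.

Lemma gm1 R : th R 1%g = 1%g.
Proof. by apply: (mulgI (th R 1%g)); rewrite -gmM !mulg1. Qed.

Lemma gmV R x : th R (x^-1)%g = ((th R x)^-1)%g.
Proof. by apply: (mulgI (th R x)); rewrite -gmM !mulgV gm1. Qed.

Definition img_vanishes (p : E) :=
  forall (S : comAlgType F) (g : G S), ev (th S g) p = 0.

Definition in_image (R : comAlgType F) (h : H R) :=
  forall p, img_vanishes p -> ev h p = 0.

Lemma in_image_th R g : in_image (th R g).
Proof. by move=> p; apply. Qed.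

Lemma in_image1 R : in_image (1%g : H R).
Proof. by rewrite -(gm1 R); apply: in_image_th. Qed.

Lemma in_imageV R (h : H R) : in_image h -> in_image (h^-1)%g.
Proof.
move=> hQ p p0; have [q qE] := coinv_exp p.
by rewrite qE; apply: hQ => S g; rewrite -qE -gmV p0.
Qed.

Lemma in_image_map (R S : comAlgType F) (g : {lrmorphism R -> S}) (h : H R) :
  in_image h -> in_image (Defs.pmap g h).
Proof. by move=> hQ p p0; rewrite peval_co_map hQ ?rmorph0. Qed.

Lemma peval_bigsum (R : comAlgType F) (h : H R) (l : seq E) :
  ev h (foldr (@PAdd _) (PConst _ 0) l) = \sum_(p <- l) ev h p.
Proof.
elim: l => [|p l IH]; first by rewrite big_nil /= scale0r.
by rewrite big_cons -IH.
Qed.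

(* Each tensor factor is handled separately: a functional on one factor turns
   the comultiplication of p into a polynomial in the other factor. *)
Lemma in_imageM R (h1 h2 : H R) :
  in_image h1 -> in_image h2 -> in_image (h1 * h2)%g.
Proof.
move=> h1Q h2Q p p0; have [l lE] := comul_exp p.
have step1 (S : comAlgType F) (g : G S) (e : S -> F) :
    linear (e : S -> F^o) ->
    \sum_(q <- l) e (ev (th S g) q.1) *: ev h2 q.2 = 0.
  move=> el.
  have := h2Q (foldr (@PAdd _) (PConst _ 0)
    [seq PMul (PConst _ (e (ev (th S g) q.1))) q.2 | q <- l]).
  rewrite peval_bigsum big_map; under eq_bigr => q _ do rewrite /= mulr_algl.
  apply=> T g'; rewrite peval_bigsum big_map.
  under eq_bigr => q _ do rewrite /= mulr_algl.
  have := @tensor_slice F S T e [seq (ev (th S g) q.1, ev (th T g') q.2) | q <- l] el.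
  rewrite !big_map /=; apply.
  (* The two points are multiplied over the tensor product of S and T, where [p] vanishes at the
     image of the result; [tensor_slice] then takes the factors apart. *)
  pose gg := (Defs.pmap (@tensl F S T : {lrmorphism S -> tensor S T}) g *
    Defs.pmap (@tensr F S T : {lrmorphism T -> tensor S T}) g')%g.
  rewrite -[RHS](p0 _ gg) /gg gmM lE !gm_nat.
  by apply: eq_bigr => q _; rewrite !peval_co_map.
(* The roles are exchanged: a functional applied to the values at [h2] leaves an expression in the
   other factor. By [step1] it vanishes on the image, so it can be evaluated at [h1]. *)
have step2 (e : R -> F) : linear (e : R -> F^o) ->
    \sum_(q <- l) e (ev h2 q.2) *: ev h1 q.1 = 0.
  move=> el.
  have := h1Q (foldr (@PAdd _) (PConst _ 0)
    [seq PMul (PConst _ (e (ev h2 q.2))) q.1 | q <- l]).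
  rewrite peval_bigsum big_map; under eq_bigr => q _ do rewrite /= mulr_algl.
  apply=> S g; rewrite peval_bigsum big_map.
  under eq_bigr => q _ do rewrite /= mulrC.
  have := @functionals_separate F S
    [seq (ev (th S g) q.1, (e (ev h2 q.2))%:A) | q <- l].
  rewrite !big_map /=; apply=> e' el'; rewrite big_map /=.
  have := step1 S g e' el' => /(congr1 e).
  have e0 : e 0 = 0 by have := el (-1) 0 0; rewrite scaler0 addr0 scaleN1r addNr.
  have -> : e (\sum_(q <- l) e' (ev (th S g) q.1) *: ev h2 q.2) =
    \sum_(q <- l) e' (ev (th S g) q.1) * e (ev h2 q.2).
    elim: l {lE step1} => [|q l IH]; first by rewrite !big_nil.
    by rewrite !big_cons el IH.
  rewrite e0 => s0; under eq_bigr => q _ do rewrite scalerA.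
  by rewrite -scaler_suml s0 scale0r.
rewrite lE; have := @functionals_separate F R [seq (ev h2 q.2, ev h1 q.1) | q <- l].
rewrite !big_map /= => sep; under eq_bigr => q _ do rewrite mulrC.
by apply: sep => e el; rewrite big_map; apply: step2.
Qed.

Section Points.
Variable R : comAlgType F.

Record img_pts := ImgPts { img_val : H R; _ : `[< in_image img_val >] }.

HB.instance Definition _ := [isSub for img_val].
HB.instance Definition _ := [Choice of img_pts by <:].

Lemma img_ptsP (x : img_pts) : in_image (img_val x).
Proof. by apply/asboolP; case: x. Qed.

Definition img_one := ImgPts (asboolT (@in_image1 R)).
Definition img_mul (x y : img_pts) :=
  ImgPts (asboolT (in_imageM (img_ptsP x) (img_ptsP y))).
Definition img_inv (x : img_pts) := ImgPts (asboolT (in_imageV (img_ptsP x))).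

Fact img_mulA : associative img_mul.
Proof. by move=> x y z; apply/val_inj/mulgA. Qed.
Fact img_mul1 : left_id img_one img_mul.
Proof. by move=> x; apply/val_inj/mul1g. Qed.
Fact img_1mul : right_id img_one img_mul.
Proof. by move=> x; apply/val_inj/mulg1. Qed.
Fact img_mulV : left_inverse img_one img_inv img_mul.
Proof. by move=> x; apply/val_inj/mulVg. Qed.
Fact img_Vmul : right_inverse img_one img_inv img_mul.
Proof. by move=> x; apply/val_inj/mulgV. Qed.

HB.instance Definition _ :=
  isGroup.Build img_pts img_mulA img_mul1 img_1mul img_mulV img_Vmul.

End Points.

Definition img_map (R S : comAlgType F) (g : {lrmorphism R -> S})
  (x : img_pts R) : img_pts S := ImgPts (asboolT (in_image_map g (img_ptsP x))).

Fact img_mapM (R S : comAlgType F) (g : {lrmorphism R -> S}) (x y : img_pts R) :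
  img_map g (x * y)%g = (img_map g x * img_map g y)%g.
Proof. by apply/val_inj/pmapM. Qed.
Fact img_map_id (R : comAlgType F) (g : {lrmorphism R -> R}) :
  g =1 id -> img_map g =1 id.
Proof. by move=> gid x; apply/val_inj; rewrite /= pmap_id. Qed.
Fact img_map_comp (R S T : comAlgType F) (g : {lrmorphism R -> S})
    (h : {lrmorphism S -> T}) (k : {lrmorphism R -> T}) :
  k =1 h \o g -> img_map k =1 img_map h \o img_map g.
Proof. by move=> kE x; apply/val_inj; rewrite /= (pmap_comp kE). Qed.

Definition img_scheme : groupFunctor F := @GroupFunctor F
  (fun R => img_pts R : groupType) img_map img_mapM img_map_id img_map_comp.

Definition img_proj : gmor G img_scheme.
Proof.
refine (@Gmor F G img_scheme
  (fun R g => ImgPts (asboolT (@in_image_th R g))) _ _).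
- by move=> R x y; apply/val_inj/gmM.
- by move=> R S g x; apply/val_inj/gm_nat.
Defined.

Definition img_incl : gmor img_scheme H.
Proof. by refine (@Gmor F img_scheme H img_val _ _). Defined.

Definition img_coordinates : coordinates img_scheme.
Proof.
refine (@Coordinates img_scheme (cidx C) (fun R x => co C (img_val x)) _ _ _).
- by move=> R S g x i; rewrite /= co_map.
- by move=> R x y xy; apply/val_inj; apply: (co_inj (c := C)).
- move=> R x x0; have [|h hx] := @co_closed H C R x.
    by move=> p p0; apply: x0 => S g; apply: p0.
  suff hQ : in_image h by exists (ImgPts (asboolT hQ)).
  move=> p p0; rewrite (eq_peval p hx); apply: x0 => S g.
  exact: img_ptsP.
Defined.

(** The inclusion has an onto comorphism since the image uses the coordinates of H. For the
    projection, an expression vanishing at the universal point of G vanishes at all points of G,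
    hence on the image by definition. *)
Lemma gker_quotient_embeds (N : forall R : comAlgType F, G R -> Prop) :
  (forall R g, gker th g <-> N R g) -> quotient_embeds N H.
Proof.
move=> kerN; exists img_scheme, img_proj, img_incl.
have [u [ru _]] := coord_represents CG.
have [w [rw wE]] := coord_represents img_coordinates.
have [v [rv vE]] := coord_represents C.
split; first split.
- have [f fw _] := rw _ (img_proj _ u).
  exists (coord_alg CG), u, (coord_alg img_coordinates), w, f; split=> //.
  apply: lrmorphism_inj => q; have [p ->] := pval_surj q.
  have fE : f (pval p) = ev (th _ u) p.
    rewrite -wE; apply: etrans (esym (@peval_co_map _ img_coordinates _ _ f w p)) _.
    by rewrite fw.
  rewrite fE -wE => q0; apply: (img_ptsP w) => S g.
  have [h <- _] := ru S g.
  by rewrite gm_nat peval_co_map q0 rmorph0.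
- move=> R g; rewrite -kerN /gker /=; split=> [[->]//|g1].
  by apply/val_inj.
- have [f fv _] := rv _ (img_incl _ w).
  exists (coord_alg img_coordinates), w, (coord_alg C), v, f; split=> // a.
  have [p ->] := pval_surj a; exists (pval (C := C) p).
  rewrite -vE -wE.
  by apply: etrans (esym (@peval_co_map _ C _ _ f v p)) _; rewrite fv.
Qed.

End Image.
End Expressions.

(** * The automorphism group scheme *)

Section PolynomialFunctions.
Variables (F : fieldType) (N : Type).

Definition polyfun (e : forall R : comAlgType F, (N -> R) -> R) :=
  exists p : pexp F N, forall R x, e R x = peval x p.

Lemma polyfun_var i : polyfun (fun R x => x i).
Proof. by exists (PVar F i). Qed.

Lemma polyfun_const c : polyfun (fun R x => c%:A).
Proof. by exists (PConst N c). Qed.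

Lemma polyfun_mul e e' : polyfun e -> polyfun e' ->
  polyfun (fun R x => e R x * e' R x).
Proof. by move=> [p pE] [q qE]; exists (PMul p q) => R x; rewrite pE qE. Qed.

Lemma polyfun_sum (I : finType) (e : I -> forall R : comAlgType F, (N -> R) -> R) :
  (forall i, polyfun (e i)) -> polyfun (fun R x => \sum_i e i R x).
Proof.
move=> eP; suff [p pE] : polyfun (fun R x => \sum_(i <- enum I) e i R x).
  by exists p => R x; rewrite -pE big_enum.
elim: (enum I) => [|i r [p pE]].
  by exists (PConst N 0) => R x; rewrite big_nil /= scale0r.
have [q qE] := eP i.
by exists (PAdd q p) => R x; rewrite big_cons pE qE.
Qed.

End PolynomialFunctions.

Lemma gpmap1 (F : fieldType) (G : groupFunctor F) (R S : comAlgType F)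
    (g : {lrmorphism R -> S}) : Defs.pmap g (1%g : G R) = 1%g.
Proof. by apply: (mulgI (Defs.pmap g (1%g : G R))); rewrite -pmapM !mulg1. Qed.

Lemma gpmapV (F : fieldType) (G : groupFunctor F) (R S : comAlgType F)
    (g : {lrmorphism R -> S}) (x : G R) :
  Defs.pmap g (x^-1)%g = ((Defs.pmap g x)^-1)%g.
Proof. by apply: (mulgI (Defs.pmap g x)); rewrite -pmapM !mulgV gpmap1. Qed.

Section AutCoordinates.
Variables (F : fieldType) (V : superpair F).
Local Notation G := (Aut_scheme V).

(** On basis vectors the conditions become finitely many polynomial equations in the entries. *)
Lemma is_autR_basis (R : comAlgType F) (A : mxpair R V) :
  (forall s, exists B : 'M[R]_(hdim (V s)),
    mxcomp A s *m B = 1%:M /\ B *m mxcomp A s = 1%:M) ->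
  (forall s i j, hpar i != hpar j -> mxcomp A s i j = 0) ->
  (forall s i j k,
    tripR (col i (mxcomp A s)) (col j (mxcomp A (~~ s))) (col k (mxcomp A s)) =
    mxcomp A s *m ext1 R (trip (hb i) (hb j) (hb k))) ->
  (forall i j, formR (col i A.1) (col j A.2) = (spform (hb i) (hb j))%:A) ->
  is_autR A.
Proof.
move=> Ab Ae At Af; split=> // [s u v w|u v].
  rewrite (mul_cV_expand _ u) (mul_cV_expand _ v) (mul_cV_expand _ w).
  rewrite tripR_expand [in RHS]/tripR mulmx_sumr; apply: eq_bigr => i _.
  rewrite mulmx_sumr; apply: eq_bigr => j _.
  rewrite mulmx_sumr; apply: eq_bigr => k _.
  by rewrite -scalemxAr At.
rewrite (mul_cV_expand _ u) (mul_cV_expand _ v) formR_expand.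
by apply: eq_bigr => i _; apply: eq_bigr => j _; rewrite Af.
Qed.

Lemma autR_trip_basis (R : comAlgType F) (A : mxpair R V) s i j k : is_autR A ->
  tripR (col i (mxcomp A s)) (col j (mxcomp A (~~ s))) (col k (mxcomp A s)) =
  mxcomp A s *m ext1 R (trip (hb i) (hb j) (hb k)).
Proof. by case=> _ _ At _; rewrite !colE At tripR_delta. Qed.

Lemma autR_form_basis (R : comAlgType F) (A : mxpair R V) i j : is_autR A ->
  formR (col i A.1) (col j A.2) = (spform (hb i) (hb j))%:A.
Proof. by case=> _ _ _ Af; rewrite !colE Af formR_delta. Qed.

(* The boolean distinguishes the entries of the inverse from those of the
   automorphism itself. *)
Definition autidx : Type := {s : bool & 'I_(hdim (V s)) * 'I_(hdim (V s)) * bool}%type.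

Definition autco (R : comAlgType F) (x : G R) (t : autidx) : R :=
  aut_comp (if (tagged t).2 then x^-1%g else x) (tag t) (tagged t).1.1 (tagged t).1.2.

Definition entry s b i j : autidx :=
  Tagged (fun s : bool => 'I_(hdim (V s)) * 'I_(hdim (V s)) * bool)%type
    (i : 'I_(hdim (V s)), j : 'I_(hdim (V s)), b).

Arguments entry s b i j : clear implicits.

Lemma autco_entry (R : comAlgType F) (x : G R) s b i j :
  autco x (entry s b i j) = aut_comp (if b then x^-1%g else x) s i j.
Proof. by []. Qed.

Definition autco_mx (R : comAlgType F) (x : autidx -> R) s b : 'M[R]_(hdim (V s)) :=
  \matrix_(i, j) x (entry s b i j).

Lemma autco_mxE (R : comAlgType F) (x : G R) s b :
  autco_mx (autco x) s b = aut_comp (if b then x^-1%g else x) s.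
Proof. by apply/matrixP => i j; rewrite mxE. Qed.

Lemma aut_compM (R : comAlgType F) (x y : G R) s :
  aut_comp (x * y)%g s = aut_comp x s *m aut_comp y s.
Proof. exact: mulpairE. Qed.

Lemma aut_comp1 (R : comAlgType F) s : aut_comp (1%g : G R) s = 1%:M.
Proof. by case: s. Qed.

Lemma aut_comp_map (R S : comAlgType F) (g : {lrmorphism R -> S}) (x : G R) s :
  aut_comp (Defs.pmap g x) s = map_mx g (aut_comp x s).
Proof. exact: mappairE. Qed.

Lemma aut_comp_inj (R : comAlgType F) (x y : G R) :
  (forall s, aut_comp x s = aut_comp y s) -> x = y.
Proof.
move=> xy; apply/val_inj; rewrite /= (surjective_pairing (aut_mx x)).
by rewrite (surjective_pairing (aut_mx y)); have := (xy false, xy true) => -[/= -> ->].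
Qed.

Section Closed.
Variables (R : comAlgType F) (x : autidx -> R).
Hypothesis x0 : forall p, (forall (S : comAlgType F) (g : G S),
  peval (autco g) p = 0) -> peval x p = 0.

(** Stated for functions, so that the equations of an automorphism pass to [x] without being written
    as terms of [pexp]. *)
Lemma polyfun_closed e e' : polyfun e -> polyfun e' ->
  (forall (S : comAlgType F) (g : G S), e S (autco g) = e' S (autco g)) ->
  e R x = e' R x.
Proof.
move=> [p pE] [q qE] ee'; apply/eqP; rewrite -subr_eq0 pE qE.
have := @x0 (PAdd p (PMul (PConst _ (-1)) q)).
rewrite /= scaleN1r mulN1r => -> // S g.
by rewrite scaleN1r mulN1r -pE -qE ee' subrr.
Qed.

Lemma autco_mx_mul s b : autco_mx x s b *m autco_mx x s (~~ b) = 1%:M.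
Proof.
apply/matrixP => i j; rewrite !mxE -scaler_nat.
pose e (R : comAlgType F) (x : autidx -> R) :=
  \sum_k x (entry s b i k) * x (entry s (~~ b) k j).
transitivity (e R x); first by apply: eq_bigr => k _; rewrite !mxE.
have -> : (i == j)%:R *: 1 = (i == j)%:R%:A :> R by rewrite !scaler_nat.
apply: (polyfun_closed (e' := fun R x => (i == j)%:R%:A)) => [||S g].
- apply: polyfun_sum => k; apply: polyfun_mul; exact: polyfun_var.
- exact: polyfun_const.
- rewrite /e scaler_nat; under eq_bigr => k _ do rewrite !autco_entry.
  have : aut_comp (if b then g^-1%g else g) s *m
      aut_comp (if ~~ b then g^-1%g else g) s = 1%:M.
    by case: (b) => /=; rewrite -aut_compM ?mulgV ?mulVg aut_comp1.
  by move/matrixP/(_ i j); rewrite !mxE.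
Qed.

Definition autco_pair : mxpair R V := (autco_mx x false false, autco_mx x true false).

Lemma autco_pairE s : mxcomp autco_pair s = autco_mx x s false.
Proof. by case: s. Qed.

Lemma autco_pair_aut : is_autR autco_pair.
Proof.
have trE (S : comAlgType F) (y : autidx -> S) s i j k l :
  tripR (col i (autco_mx y s false)) (col j (autco_mx y (~~ s) false))
    (col k (autco_mx y s false)) l 0 =
  \sum_i' \sum_j' \sum_k' y (entry s false i' i) * y (entry (~~ s) false j' j) *
    y (entry s false k' k) * (hcoord l (trip (hb i') (hb j') (hb k')))%:A.
  rewrite /tripR summxE; apply: eq_bigr => i' _; rewrite summxE.
  apply: eq_bigr => j' _; rewrite summxE; apply: eq_bigr => k' _.
  by rewrite !mxE.
have muE (S : comAlgType F) (y : autidx -> S) s w l :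
  (autco_mx y s false *m ext1 S w) l 0 =
  \sum_m y (entry s false l m) * (hcoord m w)%:A.
  by rewrite mxE; apply: eq_bigr => m _; rewrite !mxE.
have foE (S : comAlgType F) (y : autidx -> S) i j :
  formR (col i (autco_mx y false false)) (col j (autco_mx y true false)) =
  \sum_i' \sum_j' y (entry false false i' i) * y (entry true false j' j) *
    (spform (hb i') (hb j'))%:A.
  by apply: eq_bigr => i' _; apply: eq_bigr => j' _; rewrite !mxE.
apply: is_autR_basis => [s|s i j ij|s i j k|i j].
- exists (autco_mx x s true); rewrite autco_pairE.
  by split; [exact: (autco_mx_mul s false)|exact: (autco_mx_mul s true)].
- rewrite autco_pairE mxE.
  transitivity ((0 : F)%:A : R); last by rewrite scale0r.
  apply: (polyfun_closed (e := fun R x => x (entry s false i j))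
    (e' := fun R x => 0%:A)) => [||S g].
  + exact: polyfun_var.
  + exact: polyfun_const.
  + by rewrite scale0r autco_entry; apply: autR_even (autRP g) _ _ _ ij.
- rewrite !autco_pairE; apply/matrixP => l z; rewrite ord1 trE muE.
  apply: (polyfun_closed (e := fun R x => \sum_i' \sum_j' \sum_k'
      x (entry s false i' i) * x (entry (~~ s) false j' j) *
      x (entry s false k' k) * (hcoord l (trip (hb i') (hb j') (hb k')))%:A)
    (e' := fun R x => \sum_m x (entry s false l m) * (hcoord m _)%:A)) => [||S g].
  + do 3 (apply: polyfun_sum => ?).
    by repeat apply: polyfun_mul; do ?[exact: polyfun_var|exact: polyfun_const].
  + apply: polyfun_sum => ?.
    by repeat apply: polyfun_mul; do ?[exact: polyfun_var|exact: polyfun_const].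
  + rewrite -trE -muE !autco_mxE.
    by rewrite (autR_trip_basis i j k (autRP g)).
- rewrite foE.
  apply: (polyfun_closed (e := fun R x => \sum_i' \sum_j'
    x (entry false false i' i) * x (entry true false j' j) *
    (spform (hb i') (hb j'))%:A)
    (e' := fun R x => (spform (hb i) (hb j))%:A)) => [||S g].
  + do 2 (apply: polyfun_sum => ?).
    by repeat apply: polyfun_mul; do ?[exact: polyfun_var|exact: polyfun_const].
  + exact: polyfun_const.
  + rewrite -foE !autco_mxE.
    by rewrite (autR_form_basis i j (autRP g)).
Qed.

Lemma autco_closed : exists g : G R, autco g =1 x.
Proof.
exists (AutR (asboolT autco_pair_aut)) => -[s [[i j] b]].
set g := AutR _; rewrite -/(entry s b i j) autco_entry.
have gE : aut_comp g s = autco_mx x s false by apply: autco_pairE.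
have -> : x (entry s b i j) = autco_mx x s b i j by rewrite mxE.
case: b => /=; last by rewrite gE.
(* The coordinates listed as inverse entries form an inverse matrix, and inverses are unique. *)
have : aut_comp (g^-1 : G R)%g s *m autco_mx x s false = 1%:M.
  by rewrite -gE -aut_compM mulVg aut_comp1.
move/(congr1 (fun B => B *m autco_mx x s true)).
by rewrite -mulmxA (autco_mx_mul s false) mulmx1 mul1mx => ->.
Qed.

End Closed.

Definition aut_coordinates : coordinates G.
Proof.
refine (@Coordinates F G autidx autco _ _ _).
- move=> R S g x [s [[i j] b]]; rewrite -/(entry s b i j) !autco_entry.
  by case: b; rewrite -?gpmapV aut_comp_map mxE.
- move=> R x y xy; apply: aut_comp_inj => s; apply/matrixP => i j.
  exact: (xy (entry s false i j)).
- exact: autco_closed.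
Defined.

Lemma Aut_scheme_affine : affine_group_scheme G.
Proof. exact: coordinates_affine aut_coordinates. Qed.

Lemma Aut_quotient_embeds (G' : groupFunctor F) (CG' : coordinates G')
    (th : gmor G' G) (N : forall R : comAlgType F, G' R -> Prop) :
  (forall R g, gker th g <-> N R g) -> quotient_embeds N G.
Proof.
apply: (gker_quotient_embeds CG' (C := aut_coordinates)) => -[s [[i j] b]].
  case: b.
    (* The inverse of x y is y^-1 x^-1, hence the order of the indices. *)
    exists [seq (PVar F (entry s true k j), PVar F (entry s true i k))
           | k <- enum 'I_(hdim (V s))] => R x y.
    rewrite big_map big_enum /= -/(entry s true i j) autco_entry invMg aut_compM mxE.
    by apply: eq_bigr => k _; rewrite mulrC.
  exists [seq (PVar F (entry s false i k), PVar F (entry s false k j))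
         | k <- enum 'I_(hdim (V s))] => R x y.
  by rewrite big_map big_enum /= -/(entry s false i j) autco_entry aut_compM mxE.
exists (PVar F (entry s (~~ b) i j)) => R x /=.
by rewrite -/(entry s b i j) !autco_entry; case: b; rewrite ?invgK.
Qed.

End AutCoordinates.

(** * Superpowers of automorphisms *)

Section Multilinear.
Variables (R : comPzRingType) (U W : lmodType R).

Definition multilinear n (f : ('I_n -> U) -> W) :=
  forall i v, linear (fun x => f (upd i x v)).

Lemma multilinear_expand n (f : ('I_n -> U) -> W) (K : finType)
    (c : 'I_n -> K -> R) (h : 'I_n -> K -> U) : multilinear f ->
  f (fun i => \sum_k c i k *: h i k) =
  \sum_(g : {ffun 'I_n -> K}) (\prod_i c i (g i)) *: f (fun i => h i (g i)).
Proof.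
elim: n f c h => [|n IH] f c h f_lin.
  rewrite (big_pred1 [ffun i : 'I_0 => False_rect K (notF (ltn_ord i))]) => [|g].
    by rewrite big_ord0 scale1r; congr f; apply: funext => -[].
  by apply/esym/eqP/ffunP => -[].
pose cons (x : U) (v : 'I_n -> U) (k : 'I_n.+1) :=
  if unlift ord0 k is Some j then v j else x.
have consE (v : 'I_n.+1 -> U) : v = cons (v ord0) (fun j => v (lift ord0 j)).
  by apply: funext => k; rewrite /cons; case: unliftP => [j ->|->].
have cons_upd x y v : cons x v = upd ord0 x (cons y v).
  apply: funext => k; rewrite /cons /upd.
  by case: unliftP => [j ->|->]; rewrite ?eqxx // eq_sym (negPf (neq_lift _ _)).
have lin0 v : linear (fun x => f (cons x v)).
  by move=> d x y; rewrite (cons_upd _ 0) (cons_upd x 0) (cons_upd y 0) f_lin.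
have mlin x : multilinear (fun v => f (cons x v)).
  move=> i v d y z.
  have E y' : cons x (upd i y' v) = upd (lift ord0 i) y' (cons x v).
    apply: funext => k; rewrite /cons /upd; case: unliftP => [l ->|->].
      by rewrite (inj_eq lift_inj).
    by rewrite (negPf (neq_lift _ _)).
  by rewrite !E f_lin.
rewrite (consE (fun i => _)) (linear_expand _ _ (lin0 _)).
under eq_bigr => k _ do rewrite (IH _ _ _ (mlin _)) scaler_sumr.
rewrite pair_bigA /=.
pose to (g : {ffun 'I_n.+1 -> K}) := (g ord0, [ffun i => g (lift ord0 i)]).
pose from (p : K * {ffun 'I_n -> K}) :=
  [ffun k => if unlift ord0 k is Some j then p.2 j else p.1].
have toK : cancel to from.
  by move=> g; apply/ffunP => k; rewrite ffunE; case: unliftP => [j ->|->]; rewrite ?ffunE.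
have fromK : cancel from to.
  move=> [k g]; congr pair; first by rewrite ffunE unlift_none.
  by apply/ffunP => i; rewrite !ffunE liftK.
rewrite (reindex to) /=; last by exists from => g _.
apply: eq_bigr => g _; rewrite big_ord_recl scalerA; congr (_ * _ *: _).
  by apply: eq_bigr => i _; rewrite ffunE.
rewrite (consE (fun i => h i (g i))); congr (f (cons _ _)).
by apply: funext => i; rewrite ffunE.
Qed.

Lemma upd_same n i x (v : 'I_n -> U) : upd i x v i = x.
Proof. by rewrite /upd eqxx. Qed.

Lemma upd_other n i j x (v : 'I_n -> U) : j != i -> upd i x v j = v j.
Proof. by rewrite /upd => /negPf ->. Qed.

Lemma upd_upd n i x y (v : 'I_n -> U) : upd i x (upd i y v) = upd i x v.
Proof. by apply: funext => j; rewrite /upd; case: eqP. Qed.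

Lemma updC n i j x y (v : 'I_n -> U) : i != j ->
  upd i x (upd j y v) = upd j y (upd i x v).
Proof.
move=> ij; apply: funext => k; rewrite /upd; case: (k =P i) => // ->.
by rewrite (negPf ij).
Qed.

Lemma linear_sumr (I : finType) (f : I -> U -> W) (P : pred I) :
  (forall i, P i -> linear (f i)) -> linear (fun x => \sum_(i | P i) f i x).
Proof.
move=> fl c x y; rewrite scaler_sumr -big_split; apply: eq_bigr => i Pi.
exact: fl.
Qed.

Lemma linear_scaler (f : U -> W) (d : R) : linear f -> linear (fun x => d *: f x).
Proof. by move=> fl c x y; rewrite fl scalerDr !scalerA (mulrC d). Qed.

Lemma linear_scalel (g : U -> R) (w : W) :
  linear (g : U -> R^o) -> linear (fun x => g x *: w).
Proof.
by move=> gl c x y; rewrite gl scalerDl -scalerA.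
Qed.

End Multilinear.

Lemma multilinear_prod (R : comPzRingType) (U : lmodType R) n (P : pred 'I_n)
    (g : 'I_n -> U -> R) (v : 'I_n -> U) m :
  (forall i, linear (g i : U -> R^o)) -> P m ->
  linear (fun x => \prod_(i | P i) g i (upd m x v i) : R^o).
Proof.
move=> gl Pm c x y; have E z : \prod_(i | P i) g i (upd m z v i) =
    g m z * \prod_(i | P i && (i != m)) g i (v i).
  rewrite (bigD1 m) //= upd_same; congr (_ * _).
  by apply: eq_bigr => i /andP[_ im]; rewrite upd_other.
by rewrite !E gl mulrDl /GRing.scale /= mulrA.
Qed.

Lemma prod_upd_const (R : comPzRingType) (U : Type) n (P : pred 'I_n)
    (g : 'I_n -> U -> R) (v : 'I_n -> U) m x :
  ~~ P m -> \prod_(i | P i) g i (upd m x v i) = \prod_(i | P i) g i (v i).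
Proof.
move=> Pm; apply: eq_bigr => i Pi; rewrite /upd; case: eqP => // im.
by rewrite -im Pi in Pm.
Qed.

Section Ext.
Variables (F : fieldType) (R : comAlgType F) (M : superspace F).

Lemma ext1Z c (v : M) : ext1 R (c *: v) = c%:A *: ext1 R v.
Proof.
by apply/matrixP => k l; rewrite !mxE linearZ /= mulr_algl scalerA.
Qed.

Lemma ext1_sum (I : finType) (c : I -> F) (v : I -> M) :
  ext1 R (\sum_i c i *: v i) = \sum_i (c i)%:A *: ext1 R (v i).
Proof.
apply/matrixP => k l; rewrite !mxE summxE linear_sum scaler_suml.
by apply: eq_bigr => i _; rewrite !mxE linearZ /= mulr_algl scalerA.
Qed.

Lemma ext1_bigsum (I : finType) (v : I -> M) :
  ext1 R (\sum_i v i) = \sum_i ext1 R (v i).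
Proof.
apply/matrixP => k l; rewrite !mxE summxE linear_sum scaler_suml.
by apply: eq_bigr => i _; rewrite !mxE.
Qed.

Lemma ext1_hb k : ext1 R (hb k : M) = delta_mx k 0.
Proof.
apply/matrixP => i j; rewrite !mxE hcoord_hb ord1 eqxx andbT.
by rewrite scaler_nat.
Qed.

Lemma cV_sum (x : 'cV[R]_(hdim M)) : x = \sum_k x k 0 *: ext1 R (hb k : M).
Proof.
apply/matrixP => i j; rewrite ord1 summxE (bigD1 i) //= ext1_hb !mxE !eqxx mulr1.
by rewrite big1 ?addr0 // => k ki; rewrite ext1_hb !mxE eq_sym (negPf ki) mulr0.
Qed.

Definition homR (a : bool) (x : 'cV[R]_(hdim M)) :=
  forall k, hpar k != a -> x k 0 = 0.

Lemma homR_ext1 a (v : M) : v \in gr M a -> homR a (ext1 R v).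
Proof. by move=> va k ka; rewrite mxE (hcoord_gr va ka) scale0r. Qed.

Definition evenmx (A : 'M[R]_(hdim M)) :=
  forall i j, hpar i != hpar j -> A i j = 0.

Lemma homR_mul a (A : 'M[R]_(hdim M)) x :
  evenmx A -> homR a x -> homR a (A *m x).
Proof.
move=> Ae xa k ka; rewrite mxE big1 // => j _.
have [ja|ja] := eqVneq (hpar j) a; last by rewrite (xa j) ?mulr0.
by rewrite Ae ?mul0r // ja.
Qed.

End Ext.

Section Vee.
Variables (F : fieldType) (R : comAlgType F) (n : nat) (M : superspace F).
Local Notation tidx := (tidx n M).
Local Notation "''E_' t" := (ext1 R (vee (hbt t))) (at level 8, t at level 2).
Implicit Types (t u : tidx) (x : 'I_n -> 'cV[R]_(hdim M)).

Lemma veeRE x : veeR x = \sum_(t : tidx) (\prod_i x i (t i) 0) *: 'E_t.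
Proof. by []. Qed.

Lemma veeR_multilinear : multilinear (@veeR F R n M).
Proof.
move=> m v; apply: linear_sumr => t _; apply: linear_scalel.
apply: (multilinear_prod (g := fun i (y : 'cV[R]_(hdim M)) => y (t i) 0)) => // i c y z.
by rewrite !mxE.
Qed.

Lemma veeR_hbt t : veeR (fun i => ext1 R (hbt t i)) = 'E_t.
Proof.
rewrite veeRE (bigD1 t) //= big1 ?scale1r => [|i _]; last first.
  by rewrite mxE hcoord_hb eqxx scale1r.
rewrite big1 ?addr0 // => u ut.
have [i it] : exists i, u i != t i.
  by apply/existsP; rewrite -negb_forall; apply: contra ut => /eqfunP/ffunP ->.
by rewrite (bigD1 i) //= mxE hcoord_hb (negPf it) scale0r mul0r scale0r.
Qed.

Lemma E_sum (w : sympow n M) : ext1 R w = \sum_(t : tidx) (vsval w t)%:A *: 'E_t.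
Proof. by rewrite {1}(sympow_sum w) ext1_sum. Qed.

Lemma E_span (w : 'cV[R]_(hdim (sympow n M))) :
  exists c : tidx -> R, w = \sum_(t : tidx) c t *: 'E_t.
Proof.
exists (fun t => \sum_k w k 0 * (vsval (hb k : sympow n M) t)%:A).
rewrite {1}(cV_sum w); under eq_bigr => k _ do rewrite E_sum scaler_sumr.
rewrite exchange_big; apply: eq_bigr => t _; rewrite scaler_suml.
by apply: eq_bigr => k _; rewrite scalerA.
Qed.

Lemma eq_on_E m (A B : 'M[R]_(m, hdim (sympow n M))) :
  (forall t, A *m 'E_t = B *m 'E_t) -> A = B.
Proof.
move=> AB; apply/matrixP => i j.
suff : A *m delta_mx j 0 = B *m (delta_mx j 0 : 'cV_(hdim (sympow n M))).
  by rewrite -!colE => /matrixP/(_ i 0); rewrite !mxE.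
have [c ->] := E_span (delta_mx j 0); rewrite !mulmx_sumr.
by apply: eq_bigr => t _; rewrite -!scalemxAr AB.
Qed.

Lemma E_perm (s : 'S_n) t :
  'E_t = (ksgn F s (tpars t))%:A *: 'E_[ffun i => t (s^-1%g i)].
Proof.
rewrite (vee_perm s (hbt_gr t)) ext1Z; congr (_ *: ext1 _ _).
by apply: eq_vee => i; rewrite /hbt ffunE.
Qed.

Lemma prod_homR x a t : (forall i, homR (a i) (x i)) ->
  ~~ [forall i, tpars t i == a i] -> \prod_i x i (t i) 0 = 0.
Proof.
move=> xa; rewrite negb_forall => /existsP[i ti].
by rewrite (bigD1 i) //= (xa i) ?mul0r.
Qed.

Lemma veeR_perm (s : 'S_n) x a : (forall i, homR (a i) (x i)) ->
  veeR x = (ksgn F s a)%:A *: veeR (fun i => x (s^-1%g i)).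
Proof.
move=> xa; rewrite [in RHS]veeRE scaler_sumr.
rewrite (reindex (fun t : tidx => [ffun i => t (s^-1%g i)])) /=; last first.
  exists (fun t => [ffun i => t (s i)]) => t _; apply/ffunP => i;
  by rewrite !ffunE ?permK ?permKV.
apply: eq_bigr => t _; rewrite [ext1 R _ in LHS](E_perm s t).
rewrite (_ : \prod_i x (s^-1%g i) _ 0 = \prod_i x i (t i) 0); last first.
  rewrite [RHS](reindex_inj (@perm_inj _ s^-1%g)) /=.
  by apply: eq_bigr => i _; rewrite ffunE.
rewrite !scalerA; congr (_ *: _); rewrite mulrC.
have [/eqfunP ta|ta] := boolP [forall i, tpars t i == a i].
  by rewrite (eq_ksgn _ _ ta).
by rewrite (prod_homR xa ta) !mulr0.
Qed.

Lemma veeR_homR x a : (forall i, homR (a i) (x i)) ->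
  homR (\big[addb/false]_i a i) (veeR x).
Proof.
move=> xa k ka; rewrite veeRE summxE big1 // => t _; rewrite mxE.
have [/eqfunP ta|ta] := boolP [forall i, tpars t i == a i]; last first.
  by rewrite (prod_homR xa ta) mul0r.
rewrite (homR_ext1 R (vee_gr (hbt_gr t))) ?mulr0 //.
by rewrite (eq_bigr _ (fun i _ => ta i)).
Qed.

Lemma ext1_vee (v : 'I_n -> M) : ext1 R (vee v) = veeR (fun i => ext1 R (v i)).
Proof.
rewrite vee_expand ext1_sum veeRE; apply: eq_bigr => t _; congr (_ *: _).
by rewrite -(in_algE R) rmorph_prod /=; apply: eq_bigr => i _; rewrite mxE.
Qed.

End Vee.

Lemma map_veeR (F : fieldType) (R S : comAlgType F) (g : {lrmorphism R -> S}) n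
    (M : superspace F) (x : 'I_n -> 'cV[R]_(hdim M)) :
  map_mx g (veeR x) = veeR (fun i => map_mx g (x i)).
Proof.
rewrite /veeR raddf_sum; apply: eq_bigr => t _ /=.
rewrite map_mxZ map_ext1 rmorph_prod; congr (_ *: _).
by apply: eq_bigr => i _; rewrite mxE.
Qed.

Section Power.
Variables (F : fieldType) (R : comAlgType F) (n : nat) (M : superspace F).
Local Notation tidx := (tidx n M).
Local Notation "''E_' t" := (ext1 R (vee (hbt t))) (at level 8, t at level 2).
Implicit Types (A B : 'M[R]_(hdim M)).

(* Column l is the image of the l-th basis vector of the superpower, computed
   on the representative of that vector in the tensor power. *)
Definition vpow A : 'M[R]_(hdim (sympow n M)) :=
  \matrix_(k, l) (\sum_(t : tidx) (vsval (hb l : sympow n M) t)%:A *: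
    veeR (fun i => A *m ext1 R (hbt t i))) k 0.

(** An even matrix keeps the parities of the factors, so applying it factorwise commutes with S_n up
    to the same signs, and [ker_of_hb] removes the chosen representative. *)
Lemma vpow_E A t : evenmx A ->
  vpow A *m 'E_t = veeR (fun i => A *m ext1 R (hbt t i)).
Proof.
move=> Ae; apply/matrixP => k z; rewrite ord1 {z}.
pose T (u : tidx) : R := veeR (fun i => A *m ext1 R (hbt u i)) k 0.
pose L (x : tpow n M) : R := \sum_u x u *: T u.
have E w : (vpow A *m ext1 R w) k 0 = L (vsval w).
  rewrite /L {2}(hcoord_sum w) linear_sum mxE.
  under [RHS]eq_bigr => u _ do rewrite sum_ffunE scaler_suml.
  rewrite exchange_big; apply: eq_bigr => l _; rewrite !mxE summxE mulr_suml.
  apply: eq_bigr => u _; rewrite !mxE linearZ /= ffunE.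
  by rewrite mulr_algr mulr_algl scalerA.
have L_lin : linear L.
  move=> c x y; rewrite /L scaler_sumr -big_split; apply: eq_bigr => u _ /=.
  by rewrite !ffunE scalerDl scalerA.
rewrite E /vee (ker_of_hb L_lin) => [|s u]; first exact: sumT_hb.
rewrite tact_hb (linZ L_lin) /L !sumT_hb /T.
rewrite [in RHS](veeR_perm s (a := tpars u)) => [|i]; last first.
  by apply: homR_mul => //; apply: homR_ext1; apply: hbt_gr.
rewrite [in RHS]mxE mulr_algl; congr (_ *: (veeR _ k 0)).
by apply: funext => i; rewrite /hbt ffunE.
Qed.

Lemma vpow_veeR A (x : 'I_n -> 'cV[R]_(hdim M)) : evenmx A ->
  vpow A *m veeR x = veeR (fun i => A *m x i).
Proof.
move=> Ae; rewrite veeRE mulmx_sumr.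
have -> : (fun i => A *m x i) = (fun i => \sum_k x i k 0 *: (A *m ext1 R (hb k : M))).
  apply: funext => i; rewrite {1}(cV_sum (x i)) mulmx_sumr.
  by apply: eq_bigr => k _; rewrite scalemxAr.
rewrite (multilinear_expand _ _ (@veeR_multilinear F R n M)).
by apply: eq_bigr => t _; rewrite -scalemxAr vpow_E.
Qed.

Lemma vpowM A B : evenmx A -> evenmx B -> vpow A *m vpow B = vpow (A *m B).
Proof.
move=> Ae Be; have ABe : evenmx (A *m B).
  move=> i j ij; rewrite mxE big1 // => k _.
  have [e|e] := eqVneq (hpar i) (hpar k); last by rewrite Ae ?mul0r.
  by rewrite (Be k j) ?mulr0 // -e.
apply: (@eq_on_E F R n M) => t; rewrite -mulmxA !vpow_E // vpow_veeR //.
by congr veeR; apply: funext => i; rewrite mulmxA.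
Qed.

Lemma vpow1 : vpow 1%:M = 1%:M.
Proof.
have e1 : evenmx (1%:M : 'M[R]_(hdim M)).
  by move=> i j ij; rewrite mxE; case: eqP => // e; rewrite e eqxx in ij.
apply: (@eq_on_E F R n M) => t; rewrite vpow_E // mul1mx -[RHS]veeR_hbt.
by congr veeR; apply: funext => i; rewrite mul1mx.
Qed.

Lemma vpow_even A : evenmx A -> evenmx (vpow A).
Proof.
move=> Ae k l kl; have -> : vpow A k l = (vpow A *m ext1 R (hb l : sympow n M)) k 0.
  by rewrite ext1_hb -colE [RHS]mxE.
have [x [-> x0]] := sympow_gr_sum (hb_gr (l : 'I_(hdim (sympow n M)))).
rewrite ext1_sum mulmx_sumr summxE big1 // => t _.
have [e|e] := eqVneq (\big[addb/false]_i tpars t i) (hpar l); last first.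
  by rewrite x0 // scale0r scale0r mulmx0 mxE.
rewrite -scalemxAr mxE vpow_E //.
rewrite (veeR_homR (a := tpars t)) ?mulr0 ?e // => i.
by apply: homR_mul => //; apply: homR_ext1; apply: hbt_gr.
Qed.

End Power.

Lemma map_vpow (F : fieldType) (R S : comAlgType F) (g : {lrmorphism R -> S}) n
    (M : superspace F) (A : 'M[R]_(hdim M)) :
  map_mx g (vpow n A) = vpow n (map_mx g A).
Proof.
apply/matrixP => k l; rewrite !mxE !summxE rmorph_sum; apply: eq_bigr => t _.
rewrite !mxE rmorphM /= rmorph_alg; congr (_ * _).
have := congr1 (fun x : 'cV_(hdim (sympow n M)) => x k 0)
  (map_veeR g (fun i => A *m ext1 R (hbt t i))).
rewrite mxE => ->; congr (veeR _ k 0); apply: funext => i.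
by rewrite map_mxM map_ext1.
Qed.

Lemma mulmx_expand (R : comPzRingType) m p q (A : 'M[R]_(m, p)) (I : finType)
    (c : I -> R) (X : I -> 'M[R]_(p, q)) :
  A *m (\sum_i c i *: X i) = \sum_i c i *: (A *m X i).
Proof. by rewrite mulmx_sumr; apply: eq_bigr => i _; rewrite scalemxAr. Qed.

Section Pairs.
Variables (F : fieldType) (R : comAlgType F) (V : superpair F).

Lemma formR_ext1 (x : V false) (y : V true) :
  (forall y, linear (fun x => @spform F V x y : F^o)) ->
  (forall x, linear (fun y => @spform F V x y : F^o)) ->
  formR (ext1 R x) (ext1 R y) = (spform x y)%:A.
Proof.
move=> ll lr; rewrite {2}(hcoord_sum x) {2}(hcoord_sum y).
rewrite (linear_expand _ _ (ll _)) scaler_suml; apply: eq_bigr => i _.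
rewrite (linear_expand _ _ (lr _)) scaler_sumr scaler_suml; apply: eq_bigr => j _.
by rewrite !mxE -!(in_algE R) -!rmorphM /= -mulrA.
Qed.

Lemma tripR_ext1 s t (x z : V s) (y : V t) :
  (forall y z, linear (fun x : V s => @trip F V s t x y z)) ->
  (forall x z, linear (fun y : V t => @trip F V s t x y z)) ->
  (forall x y, linear (@trip F V s t x y)) ->
  tripR (ext1 R x) (ext1 R y) (ext1 R z) = ext1 R (trip x y z).
Proof.
move=> l1 l2 l3; rewrite {2}(hcoord_sum x) {2}(hcoord_sum y) {2}(hcoord_sum z).
rewrite (linear_expand _ _ (l1 _ _)) ext1_sum; apply: eq_bigr => i _.
rewrite (linear_expand _ _ (l2 _ _)) ext1_sum scaler_sumr; apply: eq_bigr => j _.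
rewrite (linear_expand _ _ (l3 _ _)) ext1_sum !scaler_sumr; apply: eq_bigr => k _.
by rewrite !scalerA !mxE.
Qed.

Lemma trip_lin_neg :
  (forall s (y : V (~~ s)) (z : V s), linear (fun x => trip x y z)) ->
  (forall s (x z : V s), linear (fun y : V (~~ s) => trip x y z)) ->
  (forall s (x : V s) (y : V (~~ s)), linear (trip x y)) ->
  forall s, [/\ forall (y : V s) (z : V (~~ s)), linear (fun x : V (~~ s) => trip x y z),
    forall x z : V (~~ s), linear (fun y : V s => trip x y z) &
    forall (x : V (~~ s)) (y : V s), linear (trip x y)].
Proof.
by move=> l1 l2 l3 []; split=> *;
  [exact: (l1 false)|exact: (l2 false)|exact: (l3 false)
  |exact: (l1 true)|exact: (l2 true)|exact: (l3 true)].
Qed.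

Definition pairR s t (x : 'cV[R]_(hdim (V s))) (y : 'cV[R]_(hdim (V t))) : R :=
  \sum_i \sum_j x i 0 * y j 0 * (pairing (hb i) (hb j))%:A.

Lemma pairR_linearl s t y : linear (fun x => @pairR s t x y : R^o).
Proof.
move=> c x x'; rewrite scaler_sumr -big_split; apply: eq_bigr => i _ /=.
rewrite scaler_sumr -big_split; apply: eq_bigr => j _ /=.
by rewrite /GRing.scale /= !mxE !mulrDl !mulrA.
Qed.

Lemma pairR_linearr s t x : linear (fun y => @pairR s t x y : R^o).
Proof.
move=> c x' y; rewrite scaler_sumr -big_split; apply: eq_bigr => i _ /=.
rewrite scaler_sumr -big_split; apply: eq_bigr => j _ /=.
by rewrite /GRing.scale /= !mxE mulrDr mulrDl !mulrA (mulrC c).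
Qed.

Lemma pairR_hb s t i j :
  @pairR s t (ext1 R (hb i)) (ext1 R (hb j)) = (pairing (hb i) (hb j))%:A.
Proof.
rewrite /pairR (bigD1 i) //= (bigD1 j) //= !ext1_hb !mxE !eqxx !mul1r.
rewrite !big1 ?addr0 // => [l ne|l ne].
- by rewrite big1 // => m _; rewrite !mxE (negPf ne) !mul0r.
- by rewrite !mxE (negPf ne) mulr0 mul0r.
Qed.

End Pairs.

(** * Powers of automorphisms preserve the form and the products *)

Section Equivariance.
Variables (F : fieldType) (V : superpair F) (n : nat).
Hypothesis VM : metric_generalized_jordan_superpair V.
Local Notation W := (sympair V n).
Local Notation eta := (@eta F).
Let lin1 := trip_linear1 (mgjs_trilinear VM).
Let lin2 := trip_linear2 (mgjs_trilinear VM).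
Let lin3 := trip_linear3 (mgjs_trilinear VM).
Let B_linl := form_linear1 (mgjs_metric VM).
Let B_linr := form_linear2 (mgjs_metric VM).
Let B_even := form_even (mgjs_metric VM).

Definition trip_sign (i k : 'I_n) (t : 'S_n) (a b c : 'I_n -> bool) : F :=
  bracket_sign F i t a (b (t i)) *
  \prod_(l < n | (l < k)%N) eta (a i (+) b (t i)) (c l).

Lemma trip_sympair_vee s (f : 'I_n -> V (~~ s)) (v : 'I_n -> V s)
    (g : 'I_n -> V (~~ s)) a b c :
  (forall i, f i \in gr (V (~~ s)) (a i)) -> (forall i, v i \in gr (V s) (b i)) ->
  (forall i, g i \in gr (V (~~ s)) (c i)) ->
  @trip F W (~~ s) s (vee f) (vee v) (vee g) =
  \sum_i \sum_(t : 'S_n) \sum_k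
    (trip_sign i k t a b c * \prod_(l | l != i) pairing (f l) (v (t l))) *:
      vee (upd k (trip (f i) (v (t i)) (g k)) g).
Proof.
move=> fa vb gc; rewrite (trip_sympair VM) (nu_sympair_vee VM fa vb).
have l : linear (fun X : endpair W => ecomp X (~~ s) (vee g)).
  by move=> d X Y; apply: ecomp_lin.
rewrite (linear_expand2 _ _ l); apply: eq_bigr => i _; apply: eq_bigr => t _.
rewrite ecomp_sympair_act (sympow_act_nu VM (fa i) (vb (t i)) gc) scaler_sumr.
by apply: eq_bigr => k _; rewrite scalerA /trip_sign mulrAC.
Qed.

Section Points.
Variable R : comAlgType F.
Local Notation "''E_' t" := (ext1 R (vee (hbt t))) (at level 8, t at level 2).

Lemma formR_veeR (x : 'I_n -> 'cV[R]_(hdim (V false)))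
    (y : 'I_n -> 'cV[R]_(hdim (V true))) a :
  (forall i, homR (a i) (x i)) ->
  @formR F R W (veeR x) (veeR y) =
  (kap F a)%:A * \sum_(s : 'S_n) (ksgn F s a)%:A * \prod_i formR (x i) (y (s i)).
Proof.
move=> xa; rewrite !veeRE formR_expand mulr_sumr.
have prodE (s : 'S_n) : \prod_i formR (x i) (y (s i)) = _ :=
  esym (sum_ffun2 s (fun i k k' =>
    x i k 0 * y (s i) k' 0 * (spform (hb k) (hb k'))%:A)).
under [RHS]eq_bigr => s _ do rewrite prodE !mulr_sumr.
rewrite [RHS]exchange_big; apply: eq_bigr => t _ /=.
under [RHS]eq_bigr => s _ do rewrite !mulr_sumr.
rewrite [RHS]exchange_big; apply: eq_bigr => u _ /=.
rewrite formR_ext1; last 2 first.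
- by move=> z; apply: (sympow_form_linl VM).
- by move=> z; apply: (sympow_form_linr VM).
have -> : @spform F W (vee (hbt t)) (vee (hbt u)) = _ :=
  sympow_form_vee B_linl B_linr B_even _ (hbt_gr t).
rewrite -(in_algE R) rmorphM rmorph_sum !mulr_sumr /=; apply: eq_bigr => s _.
have [K KE] : exists K, K = ksgn F s (tpars t) by eexists.
rewrite -KE -(in_algE R (K * _)) rmorphM rmorph_prod /= !big_split /=.
have -> : \prod_i y (s i) (u (s i)) 0 = \prod_i y i (u i) 0.
  by rewrite [RHS](reindex_inj (@perm_inj _ s)).
have [/eqfunP ta|ta] := boolP [forall i, tpars t i == a i].
  rewrite KE (eq_ksgn _ _ ta) (eq_kap _ ta) /hbt; ring.
by rewrite (prod_homR xa ta); ring.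
Qed.

Section Sign.
Variable s : bool.
Implicit Types (x z : 'I_n -> 'cV[R]_(hdim (V (~~ s)))).
Implicit Types (y : 'I_n -> 'cV[R]_(hdim (V s))) (a b c : 'I_n -> bool).

(** The formula of [trip_sympair_vee] with the parities as parameters: the signs being fixed, it is
    multilinear in the three families, though it is shown to compute the product for families of
    these parities. *)
Definition trip_vee a b c x y z : 'cV[R]_(hdim (W (~~ s))) :=
  \sum_i \sum_(t : 'S_n) \sum_k
    (trip_sign i k t a b c)%:A *: ((\prod_(l | l != i) pairR (x l) (y (t l))) *:
      veeR (upd k (tripR (x i) (y (t i)) (z k)) z)).

Lemma trip_vee_linear1 a b c y z : multilinear (fun x => trip_vee a b c x y z).
Proof.
move=> m x; rewrite /trip_vee.
apply: linear_sumr => i _; apply: linear_sumr => t _; apply: linear_sumr => k _.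
apply: linear_scaler; have [mi|mi] := eqVneq m i.
  move=> d X Y; rewrite mi !upd_same.
  rewrite !(prod_upd_const (P := fun l => l != i) (fun l X => pairR X (y (t l)))) ?eqxx //.
  rewrite tripR_linear1 veeR_multilinear scalerDr !scalerA.
  by rewrite (mulrC d).
move=> d X Y; rewrite !(upd_other _ _ (_ : i != m)) 1?eq_sym //.
have := @multilinear_prod R _ n (fun l => l != i) (fun l X => pairR X (y (t l))) x m.
move=> /(_ (fun l => pairR_linearl _) mi d X Y) ->.
by rewrite scalerDl -scalerA.
Qed.

Lemma prod_pairR_perm i (t : 'S_n) x y :
  \prod_(l | l != i) pairR (x l) (y (t l)) =
  \prod_(l | l != t i) pairR (x (t^-1%g l)) (y l).
Proof.
rewrite [RHS](reindex_inj (@perm_inj _ t)) /=.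
by apply: eq_big => l; rewrite ?(inj_eq perm_inj) ?permK.
Qed.

Lemma trip_vee_linear2 a b c x z : multilinear (fun y => trip_vee a b c x y z).
Proof.
move=> m y; rewrite /trip_vee.
apply: linear_sumr => i _; apply: linear_sumr => t _; apply: linear_sumr => k _.
apply: linear_scaler => d X Y; rewrite !prod_pairR_perm.
have [mi|mi] := eqVneq m (t i).
  rewrite mi !upd_same.
  rewrite !(prod_upd_const (P := fun l => l != t i)
    (fun l Y => pairR (x (t^-1%g l)) Y)) ?eqxx //.
  rewrite tripR_linear2 veeR_multilinear scalerDr !scalerA.
  by rewrite (mulrC d).
rewrite !(upd_other _ _ (_ : t i != m)) 1?eq_sym //.
have := @multilinear_prod R _ n (fun l => l != t i)
  (fun l Y => pairR (x (t^-1%g l)) Y) y m.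
move=> /(_ (fun l => pairR_linearr _) mi d X Y) ->.
by rewrite scalerDl -scalerA.
Qed.

Lemma trip_vee_linear3 a b c x y : multilinear (trip_vee a b c x y).
Proof.
move=> m z; rewrite /trip_vee.
apply: linear_sumr => i _; apply: linear_sumr => t _; apply: linear_sumr => k _.
do 2!apply: linear_scaler.
move=> d X Y; have [<-|mk] := eqVneq m k.
  by rewrite !upd_same !upd_upd tripR_linear3 veeR_multilinear.
by rewrite !(upd_other _ _ (_ : k != m)) 1?eq_sym // !(@updC _ _ _ k m) 1?eq_sym //
  veeR_multilinear.
Qed.

Lemma tripR_E (t w : tidx n (V (~~ s))) (u : tidx n (V s)) :
  @tripR F R W (~~ s) s 'E_t 'E_u 'E_w =
  trip_vee (tpars t) (tpars u) (tpars w) (fun i => ext1 R (hbt t i))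
    (fun i => ext1 R (hbt u i)) (fun i => ext1 R (hbt w i)).
Proof.
have [l1 l2 l3] := trip_lin_neg (@sympair_trip1 F V VM n)
  (@sympair_trip2 F V VM n) (@sympair_trip3 F V n) s.
have [m1 m2 m3] := trip_lin_neg lin1 lin2 lin3 s.
rewrite tripR_ext1 // (trip_sympair_vee (hbt_gr t) (hbt_gr u) (hbt_gr w)).
rewrite ext1_bigsum; apply: eq_bigr => i _; rewrite ext1_bigsum.
apply: eq_bigr => p _; rewrite ext1_bigsum; apply: eq_bigr => k _.
rewrite ext1Z ext1_vee !scalerA; congr (_ *: veeR _).
  rewrite -!(in_algE R) rmorphM rmorph_prod; congr (_ * _).
  by apply: eq_bigr => l _; rewrite pairR_hb.
by apply: funext => l; rewrite /upd; case: eqP => // _; rewrite tripR_ext1.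
Qed.

(** All three families are expanded in the basis. Tensors of other parities have zero coefficients,
    and for the others [tripR_E] applies. *)
Lemma tripR_veeR a b c x y z : (forall i, homR (a i) (x i)) ->
  (forall i, homR (b i) (y i)) -> (forall i, homR (c i) (z i)) ->
  @tripR F R W (~~ s) s (veeR x) (veeR y) (veeR z) = trip_vee a b c x y z.
Proof.
move=> xa yb zc; rewrite !veeRE tripR_expand.
have expand (M : superspace F) (v : 'I_n -> 'cV[R]_(hdim M)) :
    v = fun i => \sum_k v i k 0 *: ext1 R (hb k : M).
  by apply: funext => i; apply: cV_sum.
rewrite [in RHS](expand _ x) [in RHS](expand _ y) [in RHS](expand _ z).
rewrite (multilinear_expand _ _ (@trip_vee_linear1 a b c _ _)).
apply: eq_bigr => t _; rewrite (multilinear_expand _ _ (@trip_vee_linear2 a b c _ _)).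
rewrite scaler_sumr; apply: eq_bigr => u _.
rewrite (multilinear_expand _ _ (@trip_vee_linear3 a b c _ _)).
rewrite !scaler_sumr; apply: eq_bigr => w _; rewrite tripR_E !scalerA.
have [/eqfunP ta|ta] := boolP [forall i, tpars t i == a i]; last first.
  by rewrite (prod_homR xa ta) !mul0r !scale0r.
have [/eqfunP ub|ub] := boolP [forall i, tpars u i == b i]; last first.
  by rewrite (prod_homR yb ub) mulr0 !mul0r !scale0r.
have [/eqfunP wc|wc] := boolP [forall i, tpars w i == c i]; last first.
  by rewrite (prod_homR zc wc) !mulr0 !scale0r.
by rewrite (funext ta) (funext ub) (funext wc).
Qed.

End Sign.

Section Automorphism.
Variable A : mxpair R V.
Hypothesis A_aut : is_autR A.

Lemma autR_evenmx s : evenmx (mxcomp A s).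
Proof. exact: autR_even A_aut s. Qed.

Lemma pairing_twist i j :
  @pairing F V true false (hb i) (hb j) =
  eta (hpar j) (hpar i) * @spform F V (hb j) (hb i).
Proof. exact: (twist_hom B_linl B_linr (hb_gr j) (hb_gr i)). Qed.

Lemma pairR_twist a b (x : 'cV[R]_(hdim (V true))) (y : 'cV[R]_(hdim (V false))) :
  homR a x -> homR b y -> pairR x y = (eta b a)%:A * formR y x.
Proof.
move=> xa yb; rewrite /formR exchange_big mulr_sumr; apply: eq_bigr => i _.
rewrite mulr_sumr; apply: eq_bigr => j _; rewrite pairing_twist.
have [ia|ia] := eqVneq (hpar i) a; last by rewrite (xa i) //; ring.
have [jb|jb] := eqVneq (hpar j) b; last by rewrite (yb j) //; ring.
rewrite ia jb -!(in_algE R) rmorphM /=; ring.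
Qed.

Lemma pairR_aut s a b (x : 'cV[R]_(hdim (V (~~ s)))) (y : 'cV[R]_(hdim (V s))) :
  homR a x -> homR b y ->
  pairR (mxcomp A (~~ s) *m x) (mxcomp A s *m y) = pairR x y.
Proof.
case: s x y => x y xa yb; first exact: (autR_form A_aut).
rewrite !(pairR_twist (a := a) (b := b)) //; first by congr (_ * _); exact: (autR_form A_aut).
- exact: (@homR_mul _ _ (V true) a A.2 x (@autR_evenmx true) xa).
- exact: (@homR_mul _ _ (V false) b A.1 y (@autR_evenmx false) yb).
Qed.

Lemma trip_vee_aut s a b c x y z :
  (forall i, homR (a i) (x i)) -> (forall i, homR (b i) (y i)) ->
  trip_vee (s := s) a b c (fun i => mxcomp A (~~ s) *m x i)
    (fun i => mxcomp A s *m y i) (fun i => mxcomp A (~~ s) *m z i) =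
  vpow n (mxcomp A (~~ s)) *m trip_vee a b c x y z.
Proof.
move=> xa yb; rewrite mulmx_sumr; apply: eq_bigr => i _.
rewrite mulmx_sumr; apply: eq_bigr => t _; rewrite mulmx_sumr; apply: eq_bigr => k _.
rewrite -!scalemxAr vpow_veeR; last exact: autR_evenmx.
congr (_ *: (_ *: veeR _)).
  by apply: eq_bigr => l _; rewrite (pairR_aut (xa l) (yb (t l))).
apply: funext => l; rewrite /upd; case: eqP => // _.
by case: s x y z {xa yb} => x y z; exact: (autR_trip A_aut).
Qed.

Lemma vpow_trip s (x z : 'cV[R]_(hdim (W (~~ s)))) (y : 'cV[R]_(hdim (W s))) :
  @tripR F R W (~~ s) s (vpow n (mxcomp A (~~ s)) *m x)
    (vpow n (mxcomp A s) *m y) (vpow n (mxcomp A (~~ s)) *m z) =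
  vpow n (mxcomp A (~~ s)) *m @tripR F R W (~~ s) s x y z.
Proof.
have [c1 ->] := E_span x; have [c2 ->] := E_span y; have [c3 ->] := E_span z.
rewrite !mulmx_expand !tripR_expand mulmx_sumr; apply: eq_bigr => t _.
rewrite mulmx_sumr; apply: eq_bigr => u _; rewrite mulmx_sumr.
apply: eq_bigr => w _; rewrite -scalemxAr; congr (_ *: _).
rewrite !vpow_E; try exact: autR_evenmx.
have h (p : bool) (v : tidx n (V p)) i : homR (tpars v i) (ext1 R (hbt v i)).
  by apply: homR_ext1; apply: hbt_gr.
have hA (p : bool) (v : tidx n (V p)) i :
    homR (tpars v i) (mxcomp A p *m ext1 R (hbt v i)).
  by apply: homR_mul => //; apply: autR_evenmx.
rewrite (tripR_veeR (hA _ t) (hA _ u) (hA _ w)) tripR_E.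
by rewrite (trip_vee_aut _ _ (h _ t) (h _ u)).
Qed.

Lemma vpow_form (x : 'cV[R]_(hdim (W false))) (y : 'cV[R]_(hdim (W true))) :
  @formR F R W (vpow n A.1 *m x) (vpow n A.2 *m y) = @formR F R W x y.
Proof.
have [c1 ->] := E_span x; have [c2 ->] := E_span y.
rewrite !mulmx_expand !formR_expand; apply: eq_bigr => t _; apply: eq_bigr => u _.
congr (_ * _).
have A1 : evenmx A.1 := @autR_evenmx false; have A2 : evenmx A.2 := @autR_evenmx true.
rewrite !vpow_E // -(veeR_hbt R t) -(veeR_hbt R u).
have h i : homR (tpars t i) (ext1 R (hbt t i)) by apply: homR_ext1; apply: hbt_gr.
rewrite (formR_veeR _ h) (@formR_veeR _ _ (tpars t)) => [|i]; last exact: homR_mul.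
congr (_ * _); apply: eq_bigr => p _; congr (_ * _); apply: eq_bigr => i _.
exact: (autR_form A_aut).
Qed.

Definition vpowpair : mxpair R W := (vpow n A.1, vpow n A.2).

Lemma vpowpairE s : mxcomp vpowpair s = vpow n (mxcomp A s).
Proof. by case: s. Qed.

End Automorphism.

Lemma aut_even (phi : Aut_scheme V R) s : evenmx (aut_comp phi s).
Proof. exact: autR_evenmx (autRP phi) s. Qed.

Lemma vpowpair_aut (phi : Aut_scheme V R) : is_autR (vpowpair (aut_mx phi)).
Proof.
split.
- move=> s; rewrite vpowpairE; exists (vpow n (aut_comp phi^-1%g s)).
  rewrite -/(aut_comp phi s) !vpowM; try exact: aut_even.
  by rewrite -!aut_compM mulgV mulVg aut_comp1 vpow1.
- by move=> s i j; rewrite vpowpairE; apply: vpow_even; apply: aut_even.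
- move=> s x y z; rewrite !vpowpairE; have A_aut := autRP phi.
  case: s x y z => x y z; first exact: (@vpow_trip _ A_aut false).
  exact: (@vpow_trip _ A_aut true).
- exact: vpow_form (autRP phi).
Qed.

Definition vpow_aut (phi : Aut_scheme V R) : Aut_scheme W R :=
  AutR (asboolT (vpowpair_aut phi)).

Lemma vpow_autE (phi : Aut_scheme V R) s :
  aut_comp (vpow_aut phi) s = vpow n (aut_comp phi s).
Proof. exact: vpowpairE. Qed.

End Points.

Definition Omega : gmor (Aut_scheme V) (Aut_scheme W).
Proof.
refine (@Gmor F (Aut_scheme V) (Aut_scheme W) vpow_aut _ _).
- move=> R x y; apply: aut_comp_inj => s; rewrite !(aut_compM, vpow_autE) vpowM //;
  exact: aut_even.
- move=> R S g x; apply: aut_comp_inj => s.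
  by rewrite vpow_autE !aut_comp_map vpow_autE map_vpow.
Defined.

Lemma OmegaE (R : comAlgType F) (phi : Aut_scheme V R) s :
  aut_comp (Omega R phi) s = vpow n (aut_comp phi s).
Proof. exact: vpow_autE. Qed.

Lemma Omega_veeR (R : comAlgType F) (phi : Aut_scheme V R) s
    (x : 'I_n -> 'cV[R]_(hdim (V s))) :
  aut_comp (Omega R phi) s *m veeR x = veeR (fun i => aut_comp phi s *m x i).
Proof. by rewrite OmegaE vpow_veeR //; apply: aut_even. Qed.

End Equivariance.

(** * Kernels *)

Lemma det_entries (R : comPzRingType) n d (A : 'M[R]_d) (e : d = n) :
  \det (\matrix_(i < n, j < n) A (cast_ord (esym e) i) (cast_ord (esym e) j)) = \det A.
Proof.
case: n / e; congr (\det _); apply/matrixP => i j.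
by rewrite mxE !cast_ord_id.
Qed.

(** The initial indices 0, ..., n are moved by transpositions so that 0 goes to [j] and 1 to [s];
    index 1 exists as n > 0. *)
Lemma exists_inj_through d n (j s : 'I_d) : (n < d)%N -> (0 < n)%N ->
  exists f : 'I_n.+1 -> 'I_d, [/\ injective f, exists a, f a = j & exists b, f b = s].
Proof.
move=> nd n0.
have d0 : (0 < d)%N by apply: leq_trans nd.
pose z := Ordinal d0; pose w := widen_ord nd.
have w_inj : injective w by move=> a b /(congr1 val) /= ab; apply: val_inj.
have w0 : w ord0 = z by apply: val_inj.
pose p1 := tperm z j.
have [->|js] := eqVneq j s.
  exists (fun a => tperm z s (w a)); split; first by move=> a b /perm_inj/w_inj.
  - by exists ord0; rewrite w0 tpermL.
  - by exists ord0; rewrite w0 tpermL.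
pose o := w (Ordinal (n0 : (1 < n.+1)%N)).
have oz : o != z by apply/eqP => /(congr1 val).
pose p2 := tperm o (p1 s).
exists (fun a => p1 (p2 (w a))); split.
- by move=> a b /perm_inj/perm_inj/w_inj.
- exists ord0; rewrite w0 /p2 tpermD //; first by rewrite /p1 tpermL.
  by apply: contra js => /eqP e; apply/eqP; rewrite -[RHS](tpermK z j) -/p1 e tpermL.
- by exists (Ordinal (n0 : (1 < n.+1)%N)); rewrite -/o /p2 tpermL /p1 tpermK.
Qed.

(* A principal submatrix M of size n + 1 has the adjugate of the identity, and
   M adj(M) = det M. *)
Lemma scalar_of_minors (R : comPzRingType) d n (A : 'M[R]_d) : (n < d)%N -> (0 < n)%N ->
  (forall f t : 'I_n -> 'I_d, \det (\matrix_(i, j) A (f i) (t j)) =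
     \det (\matrix_(i, j) (1%:M : 'M[R]_d) (f i) (t j))) ->
  exists l : R, A = l%:M /\ l ^+ n = 1.
Proof.
move=> nd n0 A_minors.
pose sub (f : 'I_n.+1 -> 'I_d) (B : 'M[R]_d) := \matrix_(a, b) B (f a) (f b).
have sub1 f : injective f -> sub f 1%:M = 1%:M.
  by move=> f_inj; apply/matrixP => a b; rewrite !mxE (inj_eq f_inj).
have subA f : injective f -> sub f A = (\det (sub f A))%:M.
  move=> f_inj; rewrite -mul_mx_adj -[LHS]mulmx1; congr (_ *m _).
  have -> : \adj (sub f A) = \adj (sub f 1%:M).
    apply/matrixP => a b; rewrite !mxE /cofactor; congr (_ * _).
    have E B : row' b (col' a (sub f B)) =
        \matrix_(i, j) B (f (lift b i)) (f (lift a j)).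
      by apply/matrixP => i j; rewrite !mxE.
    by rewrite !E A_minors.
  by rewrite sub1 // adj1.
have d0 : (0 < d)%N by apply: leq_trans nd.
pose z := Ordinal d0.
have AE j s : A j s = (j == s)%:R * A z z.
  (* Any two indices lie in a common principal submatrix, so the scalars of all these submatrices
     agree. *)
  have AA i k : A i k = (i == k)%:R * A i i /\ A i i = A k k.
    have [f [f_inj [a <-] [b <-]]] := exists_inj_through i k nd n0.
    have /matrixP M := subA f f_inj.
    have := M a b; rewrite !mxE => ->; have := M a a; rewrite !mxE => ->.
    have := M b b; rewrite !mxE => ->.
    by rewrite !eqxx (inj_eq f_inj) mulr_natl.
  by rewrite (AA j s).1 (AA j z).2.
exists (A z z); split.
  by apply/matrixP => j s; rewrite mxE AE mulr_natl.
have [f [f_inj _ _]] := exists_inj_through z z nd n0.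
have := A_minors (fun i => f (lift ord0 i)) (fun i => f (lift ord0 i)).
have -> : \matrix_(i, j) (1%:M : 'M[R]_d) (f (lift ord0 i)) (f (lift ord0 j)) = 1%:M.
  by apply/matrixP => i j; rewrite !mxE (inj_eq f_inj) (inj_eq lift_inj).
have -> : \matrix_(i < n, j < n) A (f (lift ord0 i)) (f (lift ord0 j)) = (A z z)%:M.
  by apply/matrixP => i j; rewrite !mxE AE (inj_eq f_inj) (inj_eq lift_inj) mulr_natl.
by rewrite det_scalar det1.
Qed.

Lemma algA_inj (F : fieldType) (R : comAlgType F) (c : F) (x y : R) : c != 0 ->
  c%:A * x = c%:A * y -> x = y.
Proof.
move=> c0; rewrite !mulr_algl => /(congr1 (fun x => c^-1 *: x)).
by rewrite !scalerA mulVf // !scale1r.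
Qed.

(** In the permanent of s, ..., s, j against s, ..., s, r, the m! permutations fixing the last place
    give [A s s ^+ m * A j r], the others [A s s ^+ m.-1 * (A j s * A s r)]. The pairs (s, s), (j,
    s), (s, r) and (j, r) yield in turn the root of unity [A s s], the zeros of column and row [s],
    and the other entries. *)
Lemma scalar_of_permanents (F : fieldType) (R : comAlgType F) d m (A : 'M[R]_d)
    (s : 'I_d) : (0 < m)%N -> (m.+1`!%:R : F) != 0 ->
  let f j (i : 'I_m.+1) := if i == ord_max then j else s in
  (forall j r, \sum_(p : 'S_m.+1) \prod_i A (f j i) (f r (p i)) =
    \sum_(p : 'S_m.+1) \prod_i (1%:M : 'M[R]_d) (f j i) (f r (p i))) ->
  exists l : R, A = l%:M /\ l ^+ m.+1 = 1.
Proof.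
move=> m0 n0 f A_perm.
pose N1 : F := m`!%:R.
have N1E : (N1 : F) != 0 by move: n0; rewrite factS natrM mulf_eq0 negb_or => /andP[].
have card1 : \sum_(p : 'S_m.+1 | p ord_max == ord_max) (1 : R) = N1%:A.
  by rewrite (sum_perm_lift ord_max ord_max (fun=> 1)) sumr_const card_Sn scaler_nat.
have cardA : \sum_(p : 'S_m.+1) (1 : R) = (m.+1`!%:R : F)%:A.
  by rewrite sumr_const card_Sn scaler_nat.
(* The exact value of [N2] does not enter, only its sum with [N1], which is the invertible (m +
   1)!. *)
pose N2 : R := \sum_(p : 'S_m.+1 | p ord_max != ord_max) 1.
have N12 : N1%:A + N2 = (m.+1`!%:R : F)%:A.
  by rewrite -cardA (bigID (fun p : 'S_m.+1 => p ord_max == ord_max)) /= card1.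
have permE (B : 'M[R]_d) j r : \sum_(p : 'S_m.+1) \prod_i B (f j i) (f r (p i)) =
    N1%:A * (B s s ^+ m * B j r) + N2 * (B s s ^+ m.-1 * (B j s * B s r)).
  rewrite (bigID (fun p : 'S_m.+1 => p ord_max == ord_max)) /= -card1 !mulr_suml.
  congr (_ + _); apply: eq_bigr => p pm; rewrite mul1r.
    rewrite (bigD1 ord_max) //= /f (eqP pm) eqxx mulrC; congr (_ * _).
    rewrite (eq_bigr (fun=> B s s)) => [|i im]; last first.
      by rewrite (negPf im) -(eqP pm) (inj_eq perm_inj) (negPf im).
    by rewrite prodr_const cardC1 card_ord.
  have [k pk] : exists k, p k = ord_max by exists (p^-1%g ord_max); rewrite permKV.
  have km : k != ord_max by apply: contraNneq pm => e; rewrite -[X in p X]e pk.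
  rewrite (bigD1 ord_max) //= (bigD1 k) //= /f eqxx (negPf pm) (negPf km) pk eqxx.
  rewrite (eq_bigr (fun=> B s s)) => [|i /andP[im ik]]; last first.
    by rewrite (negPf im) -pk (inj_eq perm_inj) (negPf ik).
  rewrite prodr_const.
  have -> : #|[pred i : 'I_m.+1 | (i != ord_max) && (i != k)]| = m.-1.
    have := cardC (pred2 ord_max k : pred 'I_m.+1).
    rewrite card2 eq_sym km card_ord => e.
    have -> : m.-1 = #|[predC pred2 (@ord_max m) k]| by move/(congr1 (fun k => k.-2)): e.
    by apply: eq_card => i; rewrite !inE negb_or.
  ring.
have key j r := A_perm j r; move: key; clear A_perm => key.
have {}key j r : N1%:A * (A s s ^+ m * A j r) +
    N2 * (A s s ^+ m.-1 * (A j s * A s r)) =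
    N1%:A * (j == r)%:R + N2 * ((j == s)%:R * (s == r)%:R).
  by rewrite -permE key permE !mxE eqxx !expr1n !mul1r.
have n0A (x : R) : N1%:A * x + N2 * x = (m.+1`!%:R : F)%:A * x by rewrite -mulrDl N12.
set l := A s s in key *.
have lm : l ^+ m = l ^+ m.-1 * l by rewrite -exprSr prednK.
have ln : l * l ^+ m = 1.
  apply: (algA_inj n0); rewrite mulr1 -n0A -N12.
  have := key s s; rewrite !eqxx !mulr1 => <-.
  by rewrite -/l lm; ring.
have off (x : R) : (m.+1`!%:R : F)%:A * (l ^+ m * x) = 0 -> x = 0.
  move=> e; rewrite -[x]mul1r -ln -mulrA.
  have -> : l ^+ m * x = 0 by apply: (algA_inj n0); rewrite e mulr0.
  by rewrite mulr0.
have Ajs j : j != s -> A j s = 0.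
  move=> js; apply: off; have := key j s.
  rewrite (negPf js) mul0r !mulr0 addr0 -/l => e.
  by rewrite -n0A -[RHS]e lm; ring.
have Asr r : s != r -> A s r = 0.
  move=> sr; apply: off; have := key s r.
  rewrite (negPf sr) !mulr0 addr0 -/l => e.
  by rewrite -n0A -[RHS]e lm; ring.
exists l; split; last by rewrite exprS.
apply/matrixP => j r; rewrite mxE.
have [->|js] := eqVneq j s.
  by have [<-|sr] := eqVneq s r; rewrite // Asr.
have := key j r; rewrite (Ajs j js) (negPf js) !mul0r !mulr0 !addr0.
move=> /(algA_inj N1E) e; rewrite -[LHS]mul1r -ln -mulrA e.
by rewrite mulr_natr.
Qed.

(** A column of the cokernel of the Gram matrix lists the coordinates of a vector orthogonal to
    everything, which is zero by nondegeneracy. *)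
Lemma gram_left_inverse (F : fieldType) (M N : superspace F) (B : M -> N -> F) :
  (forall y, linear (fun x => B x y : F^o)) ->
  (forall x, linear (fun y => B x y : F^o)) ->
  (forall y, (forall x, B x y = 0) -> y = 0) ->
  exists C : 'M[F]_(hdim N, hdim M), C *m \matrix_(i, j) B (hb i) (hb j) = 1%:M.
Proof.
move=> Bl Br B0; set G := \matrix_(i, j) _.
apply/row_fullP; rewrite -cokermx_eq0; apply/eqP/matrixP => k l; rewrite [RHS]mxE.
pose y := \sum_j cokermx G j l *: (hb j : N).
have -> : cokermx G k l = hcoord k y.
  rewrite linear_sum (bigD1 k) //= big1 => [|j jk]; last first.
    by rewrite linearZ /= hcoord_hb eq_sym (negPf jk) scaler0.
  by rewrite linearZ /= hcoord_hb eqxx addr0 /GRing.scale /= mulr1.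
suff -> : y = 0 by rewrite linear0.
apply: B0 => x; rewrite (hcoord_sum x) (linear_expand _ _ (Bl _)) big1 // => i _.
have := mulmx_coker G => /matrixP/(_ i l); rewrite !mxE => e.
rewrite (linear_expand _ _ (Br _)) -[X in _ *: X = _]/(_ : F).
rewrite (_ : \sum_j _ = 0) ?scaler0 // -[RHS]e; apply: eq_bigr => j _.
by rewrite [G i j]mxE mulrC.
Qed.

Lemma fact_neq0 (F : fieldType) n :
  (forall p, p \in [pchar F] -> (n < p)%N) -> (n`!%:R : F) != 0.
Proof.
move=> np; elim: n np => [|n IH] np; first by rewrite oner_neq0.
rewrite factS natrM mulf_neq0 ?IH // => [|p /np/ltnW //].
apply/negP => n0; have [p pF] := natf0_pchar (ltn0Sn n) n0.
have := dvdn_leq (ltn0Sn n) (_ : p %| n.+1)%N.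
by rewrite (dvdn_pcharf pF) => /(_ n0); rewrite leqNgt np.
Qed.

(** Read off the determinant of a permutation matrix. *)
Lemma ksgn_odd (F : fieldType) n (s : 'S_n) : ksgn F s (fun=> true) = (-1) ^+ s.
Proof.
rewrite -(det_perm F s) -signed_perm_sum_odd /signed_perm_sum.
rewrite (bigD1 s) //= [X in _ * X]big1 ?mulr1 => [|i _]; last by rewrite !mxE eqxx.
rewrite big1 ?addr0 // => t ts.
have [i si] : exists i, s i != t i.
  apply/existsP; rewrite -negb_forall; apply: contra ts => /eqfunP st.
  by apply/eqP/permP => i; rewrite st.
by rewrite (bigD1 i) //= !mxE (negPf si) mul0r mulr0.
Qed.

Lemma vline_hdim1 (F : fieldType) (M : superspace F) (w : M) : w != 0 ->
  (forall x : M, exists c, x = c *: w) -> hdim M = 1%N.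
Proof.
move=> w0 wP; have w1 : \dim <[w]>%VS = 1%N by rewrite dim_vline w0.
rewrite hdimE -w1; congr (\dim _).
apply/vspaceP => x; rewrite memvf; apply/esym/vlineP.
by have [c ->] := wP x; exists c.
Qed.

Section FormOverR.
Variables (F : fieldType) (U : superpair F) (R : comAlgType F).
Local Notation B := (@spform F U).

Lemma formR_linr (I : finType) (q : I -> R) x Y :
  @formR F R U x (\sum_j q j *: Y j) = \sum_j q j * formR x (Y j).
Proof.
have -> : x = \sum_(i < 1) 1 *: x by rewrite big_ord1 scale1r.
rewrite formR_expand big_ord1; apply: eq_bigr => j _.
by rewrite big_ord1 mul1r scale1r.
Qed.

Lemma formR_linl (I : finType) (q : I -> R) X y :
  @formR F R U (\sum_j q j *: X j) y = \sum_j q j * formR (X j) y.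
Proof.
have -> : y = \sum_(i < 1) 1 *: y by rewrite big_ord1 scale1r.
rewrite formR_expand; apply: eq_bigr => j _.
by rewrite !big_ord1 mulr1 scale1r.
Qed.

Lemma formRZl c x y : @formR F R U (c *: x) y = c * formR x y.
Proof. by have := formR_linl (fun _ : 'I_1 => c) (fun=> x) y; rewrite !big_ord1. Qed.

Lemma formRZr c x y : @formR F R U x (c *: y) = c * formR x y.
Proof. by have := formR_linr (fun _ : 'I_1 => c) x (fun=> y); rewrite !big_ord1. Qed.

Hypothesis B_linl : forall y, linear (fun x => B x y : F^o).
Hypothesis B_linr : forall x, linear (fun y => B x y : F^o).

(** A dual basis over F recovers the coordinates over any R, so nondegeneracy survives scalar
    extension. *)
Lemma formR_injl (x x' : 'cV[R]_(hdim (U false))) :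
  (forall x, (forall y, B x y = 0) -> x = 0) ->
  (forall y, formR x y = formR x' y) -> x = x'.
Proof.
move=> B0 xx'; have [D DG] := gram_left_inverse (B := fun y x => B x y) B_linr B_linl B0.
apply/matrixP => k z; rewrite ord1 {z}.
pose y := \sum_j D k j *: (hb j : U true).
have yE i : B (hb i) y = (k == i)%:R.
  move/matrixP/(_ k i): DG; rewrite !mxE => <-.
  by rewrite (linear_expand _ _ (B_linr _)); apply: eq_bigr => j _; rewrite mxE.
have E w : formR w (ext1 R y) = w k 0.
  rewrite {1}(cV_sum w) formR_linl (bigD1 k) //=.
  rewrite formR_ext1 // yE eqxx scale1r mulr1 big1 ?addr0 // => i ik.
  by rewrite formR_ext1 // yE eq_sym (negPf ik) scale0r mulr0.
by rewrite -!E.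
Qed.

End FormOverR.

Section Kernel.
Variables (F : fieldType) (V : superpair F) (n : nat).
Hypothesis VM : metric_generalized_jordan_superpair V.
Local Notation W := (sympair V n).
Let B_linl := form_linear1 (mgjs_metric VM).
Let B_linr := form_linear2 (mgjs_metric VM).
Let B_even := form_even (mgjs_metric VM).
Local Notation B := (@spform F V).

Lemma spform_hcomp a (x : V false) (y : V true) : y \in gr (V true) a ->
  B (hcomp a x) y = B x y.
Proof.
move=> ya; rewrite -[in RHS](hcomp_add x) (linD (B_linl y)).
have h b : b != a -> B (hcomp b x) y = 0 by apply: B_even (hcomp_mem _ _) ya.
by case: a ya h => ya h; [rewrite (h false) // add0r|rewrite (h true) // addr0].
Qed.

(** Passing to homogeneous components keeps the duality, the form being even. *)
Lemma dual_basis : exists xi : 'I_(hdim (V true)) -> V false,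
  (forall j k, B (xi j) (hb k) = (j == k)%:R) /\
  forall j, xi j \in gr (V false) (hpar j).
Proof.
have [C CG] := gram_left_inverse B_linl B_linr (form_nondeg2 (mgjs_metric VM)).
pose x j := \sum_i C j i *: (hb i : V false).
exists (fun j => hcomp (hpar j) (x j)); split=> [j k|j]; last exact: hcomp_mem.
have xE : B (x j) (hb k) = (j == k)%:R.
  move/matrixP/(_ j k): CG; rewrite !mxE => <-.
  rewrite (linear_expand _ _ (B_linl _)); apply: eq_bigr => i _.
  by rewrite mxE.
have [jk|jk] := eqVneq (hpar j) (hpar k).
  by rewrite jk spform_hcomp // hb_gr.
rewrite (B_even (hcomp_mem _ _) (hb_gr k) jk).
by case: eqP => // e; rewrite e eqxx in jk.
Qed.

Lemma hdim_form : hdim (V false) = hdim (V true).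
Proof.
have [C CG] := gram_left_inverse B_linl B_linr (form_nondeg2 (mgjs_metric VM)).
have [D DG] := gram_left_inverse (B := fun y x => B x y) B_linr B_linl
  (form_nondeg1 (mgjs_metric VM)).
by apply/eqP; rewrite eqn_leq (mulmx1_min CG) (mulmx1_min DG).
Qed.

Lemma even_part_form : gr (V true) false = 0%VS -> gr (V false) false = 0%VS.
Proof.
move=> V0; apply/eqP; rewrite -subv0; apply/subvP => x x0; rewrite memv0; apply/eqP.
apply: (form_nondeg1 (mgjs_metric VM)) => y.
apply: (B_even x0 (_ : y \in gr (V true) true)) => //.
have := memvf y; rewrite -(gr_full (V true)) V0 => /memv_addP[u].
by rewrite memv0 => /eqP -> [v v1 ->]; rewrite add0r.
Qed.

Section Points.
Variable R : comAlgType F.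
Local Notation "''E_' t" := (ext1 R (vee (hbt t))) (at level 8, t at level 2).

Lemma formR_dual (xi : 'I_(hdim (V true)) -> V false) j (y : 'cV[R]_(hdim (V true))) :
  (forall j k, B (xi j) (hb k) = (j == k)%:R) -> formR (ext1 R (xi j)) y = y j 0.
Proof.
move=> xiE; rewrite {1}(cV_sum y) formR_linr (bigD1 j) //= big1 => [|k kj].
  by rewrite formR_ext1 // xiE eqxx scale1r mulr1 addr0.
by rewrite formR_ext1 // xiE eq_sym (negPf kj) scale0r mulr0.
Qed.

Lemma formR_veeR_dual (xi : 'I_(hdim (V true)) -> V false)
    (f : 'I_n -> 'I_(hdim (V true))) (y : 'I_n -> 'cV[R]_(hdim (V true))) :
  (forall j k, B (xi j) (hb k) = (j == k)%:R) ->
  (forall j, xi j \in gr (V false) (hpar j)) ->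
  @formR F R W (veeR (fun i => ext1 R (xi (f i)))) (veeR y) =
  (kap F (fun i => hpar (f i)))%:A *
  \sum_(s : 'S_n) (ksgn F s (fun i => hpar (f i)))%:A * \prod_i y (s i) (f i) 0.
Proof.
move=> xiE xi_gr; have h i : homR (hpar (f i)) (ext1 R (xi (f i))) by apply: homR_ext1.
rewrite (formR_veeR VM _ h).
congr (_ * _); apply: eq_bigr => s _; congr (_ * _); apply: eq_bigr => i _.
exact: formR_dual.
Qed.

Lemma kap_neq0 (a : 'I_n -> bool) : kap F a != 0.
Proof.
by apply/negP => /eqP k0; have := kap_sqr F a; rewrite k0 mul0r => /esym/eqP; rewrite oner_eq0.
Qed.

(** The n-th powers of [A] and of the identity act alike on a product of basis vectors; pairing with
    a product of dual basis vectors extracts the entries. *)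
Lemma vpow_kernel_sum (A : 'M[R]_(hdim (V true))) : evenmx A -> vpow n A = 1%:M ->
  forall f t : 'I_n -> 'I_(hdim (V true)),
  \sum_(s : 'S_n) (ksgn F s (fun i => hpar (f i)))%:A * \prod_i A (f i) (t (s i)) =
  \sum_(s : 'S_n) (ksgn F s (fun i => hpar (f i)))%:A *
    \prod_i (1%:M : 'M[R]_(hdim (V true))) (f i) (t (s i)).
Proof.
move=> Ae A1 f t; have [xi [xiE xi_gr]] := dual_basis.
apply: (algA_inj (kap_neq0 (fun i => hpar (f i)))).
pose y (C : 'M[R]_(hdim (V true))) i := C *m ext1 R (hb (t i) : V true).
have yE C i j : y C i j 0 = C j (t i) by rewrite /y ext1_hb -colE mxE.
have E (C : 'M[R]_(hdim (V true))) : \sum_(s : 'S_n) (ksgn F s (fun i => hpar (f i)))%:A *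
      \prod_i C (f i) (t (s i)) =
    \sum_(s : 'S_n) (ksgn F s (fun i => hpar (f i)))%:A * \prod_i y C (s i) (f i) 0.
  by apply: eq_bigr => s _; congr (_ * _); apply: eq_bigr => i _; rewrite yE.
rewrite !E -!(formR_veeR_dual _ _ xiE xi_gr); congr formR.
have e1 : evenmx (1%:M : 'M[R]_(hdim (V true))).
  by move=> i j ij; rewrite mxE; case: eqP => // e; rewrite e eqxx in ij.
by rewrite /y -!vpow_veeR // A1 vpow1.
Qed.

Lemma vpow_kernel_scalar (A : 'M[R]_(hdim (V true))) : (1 < n)%N ->
  (\dim (gr (V true) false) = 0%N -> (n < hdim (V true))%N) ->
  ((0 < \dim (gr (V true) false))%N -> (n`!%:R : F) != 0) ->
  evenmx A -> vpow n A = 1%:M -> exists l : R, A = l%:M /\ l ^+ n = 1.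
Proof.
move=> n1 dim0 fact0 Ae A1; have key := vpow_kernel_sum Ae A1.
have [d0|d0] := posnP (\dim (gr (V true) false)).
  apply: scalar_of_minors (dim0 d0) (ltnW n1) _ => f t.
  have := key f t.
  rewrite (_ : (fun i => hpar (f i)) = fun=> true); last first.
    by apply: funext => i; rewrite /hpar d0.
  move=> e; transitivity (\sum_(s : 'S_n) (ksgn F s (fun=> true))%:A *
      \prod_i A (f i) (t (s i))).
    apply: eq_bigr => s _; rewrite ksgn_odd -(in_algE R) rmorph_sign.
    by congr (_ * _); apply: eq_bigr => i _; rewrite mxE.
  rewrite e; apply: eq_bigr => s _; rewrite ksgn_odd -(in_algE R) rmorph_sign.
  by congr (_ * _); apply: eq_bigr => i _; rewrite !mxE.
have d1 : (0 < hdim (V true))%N by rewrite /hdim addn_gt0 d0.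
pose s0 : 'I_(hdim (V true)) := Ordinal d1.
have s0_even : hpar s0 = false by rewrite /hpar leqNgt d0.
move: n1 fact0 key; clear A1; case: (n) => [//|m] m0 fact0 key.
apply: (@scalar_of_permanents F R _ m A s0) => // [|j r]; first exact: fact0.
have := key (fun i => if i == ord_max then j else s0)
  (fun i => if i == ord_max then r else s0).
(* A sign needs two odd factors, and at most one factor of this family is odd. *)
have ksgn1' (p : 'S_m.+1) :
    ksgn F p (fun i => hpar (if i == ord_max then j else s0)) = 1.
  rewrite /ksgn big1 // => i _; rewrite big1 // => k /andP[ik _].
  case: (i =P ord_max) => [im|_]; last by rewrite s0_even.
  rewrite (_ : k == ord_max = false) ?s0_even ?eta0r //.
  by apply/negbTE; rewrite neq_ltn -im orbC ik.
under eq_bigr => p _ do rewrite ksgn1' scale1r mul1r.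
by under [X in _ = X -> _]eq_bigr => p _ do rewrite ksgn1' scale1r mul1r.
Qed.

End Points.
End Kernel.

Lemma val_Gm_exp (F : fieldType) (R : comAlgType F) (l : Gm F R) k :
  val (l ^+ k)%g = ((val l).1 ^+ k, (val l).2 ^+ k).
Proof. by elim: k => [|k IH]; rewrite ?expg0 // expgS !exprS /= IH. Qed.

Lemma veeR_scale (F : fieldType) (R : comAlgType F) n (M : superspace F) (c : R)
    (x : 'I_n -> 'cV[R]_(hdim M)) :
  veeR (fun i => c *: x i) = c ^+ n *: veeR x.
Proof.
rewrite !veeRE scaler_sumr; apply: eq_bigr => t _; rewrite scalerA; congr (_ *: _).
under eq_bigr => i _ do rewrite mxE.
by rewrite big_split prodr_const card_ord.
Qed.

Lemma vpow_scalar (F : fieldType) (R : comAlgType F) n (M : superspace F) (c : R) :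
  vpow n (c%:M : 'M[R]_(hdim M)) = (c ^+ n)%:M.
Proof.
have ce : evenmx (c%:M : 'M[R]_(hdim M)).
  by move=> i j ij; rewrite mxE; case: eqP => // e; rewrite e eqxx in ij.
apply: (@eq_on_E F R n M) => t; rewrite vpow_E // mul_scalar_mx -veeR_hbt -veeR_scale.
by congr veeR; apply: funext => i; rewrite mul_scalar_mx.
Qed.

(** * One-dimensional superpairs and the multiplicative group *)

Section OneDimensional.
Variables (F : fieldType) (U : superpair F).
Local Notation B := (@spform F U).
Hypothesis B_linl : forall y, linear (fun x => B x y : F^o).
Hypothesis B_linr : forall x, linear (fun y => B x y : F^o).
Hypothesis dim1 : forall s, hdim (U s) = 1%N.
Hypothesis B_neq0 : exists x y, B x y != 0.

Definition idx1 s : 'I_(hdim (U s)) := cast_ord (esym (dim1 s)) ord0.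

Lemma idx1P s (i : 'I_(hdim (U s))) : i = idx1 s.
Proof.
apply: val_inj; rewrite /=; have := ltn_ord i.
by rewrite [X in (_ < X)%N]dim1; case: (nat_of_ord i).
Qed.

Lemma mx1_scalar (R : comAlgType F) s (A : 'M[R]_(hdim (U s))) :
  A = (A (idx1 s) (idx1 s))%:M.
Proof. by apply/matrixP => i j; rewrite mxE (idx1P i) (idx1P j) eqxx. Qed.

Lemma spform_idx1_neq0 : B (hb (idx1 false)) (hb (idx1 true)) != 0.
Proof.
have [x [y]] := B_neq0; apply: contra => /eqP b0.
rewrite (hcoord_sum x) (linear_expand _ _ (B_linl _)) big1 // => i _.
rewrite (hcoord_sum y) (linear_expand _ _ (B_linr _)) big1 ?scaler0 // => j _.
by rewrite (idx1P i) (idx1P j) b0 scaler0.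
Qed.

Section Points.
Variable R : comAlgType F.

Definition aut1 s (phi : Aut_scheme U R) : R := aut_comp phi s (idx1 s) (idx1 s).

Lemma aut1E s phi : aut_comp phi s = (aut1 s phi)%:M.
Proof. exact: mx1_scalar. Qed.

(** The two basis vectors pair to a nonzero constant, so preserving the form makes the scalars
    mutually inverse. *)
Fact aut1P phi : aut1 true phi * aut1 false phi == 1.
Proof.
apply/eqP/(algA_inj spform_idx1_neq0); rewrite mulr1.
rewrite -[RHS](autR_form_basis (idx1 false) (idx1 true) (autRP phi)) !colE.
have e1 : (aut_mx phi).1 = (aut1 false phi)%:M := aut1E false phi.
have e2 : (aut_mx phi).2 = (aut1 true phi)%:M := aut1E true phi.
rewrite e1 e2 !mul_scalar_mx.
by rewrite formRZl formRZr formR_delta; ring.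
Qed.

Definition aut1_Gm (phi : Aut_scheme U R) : Gm F R := @GmPts F R (_, _) (aut1P phi).

End Points.

Lemma aut1_isomorphic : isomorphic_gf (Aut_scheme U) (Gm F).
Proof.
have scal_comp (R : comAlgType F) (l : Gm F R) s :
    aut_comp (scal_aut U l) s = (if s then (val l).1 else (val l).2)%:M.
  by case: s.
have fM (R : comAlgType F) (x y : Aut_scheme U R) :
    aut1_Gm (x * y)%g = (aut1_Gm x * aut1_Gm y)%g.
  by apply: val_inj; rewrite /= /aut1 !aut_compM !aut1E -!scalar_mxM !mxE !eqxx.
have fN (R S : comAlgType F) (g : {lrmorphism R -> S}) (x : Aut_scheme U R) :
    aut1_Gm (Defs.pmap g x) = Defs.pmap g (aut1_Gm x).
  by apply: val_inj; rewrite /= /aut1 !(@aut_comp_map F U) !mxE.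
have gM (R : comAlgType F) (x y : Gm F R) :
    scal_aut U (x * y)%g = (scal_aut U x * scal_aut U y)%g.
  apply: aut_comp_inj => s; rewrite aut_compM !scal_comp -scalar_mxM.
  by case: s.
have gN (R S : comAlgType F) (h : {lrmorphism R -> S}) (x : Gm F R) :
    scal_aut U (Defs.pmap h x) = Defs.pmap h (scal_aut U x).
  apply: aut_comp_inj => s; rewrite aut_comp_map !scal_comp map_scalar_mx.
  by case: s.
exists (@Gmor F (Aut_scheme U) (Gm F) aut1_Gm fM fN).
exists (@Gmor F (Gm F) (Aut_scheme U) (@scal_aut F U) gM gN); split=> R x.
  by apply: aut_comp_inj => s; rewrite scal_comp [RHS]aut1E; case: s.
apply: val_inj; rewrite /= /aut1 !scal_comp !mxE !eqxx.
by rewrite !mulr1n -surjective_pairing.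
Qed.

End OneDimensional.

Section OddTop.
Variables (F : fieldType) (n : nat) (M : superspace F).
Hypothesis charF : (2 : F) != 0.
Hypothesis dim_n : hdim M = n.
Hypothesis M_odd : forall k : 'I_(hdim M), hpar k = true.

Definition top_idx : tidx n M := [ffun i => cast_ord (esym dim_n) i].

(** An injective family permutes the basis. If an odd vector is repeated, a transposition shows that
    the product equals its opposite, hence is zero as 2 is invertible. *)
Lemma vee_top (t : tidx n M) : exists c, vee (hbt t) = c *: vee (hbt top_idx).
Proof.
have tp u : tpars (u : tidx n M) = fun=> true by apply: funext => i; apply: M_odd.
have [t_inj|t_ninj] := pselect (injective t).
  have s_inj : injective (fun i => cast_ord dim_n (t i)).
    by move=> i j /cast_ord_inj/t_inj.
  pose s := perm s_inj; exists (ksgn F s^-1%g (fun=> true)).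
  rewrite (vee_perm s^-1%g (hbt_gr top_idx)) tp scalerA ksgn_sqr scale1r.
  by apply: eq_vee => i; rewrite /hbt ffunE invgK permE cast_ordK.
exists 0; rewrite scale0r.
have [i [j [tij ij]]] : exists i j, t i = t j /\ i != j.
  apply: contrapT => h; apply: t_ninj => i j tij; apply/eqP/negPn/negP => ij.
  by apply: h; exists i, j.
have := vee_perm (tperm i j) (hbt_gr t).
rewrite tp ksgn_odd odd_tperm ij expr1 scaleN1r.
have -> : (fun k => hbt t ((tperm i j)^-1%g k)) = hbt t.
  by apply: funext => k; rewrite tpermV /hbt; case: tpermP => // ->; rewrite tij.
move/eqP; rewrite -addr_eq0 -mulr2n -scaler_nat scaler_eq0 (negPf charF) /=.
by move/eqP.
Qed.

Lemma sympow_top (w : sympow n M) : exists c, w = c *: vee (hbt top_idx).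
Proof.
exists (\sum_t vsval w t * projT1 (cid (vee_top t))).
rewrite {1}(sympow_sum w) scaler_suml; apply: eq_bigr => t _.
by case: cid => c /= ->; rewrite scalerA.
Qed.

End OddTop.

Section OddKernel.
Variables (F : fieldType) (V : superpair F) (n : nat).
Hypothesis VM : metric_generalized_jordan_superpair V.
Hypothesis charF : (2 : F) != 0.
Hypothesis V_odd : forall s, gr (V s) false = 0%VS.
Hypothesis V_dim : forall s, hdim (V s) = n.
Local Notation W := (sympair V n).

Lemma hpar_odd s (k : 'I_(hdim (V s))) : hpar k = true.
Proof. by rewrite /hpar V_odd dimv0. Qed.

Definition wtop s : W s := vee (hbt (top_idx (V_dim s))).

Lemma wtop_span s (w : W s) : exists c, w = c *: wtop s.
Proof. by apply: sympow_top => //; apply: hpar_odd. Qed.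

Lemma W_linl y : linear (fun x => @spform F W x y : F^o).
Proof. exact: (sympow_form_linl VM). Qed.

Lemma W_linr x : linear (fun y => @spform F W x y : F^o).
Proof. exact: (sympow_form_linr VM). Qed.

(** Pairing with the product of the dual basis reads off the determinant, and [c] is the sign [kap]
    of n odd factors. The case A = 1 shows that the form of W is nonzero. *)
Lemma top_form : exists2 c : F, c != 0 & exists w' : W false,
  @spform F W w' (wtop true) = c /\
  forall (R : comAlgType F) (A : 'M[R]_(hdim (V true))),
    @formR F R W (ext1 R w') (veeR (fun i => A *m ext1 R (hbt (top_idx (V_dim true)) i))) =
    c%:A * \det A.
Proof.
have [xi [xiE xi_gr]] := dual_basis VM.
pose f := top_idx (V_dim true).
have ht : (fun i => hpar (f i)) = fun=> true by apply: funext => i; apply: hpar_odd.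
exists (kap F (fun _ : 'I_n => true)); first exact: kap_neq0.
exists (vee (fun i => xi (f i))).
have E (R : comAlgType F) (A : 'M[R]_(hdim (V true))) :
    @formR F R W (ext1 R (vee (fun i => xi (f i)) : W false))
      (veeR (fun i => A *m ext1 R (hbt f i))) =
    (kap F (fun _ : 'I_n => true))%:A * \det A.
  rewrite ext1_vee (formR_veeR_dual VM _ _ xiE xi_gr) ht; congr (_ * _).
  rewrite -(det_entries A (V_dim true)); apply: eq_bigr => s _.
  rewrite ksgn_odd -(in_algE R) rmorph_sign; congr (_ * _).
  apply: eq_bigr => i _; rewrite /hbt ext1_hb -colE !mxE.
  by rewrite /f !ffunE.
split=> //; have := E F^o 1%:M; rewrite det1 mulr1.
have -> : (fun i => (1%:M : 'M[F^o]_(hdim (V true))) *m ext1 F^o (hbt f i)) =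
    (fun i => ext1 F^o (hbt f i)) by apply: funext => i; rewrite mul1mx.
rewrite -ext1_vee (formR_ext1 _ _ _ W_linl W_linr).
by rewrite /GRing.scale /= !mulr1.
Qed.

Lemma W_neq0 : exists x y, @spform F W x y != 0.
Proof. by have [c c0 [w [e _]]] := top_form; exists w, (wtop true); rewrite e. Qed.

Lemma wtop_neq0 s : wtop s != 0.
Proof.
have [x [y]] := W_neq0; have [cx ->] := wtop_span x; have [cy ->] := wtop_span y.
apply: contra => /eqP w0; case: s w0 => ->; rewrite scaler0.
  by rewrite (lin0 (W_linr _)).
by rewrite (lin0 (W_linl _)).
Qed.

Lemma W_dim s : hdim (W s) = 1%N.
Proof. exact: vline_hdim1 (wtop_neq0 s) (@wtop_span s). Qed.

Lemma W_nondeg (x : W false) : (forall y, @spform F W x y = 0) -> x = 0.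
Proof.
have [c c0 [w [e _]]] := top_form.
have [d wE] := wtop_span w.
have b0 : @spform F W (wtop false) (wtop true) != 0.
  by apply: contra c0 => /eqP b0; rewrite -e wE (linZ (W_linl _)) b0 scaler0.
have [d' ->] := wtop_span x; move=> /(_ (wtop true)).
rewrite (linZ (W_linl _)) /GRing.scale /= => /eqP; rewrite mulf_eq0 (negPf b0) orbF => /eqP ->.
exact: scale0r.
Qed.

(** W^+ is the line of [wtop true], on which [A] acts by its determinant. Once this component is
    trivial, preservation of the nondegenerate form makes the one on W^- trivial too. *)
Lemma gker_det (R : comAlgType F) (phi : Aut_scheme V R) :
  gker (Omega n VM) phi <-> \det (aut_comp phi true) = 1.
Proof.
set A := aut_comp phi true; have Ae : evenmx A := @aut_even F V R phi true.
have [c c0 [w [wc wA]]] := top_form.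
pose f := top_idx (V_dim true).
have fE : formR (ext1 R w) (ext1 R (wtop true)) = c%:A.
  by rewrite (formR_ext1 _ _ _ W_linl W_linr) wc.
have AE : vpow n A *m ext1 R (wtop true) = \det A *: ext1 R (wtop true).
  have [d dE] : exists d : R, vpow n A *m ext1 R (wtop true) = d *: ext1 R (wtop true).
    have [q ->] := E_span (vpow n A *m ext1 R (wtop true)).
    exists (\sum_t q t * (projT1 (cid (wtop_span (vee (hbt t) : W true))))%:A).
    rewrite scaler_suml; apply: eq_bigr => t _; case: cid => e /= et.
    by rewrite {1}et ext1Z scalerA.
  rewrite dE; congr (_ *: _); apply: (algA_inj c0).
  by rewrite -wA -vpow_E // -/(wtop true) dE formRZr fE mulrC.
split=> [|A1].
  move=> /(congr1 (fun psi => aut_comp psi true)).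
  rewrite OmegaE aut_comp1 -/A => A1; apply: (algA_inj c0).
  by rewrite mulr1 -fE mulrC -formRZr -AE A1 mul1mx.
have Om1 : aut_comp (Omega n VM R phi) true = 1%:M.
  rewrite OmegaE; apply: (@eq_on_E F R n (V true)) => t.
  have [d ->] := wtop_span (vee (hbt t) : W true).
  by rewrite ext1Z -!scalemxAr AE A1 scale1r mul1mx.
apply: aut_comp_inj => s; rewrite aut_comp1; case: s => //.
apply: (@eq_on_E F R n (V false)) => t.
apply: (formR_injl W_linl W_linr W_nondeg) => y.
have := autR_form (autRP (Omega n VM R phi)) (ext1 R (vee (hbt t) : W false)) y.
have -> : (aut_mx (Omega n VM R phi)).2 = 1%:M by exact: Om1.
by rewrite !mul1mx.
Qed.

End OddKernel.

Section MuKernel.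
Variables (F : fieldType) (V : superpair F) (n : nat).
Hypothesis VM : metric_generalized_jordan_superpair V.
Let B_linl := form_linear1 (mgjs_metric VM).
Let B_linr := form_linear2 (mgjs_metric VM).

Lemma gker_mu (R : comAlgType F) (phi : Aut_scheme V R) : (1 < n)%N ->
  (\dim (gr (V true) false) = 0%N -> (n < hdim (V true))%N) ->
  ((0 < \dim (gr (V true) false))%N -> (n`!%:R : F) != 0) ->
  gker (Omega n VM) phi <-> mu_aut n phi.
Proof.
move=> n1 dim0 fact0; split=> [ker|[l [ln ->]]]; last first.
  move/(congr1 val): ln; rewrite val_Gm_exp => -[l1 l2].
  apply: aut_comp_inj => s; rewrite OmegaE aut_comp1.
  by case: s; rewrite /aut_comp /= vpow_scalar ?l1 ?l2.
have A1 : vpow n (aut_comp phi true) = 1%:M.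
  by rewrite -(OmegaE _ VM) (_ : Omega n VM R phi = 1%g) ?aut_comp1.
have [l [lE ln]] := vpow_kernel_scalar VM n1 dim0 fact0 (@aut_even F V R phi true) A1.
(* A point of [Gm] carries its inverse, here l^(n-1) since l^n = 1. *)
have ll : l * l ^+ n.-1 == 1 by rewrite -exprS prednK ?ln // ltnW.
exists (@GmPts F R (l, l ^+ n.-1) ll); split.
  apply: val_inj; rewrite val_Gm_exp /= ln; congr pair.
  by rewrite -exprM mulnC exprM ln expr1n.
apply: aut_comp_inj => -[]; first exact: lE.
apply/matrixP => i j.
(* The component on V^- is forced to be the inverse scalar, because the form is preserved. *)
suff : aut_comp phi false *m delta_mx j 0 =
    l ^+ n.-1 *: (delta_mx j 0 : 'cV[R]_(hdim (V false))).
  rewrite -colE => /matrixP/(_ i 0); rewrite !mxE eqxx andbT => ->.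
  by rewrite mulr_natr.
apply: (formR_injl B_linl B_linr (form_nondeg1 (mgjs_metric VM))) => y.
rewrite formRZl -(autR_form (autRP phi) (delta_mx j 0) y).
have -> : (aut_mx phi).2 = l%:M by exact: lE.
by rewrite mul_scalar_mx formRZr mulrA [_ * l]mulrC (eqP ll) mul1r.
Qed.

End MuKernel.

Theorem proposition8p4 (F : fieldType) (charF : (2 : F) != 0)
    (V : superpair F) (V_metric : metric_generalized_jordan_superpair V)
    (V_neq0 : exists (s : bool) (x : V s), x != 0)
    (n : nat) (n_gt1 : (1 < n)%N)
    (dim_odd : \dim (gr (V true) false) = 0%N ->
       (n <= \dim (gr (V true) true))%N)
    (char_gt : (0 < \dim (gr (V true) false))%N ->
       forall p : nat, p \in [pchar F] -> (n < p)%N) :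
  let W := sympair V n in
  (* 1) *)
  ((forall (p q : nat) (f : 'I_n -> V false) (v : 'I_n -> V true),
      (p <= n)%N -> (q <= n)%N -> parity_ordered p f -> parity_ordered q v ->
      @spform F W (vee f) (vee v) =
        omega (n - p) * perdet p (\matrix_(i, j) @spform F V (f i) (v j)) /\
      (p != q -> @spform F W (vee f) (vee v) = 0)) /\
   (forall B : W false -> W true -> F,
      (forall y, linear (fun x => B x y : F^o)) ->
      (forall x, linear (fun y => B x y : F^o)) ->
      (forall (p q : nat) (f : 'I_n -> V false) (v : 'I_n -> V true),
         (p <= n)%N -> (q <= n)%N ->
         parity_ordered p f -> parity_ordered q v ->
         B (vee f) (vee v) =
           omega (n - p) * perdet p (\matrix_(i, j) @spform F V (f i) (v j))) ->
      forall x y, @spform F W x y = B x y)) /\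
  (* 2) *)
  (forall (s : bool) (p q : nat)
      (f : 'I_n -> V (~~ s)) (v : 'I_n -> V s),
    (p <= n)%N -> (q <= n)%N -> parity_ordered p f -> parity_ordered q v ->
    let B := \matrix_(i, j) pairing (f i) (v j) in
    @nu F W (~~ s) s (vee f) (vee v) =
      omega (n - p) *: \sum_(i < n) \sum_(j < n)
        (scheck p q i j * superminor p q B i j) *:
          sympair_act n (nu (f i) (v j))) /\
  (* 3) *)
  (forall (s : bool) (p q r : nat)
      (f : 'I_n -> V (~~ s)) (v : 'I_n -> V s) (g : 'I_n -> V (~~ s)),
    (p <= n)%N -> (q <= n)%N -> (r <= n)%N ->
    parity_ordered p f -> parity_ordered q v -> parity_ordered r g ->
    let B := \matrix_(i, j) pairing (f i) (v j) in
    @trip F W (~~ s) s (vee f) (vee v) (vee g) =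
      omega (n - p) *: \sum_(i < n) \sum_(j < n) \sum_(k < n)
        (scheck p q i j * superminor p q B i j *
         \prod_(t < n | (t < k)%N) eta (par (g t)) (par (f i) (+) par (v j))) *:
        vee (fun t => if t == k then trip (f i) (v j) (g k) else g t)) /\
  (* 4) *)
  (affine_group_scheme (Aut_scheme V) /\ affine_group_scheme (Aut_scheme W) /\
   exists Omega : gmor (Aut_scheme V) (Aut_scheme W),
     (forall (R : comAlgType F) (phi : Aut_scheme V R) (s : bool)
         (x : 'I_n -> 'cV[R]_(hdim (V s))),
       aut_comp (Omega R phi) s *m veeR x =
         veeR (fun i => aut_comp phi s *m x i)) /\
     let odd_of_dim_n := (forall s : bool, gr (V s) false = 0%VS) /\
                         (forall s : bool, \dim {: V s} = n) in
     (* i) *)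
     (odd_of_dim_n ->
       (forall (R : comAlgType F) (phi : Aut_scheme V R),
          gker Omega phi <-> \det (aut_comp phi true) = 1) /\
       isomorphic_gf (Aut_scheme W) (Gm F) /\
       quotient_embeds (gker Omega) (Aut_scheme W)) /\
     (* ii) *)
     (~ odd_of_dim_n ->
       (forall (R : comAlgType F) (phi : Aut_scheme V R),
          gker Omega phi <-> mu_aut n phi) /\
       quotient_embeds (@mu_aut F V n) (Aut_scheme W))).
Proof.
move=> W; split; first by split;
  [exact: (form_perdet V_metric)|exact: (form_perdet_uniq V_metric)].
split; first exact: (nu_sympair_superminor V_metric).
split; first exact: (trip_sympair_superminor V_metric).
split; first exact: Aut_scheme_affine; split; first exact: Aut_scheme_affine.
exists (Omega n V_metric); split; first exact: Omega_veeR.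
split=> [[V_odd V_dim]|not_odd].
  have V_dim' s : hdim (V s) = n by rewrite hdimE.
  split; first by move=> R phi; apply: gker_det.
  split; last first.
    by apply: (Aut_quotient_embeds (aut_coordinates V) (th := Omega n V_metric)).
  apply: aut1_isomorphic (W_linl V_metric) (W_linr V_metric) _ _.
    exact: (W_dim V_metric charF V_odd V_dim').
  exact: (W_neq0 V_metric V_odd V_dim').
have ker (R : comAlgType F) (phi : Aut_scheme V R) :
    gker (Omega n V_metric) phi <-> mu_aut n phi.
  apply: gker_mu => // [d0|d0]; last exact: fact_neq0 (char_gt d0).
  (* When V^+ is odd, [dim_odd] leaves only the equality with n to exclude: the form would make V^-
     odd of dimension n as well, which is case i). *)
  rewrite ltn_neqAle /hdim d0 add0n (dim_odd d0) andbT; apply/negP => /eqP nE.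
  have V0 : gr (V true) false = 0%VS by apply/eqP; rewrite -dimv_eq0 d0.
  have hn : hdim (V true) = n by rewrite /hdim d0 nE.
  apply: not_odd; split=> -[] //; rewrite -?hdimE //.
    exact: (even_part_form V_metric).
  by rewrite (hdim_form V_metric).
split=> //; exact: (Aut_quotient_embeds (aut_coordinates V) ker).
Qed.
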